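(* Let $(A,[\cdot,\cdot],\rho)$ be a Lie algebroid over $M$, let $\mathrm{top}=\mathrm{rank}\,A$, and let $B=\{x\in M:\rho_x=0\}$ and $B^c=\{x\in M:\rho_x\neq0\}$. Every $(\mathrm{top}+1)$-differential $\delta=(\delta^{(0)}=0,\delta^{(1)})$ on $A$ corresponds to a section $\pi\in\Gamma(TM\otimes(\wedge^{\mathrm{top}}A))$ which vanishes on the sets $B^c$ and $$\{x\in B:\ \text{the adjoint character of }A_x\text{ is nontrivial}\},$$ such that $\delta^{(1)}(f)=(-1)^{\mathrm{top}}\iota_{df}\pi$ for all $f\in C^\infty(M)$. Conversely, any such $\pi$ determines a $(\mathrm{top}+1)$-differential $\delta$ in this way.
   Context: The Schouten bracket on $\Gamma(\wedge^\bullet A)$ extends the bracket of $\Gamma(A)$ with $[u,f]=\rho(u)f$, $[X,Y]=-(-1)^{(|X|-1)(|Y|-1)}[Y,X]$, $[X,Y\wedge Z]=[X,Y]\wedge Z+(-1)^{(|X|-1)|Y|}Y\wedge[X,Z]$, with $|X|=p$ for $X\in\Gamma(\wedge^pA)$. A $k$-differential on $A$ is an $\mathbb{R}$-linear map $\delta:\Gamma(\wedge^\bullet A)\to\Gamma(\wedge^{\bullet+k-1}A)$ with $\delta(X\wedge Y)=\delta(X)\wedge Y+(-1)^{(k-1)|X|}X\wedge\delta(Y)$ and $\delta[X,Y]=[\delta(X),Y]+(-1)^{(k-1)(|X|-1)}[X,\delta(Y)]$. It is determined by $\delta^{(0)}=\delta|_{\Gamma(A)}:\Gamma(A)\to\Gamma(\wedge^kA)$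 and $\delta^{(1)}=\delta|_{C^\infty(M)}:C^\infty(M)\to\Gamma(\wedge^{k-1}A)$; for $k=\mathrm{top}+1$ one has $\delta^{(0)}=0$. $\iota_{df}\pi$ is the contraction in the $TM$ factor. For $x\in B$ the fibre $A_x$ is a Lie algebra with the bracket induced from $A$; its adjoint character is the map $A_x\to\mathbb{R}$, $u\mapsto\mathrm{tr}(\mathrm{ad}_u)$. *)

(* Defs.v *)
From HB Require Import structures.
From mathcomp Require Import all_boot all_order all_algebra.
From mathcomp Require Import all_classical all_reals all_analysis.

Set Implicit Arguments.
Unset Strict Implicit.
Unset Printing Implicit Defensive.

Import Order.TTheory GRing.Theory Num.Theory.
Import numFieldNormedType.Exports.

Local Open Scope classical_set_scope.
Local Open Scope ring_scope.

(* [U] is meant to be open, so that continuity and partial derivatives at the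
   points of [U] do not depend on the values of [f] outside [U]. *)
Fixpoint Ck (R : realType) (n k : nat) (U : set 'rV[R]_n)
    (f : 'rV[R]_n -> R) : Prop :=
  (forall p, U p -> continuous_at p f) /\
  (if k is k'.+1 then
     forall i : 'I_n,
       (forall p, U p -> derivable f p (delta_mx 0 i)) /\
       Ck k' U (fun p => 'D_(delta_mx 0 i) f p)
   else True).

Definition Cinfty (R : realType) (n : nat) (U : set 'rV[R]_n)
    (f : 'rV[R]_n -> R) : Prop :=
  forall k, Ck k U f.

(* The atlas is indexed by the points of the manifold: [phi x], with inverse
   [psi x], is a chart on an open neighbourhood [dom x] of [x].  Every smooth
   atlas contains an equivalent one of this form. *)
Record manifold (R : realType) (n : nat) := Manifold {
  carrier :> topologicalType;
  dom : carrier -> set carrier;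
  phi : carrier -> carrier -> 'rV[R]_n;
  psi : carrier -> 'rV[R]_n -> carrier;
  manifold_hausdorff : hausdorff_space carrier;
  manifold_second_countable : @second_countable carrier;
  dom_open : forall x, open (dom x);
  dom_center : forall x, dom x x;
  phi_open : forall x, open (phi x @` dom x);
  phi_continuous : forall x y, dom x y -> continuous_at y (phi x);
  psi_continuous : forall x p, (phi x @` dom x) p -> continuous_at p (psi x);
  phiK : forall x y, dom x y -> psi x (phi x y) = y;
  transition_smooth : forall x0 x1 (j : 'I_n),
    Cinfty (phi x0 @` (dom x0 `&` dom x1)) (fun p => phi x1 (psi x0 p) 0 j)
}.

Definition smooth_on (R : realType) (n : nat) (M : manifold R n) (W : set M)
    (f : M -> R) : Prop :=
  forall x0 : M, Cinfty (phi x0 @` (dom x0 `&` W)) (fun p => f (psi x0 p)).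

Definition smooth (R : realType) (n : nat) (M : manifold R n) (f : M -> R) :=
  smooth_on setT f.

Definition dualspace (R : realType) (V : vectType R) : vectType R :=
  'Hom(V, R^o).

(* A tangent vector at [x] is given by its components in the chart [phi x]. *)
Definition tangent (R : realType) (n : nat) (M : manifold R n) (x : M) :
  vectType R := 'rV[R]_n.

Definition differential (R : realType) (n : nat) (M : manifold R n)
    (f : M -> R) (x : M) : dualspace (tangent x) :=
  linfun (fun v : 'rV[R]_n =>
    (\sum_(i < n)
       'D_(delta_mx 0 i) (fun p => f (psi x p)) (phi x x) * v 0 i) : R^o).

(* [dx x0 j] is the differential of the j-th coordinate function of the chart
   [phi x0]; only its values on [dom x0] are meaningful.  The components of a
   tangent vector [v] at [y] in the chart [phi x0] are the [dx x0 j y v]. *)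
Definition dx (R : realType) (n : nat) (M : manifold R n) (x0 : M) (j : 'I_n)
    (y : M) : dualspace (tangent y) :=
  differential (fun z => phi x0 z 0 j) y.

Definition smooth_vector_field (R : realType) (n : nat) (M : manifold R n)
    (v : forall x : M, tangent x) : Prop :=
  forall (x0 : M) (j : 'I_n), smooth_on (dom x0) (fun y => dx x0 j y (v y)).

(* [triv x0] is a local trivialization on an open neighbourhood [bdom x0] of
   [x0]; [triv x0 y] is only meaningful for [y] in [bdom x0]. *)
Record vbundle (R : realType) (n : nat) (M : manifold R n) (r : nat) :=
  VBundle {
  fib : M -> vectType R;
  bdom : M -> set M;
  triv : M -> forall y : M, 'Hom(fib y, 'rV[R]_r);
  bdom_open : forall x, open (bdom x);
  bdom_center : forall x, bdom x x;
  triv_bij : forall x0 y, bdom x0 y -> bijective (triv x0 y);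
  triv_smooth : forall x0 x1 (i j : 'I_r),
    smooth_on (bdom x0 `&` bdom x1)
      (fun y => triv x1 y ((triv x0 y)^-1%VF (delta_mx 0 i)) 0 j)
}.

Definition section (R : realType) (n : nat) (M : manifold R n) (r : nat)
    (A : vbundle M r) := forall x : M, fib A x.

Definition smooth_section (R : realType) (n : nat) (M : manifold R n)
    (r : nat) (A : vbundle M r) (u : section A) : Prop :=
  forall (x0 : M) (i : 'I_r),
    smooth_on (bdom A x0) (fun y => triv A x0 y (u y) 0 i).

(* The local frame of the dual bundle attached to a trivialization. *)
Definition coframe (R : realType) (n : nat) (M : manifold R n) (r : nat)
    (A : vbundle M r) (x0 : M) (i : 'I_r) (y : M) : dualspace (fib A y) :=
  linfun (fun a : fib A y => (triv A x0 y a 0 i) : R^o).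

(* The exterior power of degree p of a finite dimensional space V is realized
   as the space of alternating p-linear forms on the dual of V, where
   u_1 /\ ... /\ u_p is the form (a_1, ..., a_p) |-> det (a_i (u_j)).  Using
   lists of covectors as arguments, all degrees live in the same type, and an
   element of degree p is a form that is zero on the lists of size different
   from p.  Degrees are integers; in negative degree there is only 0. *)
Definition multivector (R : realType) (V : vectType R) :=
  seq (dualspace V) -> R.

Definition in_ext (R : realType) (V : vectType R) (p : int)
    (X : multivector V) : Prop :=
  [/\ forall (s t : seq (dualspace V)) (c : R) (a b : dualspace V),
        X (s ++ (c *: a + b) :: t) = c * X (s ++ a :: t) + X (s ++ b :: t),
      forall (s t w : seq (dualspace V)) (a : dualspace V),
        X (s ++ a :: t ++ a :: w) = 0
    & forall s : seq (dualspace V), (size s)%:Z <> p -> X s = 0].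

(* A bit mask [m] encodes a shuffle: the positions at which it is true come
   first.  This is the number of inversions of the shuffle. *)
Definition inversions (m : bitseq) : nat :=
  (\sum_(i < size m) \sum_(j < size m | (i < j)%N)
     (~~ nth false m i && nth false m j))%N.

Definition wedge (R : realType) (V : vectType R) (X Y : multivector V) :
    multivector V :=
  fun s => \sum_(m : (size s).-tuple bool)
    (-1) ^+ inversions m * X (mask m s) * Y (mask (map negb m) s).

Definition mvfield (R : realType) (n : nat) (M : manifold R n) (r : nat)
    (A : vbundle M r) := forall x : M, multivector (fib A x).

(* [Gamma p X] : the field [X] is a smooth section of the p-th exterior power
   of [A]. *)
Definition Gamma (R : realType) (n : nat) (M : manifold R n) (r : nat)
    (A : vbundle M r) (p : int) (X : mvfield A) : Prop :=
  (forall x, in_ext p (X x)) /\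
  (forall (x0 : M) (I : seq 'I_r),
     smooth_on (bdom A x0) (fun y => X y [seq coframe A x0 i y | i <- I])).

Section MultivectorFieldOperations.
Variables (R : realType) (n : nat) (M : manifold R n) (r : nat).
Variable (A : vbundle M r).

Definition mv0 : mvfield A := fun _ _ => 0.
Definition mv_add (X Y : mvfield A) : mvfield A := fun x s => X x s + Y x s.
Definition mv_scale (c : R) (X : mvfield A) : mvfield A := fun x s => c * X x s.
Definition mv_wedge (X Y : mvfield A) : mvfield A :=
  fun x => wedge (X x) (Y x).

(* Functions and sections of [A] as multivector fields of degree 0 and 1. *)
Definition mv_fun (f : M -> R) : mvfield A :=
  fun x s => if s is [::] then f x else 0.
Definition mv_section (u : section A) : mvfield A :=
  fun x s => if s is [:: a] then a (u x) else 0.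

End MultivectorFieldOperations.

Arguments mv0 {R n M r} A.
Arguments mv_fun {R n M r} A f.

Definition lie_derivative (R : realType) (n : nat) (M : manifold R n)
    (v : forall x : M, tangent x) (f : M -> R) : M -> R :=
  fun x => differential f x (v x).

Record lie_algebroid (R : realType) (n : nat) (M : manifold R n) (r : nat)
    (A : vbundle M r) := LieAlgebroid {
  bracket : section A -> section A -> section A;
  anchor : forall x : M, 'Hom(fib A x, tangent x);
  anchor_smooth : forall u : section A, smooth_section u ->
    smooth_vector_field (fun x => anchor x (u x));
  bracket_smooth : forall u v : section A,
    smooth_section u -> smooth_section v -> smooth_section (bracket u v);
  bracket_linear : forall (c : R) (u v w : section A),
    smooth_section u -> smooth_section v -> smooth_section w ->
    bracket (fun x => c *: u x + v x) w =
    (fun x => c *: bracket u w x + bracket v w x);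
  bracket_antisym : forall u v : section A,
    smooth_section u -> smooth_section v ->
    bracket u v = (fun x => - bracket v u x);
  bracket_jacobi : forall u v w : section A,
    smooth_section u -> smooth_section v -> smooth_section w ->
    forall x, bracket u (bracket v w) x + bracket v (bracket w u) x
            + bracket w (bracket u v) x = 0;
  bracket_leibniz : forall (u v : section A) (f : M -> R),
    smooth_section u -> smooth_section v -> smooth f ->
    bracket u (fun x => f x *: v x) =
    (fun x => f x *: bracket u v x +
              lie_derivative (fun y => anchor y (u y)) f x *: v x)
}.

Section LieAlgebroidTheory.
Variables (R : realType) (n : nat) (M : manifold R n) (r : nat).
Variables (A : vbundle M r) (L : lie_algebroid A).

(* Over a zero of the anchor, [m] is the Lie bracket induced on the fibre: by
   the Leibniz rule, [u, v] x depends only on u x and v x. *)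
Definition is_fibre_bracket (x : M) (m : fib A x -> fib A x -> fib A x) :=
  forall u v : section A, smooth_section u -> smooth_section v ->
    m (u x) (v x) = bracket L u v x.

Definition lfun_trace (V : vectType R) (g : 'End(V)) : R :=
  \tr (passmx.mxof (vbasis {:V}) (vbasis {:V}) g).

Definition adjoint_character (x : M) (m : fib A x -> fib A x -> fib A x)
    (a : fib A x) : R :=
  lfun_trace (linfun (m a)).

Definition adjoint_character_nontrivial (x : M) : Prop :=
  exists m : fib A x -> fib A x -> fib A x,
    is_fibre_bracket m /\ exists a, adjoint_character m a <> 0.

(* These properties characterize the Schouten bracket on fields of
   homogeneous degree.  Degree -1 being zero, it vanishes on two functions. *)
Record is_schouten_bracket (S : mvfield A -> mvfield A -> mvfield A) : Prop :=
  IsSchoutenBracket {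
  schouten_degree : forall (p q : int) X Y, Gamma p X -> Gamma q Y ->
    Gamma (p + q - 1) (S X Y);
  schouten_linearl : forall (p q : int) c X X' Y,
    Gamma p X -> Gamma p X' -> Gamma q Y ->
    S (mv_add (mv_scale c X) X') Y = mv_add (mv_scale c (S X Y)) (S X' Y);
  schouten_linearr : forall (p q : int) c X Y Y',
    Gamma p X -> Gamma q Y -> Gamma q Y' ->
    S X (mv_add (mv_scale c Y) Y') = mv_add (mv_scale c (S X Y)) (S X Y');
  schouten_section : forall u v : section A,
    smooth_section u -> smooth_section v ->
    S (mv_section u) (mv_section v) = mv_section (bracket L u v);
  schouten_fun : forall (u : section A) (f : M -> R),
    smooth_section u -> smooth f ->
    S (mv_section u) (mv_fun A f) =
    mv_fun A (lie_derivative (fun x => anchor L x (u x)) f);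
  schouten_antisym : forall (p q : int) X Y, Gamma p X -> Gamma q Y ->
    S X Y = mv_scale (- (-1) ^ ((p - 1) * (q - 1))) (S Y X);
  schouten_leibniz : forall (p q l : int) X Y Z,
    Gamma p X -> Gamma q Y -> Gamma l Z ->
    S X (mv_wedge Y Z) =
    mv_add (mv_wedge (S X Y) Z)
           (mv_scale ((-1) ^ ((p - 1) * q)) (mv_wedge Y (S X Z)))
}.

(* Maps on multivector fields are only meaningful on smooth fields of
   homogeneous degree. *)
Record is_differential (S : mvfield A -> mvfield A -> mvfield A) (k : nat)
    (delta : mvfield A -> mvfield A) : Prop := IsDifferential {
  differential_degree : forall (p : int) X, Gamma p X ->
    Gamma (p + k%:Z - 1) (delta X);
  differential_linear : forall (p : int) c X Y, Gamma p X -> Gamma p Y ->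
    delta (mv_add (mv_scale c X) Y) =
    mv_add (mv_scale c (delta X)) (delta Y);
  differential_wedge : forall (p q : int) X Y, Gamma p X -> Gamma q Y ->
    delta (mv_wedge X Y) =
    mv_add (mv_wedge (delta X) Y)
           (mv_scale ((-1) ^ ((k%:Z - 1) * p)) (mv_wedge X (delta Y)));
  differential_bracket : forall (p q : int) X Y, Gamma p X -> Gamma q Y ->
    delta (S X Y) =
    mv_add (S (delta X) Y)
           (mv_scale ((-1) ^ ((k%:Z - 1) * (p - 1))) (S X (delta Y)))
}.

(* The tensor product of the tangent space at [x] with W is realized as the
   space of linear maps from the cotangent space at [x] to W. *)
Definition tensor_field :=
  forall x : M, dualspace (tangent x) -> multivector (fib A x).

Definition vanishes_at (pi : tensor_field) (x : M) : Prop :=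
  forall a s, pi x a s = 0.

(* [pi] is a smooth section of TM (x) (r-th exterior power of A). *)
Definition is_top_tensor_section (pi : tensor_field) : Prop :=
  [/\ forall (x : M) (c : R) (a b : dualspace (tangent x)) s,
        pi x (c *: a + b) s = c * pi x a s + pi x b s,
      forall (x : M) (a : dualspace (tangent x)), in_ext r%:Z (pi x a)
    & forall (x0 x1 : M) (j : 'I_n) (I : seq 'I_r),
        smooth_on (dom x0 `&` bdom A x1)
          (fun y => pi y (dx x0 j y) [seq coframe A x1 i y | i <- I])].

Definition iota_d (f : M -> R) (pi : tensor_field) : mvfield A :=
  fun x => pi x (differential f x).

Definition admissible (pi : tensor_field) : Prop :=
  [/\ is_top_tensor_section pi,
      forall x, anchor L x <> 0 -> vanishes_at pi x
    & forall x, anchor L x = 0 -> adjoint_character_nontrivial x ->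
        vanishes_at pi x].

End LieAlgebroidTheory.

(* Main.v *)
Require Import Defs.
From HB Require Import structures.
From mathcomp Require Import all_boot all_order all_algebra.
From mathcomp Require Import all_classical all_reals all_analysis.
From mathcomp Require Import ring lra zify.

Set Implicit Arguments.
Unset Strict Implicit.
Unset Printing Implicit Defensive.

Import Order.TTheory GRing.Theory Num.Theory.
Import numFieldNormedType.Exports.
Local Open Scope ring_scope.

(** Write r for the rank of A and D f for the value of a differential delta on
    a function f.  For degree reasons delta vanishes on sections, so delta is
    carried by D, which is a derivation of the smooth functions with values in
    the top multivector fields.  At a point, a derivation sees only the
    differential of the function: by Hadamard's lemma a function with zero
    value and zero differential is locally a sum of products of two functions
    vanishing there ([hadamard], [pd_differential0]).  This gives a tensor pi,
    the [symbol] of delta, with D f = pi(df) up to the sign.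

    Compatibility with the bracket of a section u and a function f reads
    D (rho(u) f) = [u, D f].  In a local frame e_1, ..., e_r with coframe eps,
    a top field Z = z e_1 /\ ... /\ e_r has a bracket [u, Z] with coefficient
    rho(u) z + z T(u), where T(u) is the sum of the eps_k([u, e_k])
    ([schouten_top]).  The number T(u) is not linear over functions:
    T(h u) = h T(u) - rho(u) h ([frame_trace_scale]).  Comparing the identity
    for u with the one for h u therefore leaves
    D h . rho(u) f + D f . rho(u) h = 0 ([dcoef_anchor]), and at a point where
    rho is nonzero this forces D = 0.  Hence, near a point x where pi is
    nonzero, the anchor vanishes identically; both rho(u) f and rho(u) z are
    then zero near x and the identity is reduced to z T(u) = 0.  At a zero of
    the anchor T(u) is the trace of ad_u ([frame_trace_adjoint]), so the adjoint
    character vanishes at x ([symbol_admissible]).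

    Conversely, given pi, let delta be pi(df) on functions and zero in the other
    degrees.  All the identities hold for degree reasons except the derivation
    rule on functions, the identity D (rho(u) f) = [u, D f], and
    [D f, g] + [D g, f] = 0.  The last two are checked at each point x
    ([ham_rho], [schouten_ham_fun]).  If pi is nonzero at x then the anchor is
    zero near x and T = 0 at x, and all terms vanish.  If pi is zero at x then
    either the anchor is zero at x, which kills the terms with a derivative, or
    it is nonzero near x, and then pi vanishes near x. *)

(** * Functions of class C^k on an open subset of R^n *)

Section Calculus.
Local Open Scope classical_set_scope.
Local Open Scope ring_scope.
Context {R : realType}.

Lemma Ck_sub (n k : nat) (U V : set 'rV[R]_n) f : V `<=` U -> Ck k U f -> Ck k V f.
Proof.
move=> VU; elim: k f => [|k IH] f [cf df]; split=> //; first by move=> p /VU /cf.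
  by move=> p /VU /cf.
move=> i; have [di Di] := df i; split; first by move=> p /VU /di.
exact: IH.
Qed.

Lemma CkS (n k : nat) (U : set 'rV[R]_n) f : Ck k.+1 U f -> Ck k U f.
Proof.
elim: k f => [|k IH] f [cf df]; split=> // i; have [di Di] := df i.
by split=> //; apply: IH.
Qed.

(** Membership in C^k over U is a condition at the points of U on the germs
    of f alone; this is what reduces smoothness to a local question. *)
Lemma Ck_pointwise (n k : nat) (U : set 'rV[R]_n) f :
  (forall p, U p -> exists2 V : set 'rV[R]_n, V p & Ck k V f) -> Ck k U f.
Proof.
elim: k f => [|k IH] f H.
  by split=> // p /H[V Vp [cf _]]; exact: cf.
split=> [p /H[V Vp [cf _]]|i]; first exact: cf.
split=> [p /H[V Vp [_ /(_ i)[df _]]]|]; first exact: df.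
apply: IH => p /H[V Vp [_ /(_ i)[_ df]]]; by exists V.
Qed.

Lemma Ck_eq (n k : nat) (U : set 'rV[R]_n) f g :
  open U -> (forall p, U p -> f p = g p) -> Ck k U f -> Ck k U g.
Proof.
move=> oU; have nU p : U p -> nbhs p U by move=> Up; exact: open_nbhs_nbhs.
have near_fg (f1 g1 : _ -> R) p : (forall p, U p -> f1 p = g1 p) -> U p -> {near p, f1 =1 g1}.
  by move=> fg Up; near=> q; apply: fg; near: q; exact: nU.
have ct (f1 g1 : _ -> R) p : (forall p, U p -> f1 p = g1 p) -> U p -> continuous_at p f1 ->
  continuous_at p (g1 : _ -> R).
  move=> fg Up cf; rewrite /continuous_at -(fg _ Up); apply: cvg_trans cf.
  by apply: (@near_eq_cvg _ _ (nbhs p)); exact: near_fg.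
elim: k f g => [|k IH] f g fg [cf df]; (split; first by move=> p Up; exact: ct (cf p Up)) => //.
move=> i; have [di Di] := df i; split=> [p Up|].
  exact: near_eq_derivable (near_fg _ _ p fg Up) (di p Up).
apply: IH Di => p Up; apply: near_eq_derive; exact: near_fg.
Unshelve. all: by end_near. Qed.

Lemma Ck_cst (n k : nat) (U : set 'rV[R]_n) (c : R) : Ck k U (fun=> c).
Proof.
elim: k c => [|k IH] c; (split; first by move=> p _; exact: cst_continuous) => // i.
split=> [p _|]; first exact: derivable_cst.
rewrite [X in Ck _ _ X](_ : _ = (fun=> 0)); first exact: IH.
by apply/funext => p; exact: derive_cst.
Qed.

Lemma CkD (n k : nat) (U : set 'rV[R]_n) f g : open U ->
  Ck k U f -> Ck k U g -> Ck k U (fun p => f p + g p).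
Proof.
move=> oU; elim: k f g => [|k IH] f g [cf df] [cg dg].
  by split=> // p Up; exact: (continuousD (cf p Up) (cg p Up)).
split=> [p Up|i]; first exact: (continuousD (cf p Up) (cg p Up)).
have [dfi Dfi] := df i; have [dgi Dgi] := dg i; split.
  by move=> p Up; apply: derivableD; [exact: dfi|exact: dgi].
apply: Ck_eq oU _ (IH _ _ Dfi Dgi) => p Up.
by rewrite [RHS]deriveD //; [exact: dfi|exact: dgi].
Qed.

Lemma CkM (n k : nat) (U : set 'rV[R]_n) f g : open U ->
  Ck k U f -> Ck k U g -> Ck k U (fun p => f p * g p).
Proof.
move=> oU; elim: k f g => [|k IH] f g Hf Hg.
  by split=> // p Up; exact: (continuousM (Hf.1 p Up) (Hg.1 p Up)).
have Hf' := CkS Hf; have Hg' := CkS Hg; move: Hf Hg => [cf df] [cg dg].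
split=> [p Up|i]; first exact: (continuousM (cf p Up) (cg p Up)).
have [dfi Dfi] := df i; have [dgi Dgi] := dg i; split.
  by move=> p Up; apply: derivableM; [exact: dfi|exact: dgi].
apply: Ck_eq oU _ (CkD oU (IH _ _ Hf' Dgi) (IH _ _ Hg' Dfi)) => p Up.
by rewrite [RHS]deriveM //; [exact: dfi|exact: dgi].
Qed.

Lemma Ck_sum (n k m : nat) (U : set 'rV[R]_n) (f : 'I_m -> 'rV[R]_n -> R) : open U ->
  (forall i, Ck k U (f i)) -> Ck k U (fun p => \sum_(i < m) f i p).
Proof.
move=> oU; elim: m f => [|m IH] f Hf.
  rewrite [X in Ck _ _ X](_ : _ = fun=> 0); first exact: Ck_cst.
  by apply/funext => p; rewrite big_ord0.
rewrite [X in Ck _ _ X](_ : _ = fun p => (\sum_(i < m) f (widen_ord (leqnSn m) i) p) + f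
  ord_max p).
  by apply: CkD => //; exact: IH.
by apply/funext => p; rewrite big_ord_recr.
Qed.

Lemma derive_coord (n : nat) (j : 'I_n) (p v : 'rV[R]_n) :
  is_derive p v (fun q : 'rV[R]_n => q 0 j) (v 0 j).
Proof.
have d := @derivable_id R ('rV[R]_n) p v.
apply: DeriveDef; first exact: ((derivable_mxP _ _ _).1 d 0 j).
by have := derive_mx d => /matrixP /(_ 0 j); rewrite derive_id !mxE.
Qed.

Lemma Ck_coord (n k : nat) (U : set 'rV[R]_n) (j : 'I_n) : open U -> Ck k U (fun p => p 0 j).
Proof.
move=> oU; case: k => [|k]; (split; first by move=> p _; exact: coord_continuous) => // i.
split=> [p _|]; first exact: (@ex_derive _ _ _ _ _ _ _ (derive_coord j p _)).
rewrite [X in Ck _ _ X](_ : _ = (fun=> (delta_mx 0 i : 'rV[R]_n) 0 j)); first exact: Ck_cst.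
by apply/funext => p; exact: (@derive_val _ _ _ _ _ _ _ (derive_coord j p _)).
Qed.

(** Partial derivatives are derivatives along lines, so one-variable calculus
    applies to the restriction of f to a line. *)
Lemma is_derive_line (n : nat) (f : 'rV[R]_n -> R) (w v : 'rV[R]_n) (c x : R) :
  derivable f w v ->
  is_derive x 1 (fun y : R => f (w + ((y - x) * c) *: v)) (c * 'D_v f w).
Proof.
move=> df; have d1 := (derivable1P _ _ _).1 df.
pose h (s : R) := f (s *: v + w).
have -> : (fun y : R => f (w + ((y - x) * c) *: v)) = h \o (fun y => (y - x) * c).
  by apply/funext => s /=; rewrite /h addrC.
have dl : is_derive x 1 (fun s : R => (s - x) * c) c.
  have H : is_derive x (1 : R) (c \*: (@idfun R - cst x)) (c *: (1 - 0)) by apply: is_deriveZ.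
  rewrite (_ : c *: (1 - 0) = c) in H; last by rewrite subr0 [LHS]mulr1.
  by rewrite (_ : (fun s => _) = (c \*: (@idfun R - cst x))) //; apply/funext => s /=;
    rewrite mulrC.
have -> : c * 'D_v f w = c * derive1 h 0.
  congr (_ * _); rewrite derive1E /derive; set g1 := fun s : R => _; set g2 := fun s : R => _.
  by have -> : g1 = g2 by apply/funext => s; rewrite /g1 /g2 /h /= scale0r add0r addr0
    [_%:A]mulr1.
have e0 : (x - x) * c = 0 by ring.
apply: DeriveDef.
  apply/derivable1_diffP; apply: differentiable_comp; first by apply/derivable1_diffP;
    exact: ex_derive.
  by rewrite e0; apply/derivable1_diffP.
have d0 : derivable h ((x - x) * c) 1 by rewrite e0.
rewrite -derive1E (derive1_comp (@ex_derive _ _ _ _ _ _ _ dl) d0) e0.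
by rewrite mulrC; congr (_ * _); rewrite derive1E derive_val.
Qed.

Lemma mvt_direction (n : nat) (f : 'rV[R]_n -> R) (q v : 'rV[R]_n) (c : R) :
  (forall t : R, t \in `[0, 1]%R -> derivable f (q + (t * c) *: v) v) ->
  exists2 t : R, t \in `[0, 1]%R & f (q + c *: v) - f q = c * 'D_v f (q + (t * c) *: v).
Proof.
move=> df; pose g (t : R) := f (q + (t * c) *: v).
have dg (t : R) : t \in `[0, 1]%R -> is_derive t 1 g (c * 'D_v f (q + (t * c) *: v)).
  move=> t01; have := is_derive_line c t (df t t01).
  rewrite (_ : (fun y => _) = g) //; apply/funext => y.
  by rewrite /g -addrA -scalerDl -mulrDl addrCA subrr addr0.
have [t t01 e] := @MVT_segment R g _ 0 1 ler01
  (fun x h => dg x (subset_itv_oo_cc h))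
  (derivable_within_continuous (fun x h => @ex_derive _ _ _ _ _ _ _ (dg x h))).
by exists t => //; move: e; rewrite /g mul1r mul0r scale0r addr0 subr0 mulr1 => ->.
Qed.
End Calculus.

(** * The chain rule in several variables *)

Section ChainRuleRn.
Local Open Scope classical_set_scope.
Local Open Scope ring_scope.
Context {R : realType}.

Lemma Ck_continuous (n k : nat) (U : set 'rV[R]_n) f p : Ck k U f -> U p -> continuous_at p f.
Proof. by case: k => [|k] [cf _] Up; exact: cf. Qed.

Lemma coord_le_norm (n : nat) (v : 'rV[R]_n) (i : 'I_n) : `|v 0 i| <= `|v|.
Proof. by rewrite [leRHS]/Num.Def.normr /= mx_normrE; exact: (le_bigmax _ _ (ord0, i)). Qed.

Lemma norm_le_coord (n : nat) (v : 'rV[R]_n) (c : R) :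
  0 <= c -> (forall i, `|v 0 i| <= c) -> `|v| <= c.
Proof.
move=> c0 H; rewrite /Num.Def.normr /= mx_normrE; apply: bigmax_le => // -[i j] _ /=.
by rewrite ord1.
Qed.

(** The increment of f is split along a path from p to p + h that follows the
    coordinate axes; on each edge the mean value theorem gives the partial
    derivative at a nearby point, and continuity at p bounds the error by the
    norm of h. *)
Lemma C1_differentiable (n : nat) (U : set 'rV[R]_n) f p : open U -> Ck 1 U f -> U p ->
  differentiable f p /\
  forall v, 'D_v f p = \sum_(i < n) 'D_(delta_mx 0 i) f p * v 0 i.
Proof.
move=> oU [_ C1] Up.
pose df (v : 'rV[R]_n) : R := \sum_(i < n) 'D_(delta_mx 0 i) f p * v 0 i.
have df_lin : linear df.
  move=> c u v; rewrite /df (_ : forall x : R, c *: x = c * x) // mulr_sumr -big_split /=;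
    apply: eq_bigr => i _.
  by rewrite !mxE; ring.
pose dfM := GRing.isLinear.Build _ _ _ _ _ df_lin.
pose dfL : {linear 'rV[R]_n -> R} := HB.pack df dfM.
have dfc : continuous dfL.
  have [c0 _] : Ck 0 setT df.
    apply: Ck_sum openT _ => i; exact: CkM openT (Ck_cst _ _ _) (Ck_coord _ _ openT).
  by move=> v; exact: c0.
have dfo : f \o shift p = cst (f p) + dfL +o_ (0 : 'rV[R]_n) id.
  apply/eqaddoP => e e0.
  pose e' := e / n.+1%:R; have e'0 : 0 < e' by rewrite divr_gt0.
  have : \forall q \near p, U q /\ forall i : 'I_n, `|'D_(delta_mx 0 i) f q - 'D_(delta_mx 0 i)
    f p| <= e'.
    apply: filterI; first exact: open_nbhs_nbhs.
    have H (i : 'I_n) : \forall q \near p, `|'D_(delta_mx 0 i) f q - 'D_(delta_mx 0 i) f p| <= e'.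
      have [_ [/(_ p Up) + _]] := C1 i; rewrite /continuous_at; move/cvgrPdist_le => /(_ _ e'0).
      by apply: filterS => q; rewrite distrC.
    exact: (@filter_forall _ _ (fun i q => `|'D_(delta_mx 0 i) f q - 'D_(delta_mx 0 i) f p| <=
      e') _ _ H).
  move=> /nbhs_ballP[d /= d0 Hd].
  have hd0 : \forall h \near (0 : 'rV[R]_n), `|h| < d.
    by apply/nbhs_ballP; exists d => //= h; rewrite -ball_normE /ball_ /= sub0r normrN.
  near=> h; rewrite [leLHS](_ : _ = `|f (h + p) - f p - df h|); last first.
    by congr `| _ |; rewrite !fctE /= opprD addrA.
  have hd : `|h| < d by near: h; exact: hd0.
  (* q k is the path after its first k edges. *)
  pose q (k : nat) : 'rV[R]_n := \row_i (p 0 i + if (i < k)%N then h 0 i else 0).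
  have q0 : q 0%N = p by apply/rowP => i; rewrite mxE addr0.
  have qn : q n = h + p by apply/rowP => i; rewrite !mxE ltn_ord addrC.
  have qS (k : 'I_n) : q k.+1 = q k + h 0 k *: delta_mx 0 k.
    apply/rowP => i; rewrite !mxE eqxx /=.
    have [->|ik] := eqVneq i k; first by rewrite ltnS leqnn ltnn addr0 mulr1.
    by rewrite ltnS leq_eqVlt val_eqE (negbTE ik) mulr0 addr0.
  have qb (k : 'I_n) (t : R) : t \in `[0, 1]%R -> ball p d (q k + (t * h 0 k) *: delta_mx 0 k).
    move=> t01; rewrite -ball_normE /ball_ /=; apply: le_lt_trans hd.
    apply: norm_le_coord => // i; rewrite !mxE eqxx /= opprD addrA opprD addrA subrr sub0r.
    have [->|ik] := eqVneq i k.
      rewrite ltnn /= oppr0 add0r mulr1 normrN normrM.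
      move: t01; rewrite in_itv /= => /andP[t0 t1]; rewrite ger0_norm //.
      by apply: le_trans (coord_le_norm h k); rewrite ler_piMl.
    rewrite mulr0 subr0 normrN; case: ifP => _; first exact: coord_le_norm.
    by rewrite normr0.
  have -> : f (h + p) - f p = \sum_(k < n) (f (q k.+1) - f (q k)).
    by rewrite -(big_mkord xpredT (fun k => f (q k.+1) - f (q k))) telescope_sumr // q0 qn.
  rewrite /df -sumrB; apply: le_trans (ler_norm_sum _ _ _) _.
  apply: (@le_trans _ _ (\sum_(i < n) e' * `|h|)); last first.
    rewrite sumr_const card_ord -mulr_natl mulrA ler_wpM2r //.
    rewrite /e' mulrCA ger_pMr // ler_pdivrMr // mul1r ler_nat //.
  apply: ler_sum => k _; rewrite qS.
  have [t t01 ->] := @mvt_direction R n f (q k) (delta_mx 0 k) (h 0 k)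
    (fun t t01 => (C1 k).1 _ (Hd _ (qb k t t01)).1).
  rewrite mulrC -mulrBl normrM; apply: ler_pM => //; last exact: coord_le_norm.
  by have [_] := Hd _ (qb k t t01); apply.
have dif : differentiable f p.
  by apply/diff_locallyP; rewrite (diff_unique dfc dfo).
split=> // v; rewrite deriveE // (diff_unique dfc dfo) //.
Unshelve. all: by end_near. Qed.

(** The derivative of f o G along v is that of f along the curve t |-> G (p +
    t v), to which the chain rule for differentiable maps applies. *)
Lemma derive_rV_comp (m n : nat) (V : set 'rV[R]_m) (U : set 'rV[R]_n)
    (G : 'rV[R]_m -> 'rV[R]_n) f p v :
  open U -> open V -> Ck 1 U f -> (forall j, Ck 1 V (fun q => G q 0 j)) ->
  V p -> U (G p) ->
  derivable (f \o G) p v /\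
  'D_v (f \o G) p = \sum_(j < n) 'D_(delta_mx 0 j) f (G p) * 'D_v (fun q => G q 0 j) p.
Proof.
move=> oU oV Cf CG Vp UGp.
have [df Df] := C1_differentiable oU Cf UGp.
have dGj j : derivable (fun q => G q 0 j) p v.
  by apply: diff_derivable; have [] := C1_differentiable oV (CG j) Vp.
have dG : derivable G p v by apply/derivable_mxP => i j; rewrite (ord1 i).
pose c (t : R) := G (t *: v + p).
have c0 : c 0 = G p by rewrite /c scale0r add0r.
have dc : differentiable c 0 by apply/derivable1_diffP; exact: (derivable1P _ _ _).1.
have dfc : differentiable (f \o c) 0 by apply: differentiable_comp; rewrite ?c0.
have e (h : 'rV[R]_m -> R) : 'D_v h p = 'D_1 (fun t : R => h (t *: v + p)) 0.
  rewrite /derive; set g1 := fun s : R => s^-1 *: _; set g2 := fun s : R => s^-1 *: _.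
  by have -> : g1 = g2 by apply/funext => s; rewrite /g1 /g2 /= scale0r add0r addr0 [_%:A]mulr1.
have eG : 'D_v G p = 'D_1 c 0.
  rewrite /derive; set g1 := fun s : R => s^-1 *: _; set g2 := fun s : R => s^-1 *: _.
  by have -> : g1 = g2 by apply/funext => s; rewrite /g1 /g2 /c /= scale0r add0r addr0
    [_%:A]mulr1.
split.
  by apply/derivable1P; apply: diff_derivable.
rewrite e [LHS](_ : _ = 'D_1 (f \o c) 0) // deriveE // diff_comp ?c0 //=.
rewrite -[X in 'd f _ X]deriveE // -eG -deriveE // Df; apply: eq_bigr => j _.
by rewrite derive_mx // mxE.
Qed.

(** Induction on k: by the chain rule a partial derivative of f o G is a sum
    of products of functions to which the induction hypothesis applies. *)
Lemma Ck_comp (k m n : nat) (V : set 'rV[R]_m) (U : set 'rV[R]_n)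
    (G : 'rV[R]_m -> 'rV[R]_n) f :
  open U -> open V -> Ck k U f -> (forall j, Ck k V (fun q => G q 0 j)) ->
  (forall p, V p -> U (G p)) -> Ck k V (fun p => f (G p)).
Proof.
move=> oU oV Cf CG VU.
have contG l : (forall j, Ck l V (fun q => G q 0 j)) -> forall p, V p -> continuous_at p G.
  move=> CGl p Vp; rewrite /continuous_at; apply/(@cvgrPdist_le _ _ _ (nbhs p)) => e e0.
  have H j : \forall q \near p, `|G p 0 j - G q 0 j| <= e.
    have := Ck_continuous (CGl j) Vp; by rewrite /continuous_at; move/cvgrPdist_le => /(_ _ e0).
  have H' := @filter_forall _ _ (fun j q => `|G p 0 j - G q 0 j| <= e) (nbhs p) _ H.
  near=> q; have Hq : forall j, `|G p 0 j - G q 0 j| <= e by near: q; exact: H'.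
  apply: norm_le_coord => [|j]; first exact: ltW.
  by rewrite !mxE.
elim: k f Cf CG => [|k IH] f Cf CG.
  by split=> // p Vp; exact: (continuous_comp (contG _ CG p Vp) (Ck_continuous Cf (VU p Vp))).
split=> [p Vp|i].
  exact: (continuous_comp (contG _ CG p Vp) (Ck_continuous Cf (VU p Vp))).
have C1 (l : nat) (W : set 'rV[R]_l) g : Ck k.+1 W g -> Ck 1 W g.
  by clear; elim: k g => [|k IH] g // /CkS; exact: IH.
have Cf1 := C1 _ _ _ Cf; have CG1 j := C1 _ _ _ (CG j).
have chain p (Vp : V p) := derive_rV_comp (delta_mx 0 i) oU oV Cf1 CG1 Vp (VU p Vp).
split=> [p Vp|]; first by have [] := chain p Vp.
apply: (Ck_eq (f := fun p => \sum_(j < n) 'D_(delta_mx 0 j) f (G p) * 'D_(delta_mx 0 i) (fun q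
  => G q 0 j) p)) => //.
  by move=> p Vp; have [_ ->] := chain p Vp.
apply: Ck_sum => // j; apply: CkM => //.
  apply: (IH (fun q => 'D_(delta_mx 0 j) f q)) => [|j']; last exact: CkS.
  by have [_ /(_ j)[]] := Cf.
by have [_ /(_ i)[]] := CG j.
Unshelve. all: by end_near. Qed.
End ChainRuleRn.

(** * Smooth germs and bump functions on R^n *)

Section Smooth.
Local Open Scope classical_set_scope.
Local Open Scope ring_scope.
Context {R : realType}.

Definition smooth_near (n : nat) (f : 'rV[R]_n -> R) (p : 'rV[R]_n) :=
  exists2 V : set 'rV[R]_n, open_nbhs p V & Cinfty V f.

Section Near.
Context {n : nat}.
Implicit Types (f g : 'rV[R]_n -> R) (p : 'rV[R]_n).

Lemma smooth_near_of (U : set 'rV[R]_n) f p : open U -> U p -> Cinfty U f -> smooth_near f p.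
Proof. by move=> oU Up Uf; exists U. Qed.

Lemma Cinfty_smooth_near (U : set 'rV[R]_n) f :
  (forall p, U p -> smooth_near f p) -> Cinfty U f.
Proof.
move=> H k; apply: Ck_pointwise => p /H[V [oV Vp] Vf]; exists V => //; exact: Vf.
Qed.

Lemma smooth_near_near f p : smooth_near f p -> \forall q \near p, smooth_near f q.
Proof.
move=> [V [oV Vp] Vf]; have : nbhs p V by exact: open_nbhs_nbhs.
by apply: filterS => q Vq; exists V.
Qed.

(** This form of the definition is stable under finite conjunctions by the
    filter laws, so that finitely many germs get a common neighbourhood. *)
Lemma smooth_nearP f p :
  smooth_near f p <-> \forall q \near p, forall k, Ck k [set q] f.
Proof.
split=> [[V oVp Vf]|].
  have : nbhs p V by exact: open_nbhs_nbhs.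
  by apply: filterS => q Vq k; apply: Ck_sub (Vf k) => _ ->.
rewrite /prop_near1 nbhsE => -[V oVp VH]; exists V => // k.
by apply: Ck_pointwise => q Vq; exists [set q] => //; exact: VH.
Qed.

Lemma smooth_near_eq f g p : {near p, f =1 g} -> smooth_near f p -> smooth_near g p.
Proof.
move=> fg [V [oV Vp] Vf]; exists (V `&` [set q | f q = g q]°).
  split; last by split=> //; exact: fg.
  by apply: openI => //; exact: open_interior.
move=> k; apply: (@Ck_eq _ _ _ _ f).
- by apply: openI => //; exact: open_interior.
- by move=> q [_ /interior_subset].
- by apply: Ck_sub (Vf k) => q [].
Qed.

Lemma smooth_near_cst (c : R) p : smooth_near (fun=> c) p.
Proof. by exists setT => [|k]; [split=> //; exact: openT|exact: Ck_cst]. Qed.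

Lemma smooth_near_coord (j : 'I_n) p : smooth_near (fun q => q 0 j) p.
Proof. by exists setT => [|k]; [split=> //; exact: openT|apply: Ck_coord; exact: openT]. Qed.

Lemma smooth_nearD f g p : smooth_near f p -> smooth_near g p ->
  smooth_near (fun q => f q + g q) p.
Proof.
move=> [V [oV Vp] Vf] [W [oW Wp] Wg]; have oVW := openI oV oW.
exists (V `&` W) => // k; apply: CkD => //.
  by apply: Ck_sub (Vf k) => ? [].
by apply: Ck_sub (Wg k) => ? [].
Qed.

Lemma smooth_nearM f g p : smooth_near f p -> smooth_near g p ->
  smooth_near (fun q => f q * g q) p.
Proof.
move=> [V [oV Vp] Vf] [W [oW Wp] Wg]; have oVW := openI oV oW.
exists (V `&` W) => // k; apply: CkM => //.
  by apply: Ck_sub (Vf k) => ? [].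
by apply: Ck_sub (Wg k) => ? [].
Qed.

Lemma smooth_near_sum (I : Type) (r : seq I) (P : pred I) (f : I -> 'rV[R]_n -> R) p :
  (forall i, P i -> smooth_near (f i) p) -> smooth_near (fun q => \sum_(i <- r | P i) f i q) p.
Proof.
move=> H; elim: r => [|i r IH].
  by apply: smooth_near_eq (smooth_near_cst 0 p); near=> q; rewrite big_nil.
have [Pi|Pi] := boolP (P i).
  apply: smooth_near_eq (smooth_nearD (H i Pi) IH); near=> q.
  by rewrite big_cons Pi.
by apply: smooth_near_eq IH; near=> q; rewrite big_cons (negbTE Pi).
Unshelve. all: by end_near. Qed.

Lemma smooth_near_continuous f p : smooth_near f p -> continuous_at p f.
Proof. by move=> [V [_ Vp] /(_ 0%N) Vf]; exact: Ck_continuous Vf Vp. Qed.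

Lemma smooth_near_derivable f p i : smooth_near f p -> derivable f p (delta_mx 0 i).
Proof. by move=> [V [_ Vp] /(_ 1%N)[_ /(_ i)[H _]]]; exact: H. Qed.

Lemma smooth_near_derive f p i : smooth_near f p ->
  smooth_near (fun q => 'D_(delta_mx 0 i) f q) p.
Proof.
by move=> [V oVp Vf]; exists V => // k; have [_ /(_ i)[]] := Vf k.+1.
Qed.
End Near.

Lemma Cinfty_near (n : nat) (U : set 'rV[R]_n) f :
  open U -> Cinfty U f <-> forall p, U p -> smooth_near f p.
Proof.
move=> oU; split; last exact: Cinfty_smooth_near.
by move=> Uf p Up; exists U.
Qed.

Lemma continuous_at_rV (T : topologicalType) (n : nat) (G : T -> 'rV[R]_n) p :
  (forall j, continuous_at p (fun q => G q 0 j)) -> continuous_at p G.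
Proof.
move=> CG; rewrite /continuous_at; apply/(@cvgrPdist_le _ _ _ (nbhs p)) => e e0.
have H j : \forall q \near p, `|G p 0 j - G q 0 j| <= e.
  by have := CG j; rewrite /continuous_at; move/cvgrPdist_le => /(_ _ e0).
have H' := @filter_forall _ _ (fun j q => `|G p 0 j - G q 0 j| <= e) (nbhs p) _ H.
near=> q; have Hq : forall j, `|G p 0 j - G q 0 j| <= e by near: q; exact: H'.
apply: norm_le_coord => [|j]; first exact: ltW.
by rewrite !mxE.
Unshelve. all: by end_near. Qed.

Lemma smooth_near_comp (m n : nat) (G : 'rV[R]_m -> 'rV[R]_n) f p :
  (forall j, smooth_near (fun q => G q 0 j) p) -> smooth_near f (G p) ->
  smooth_near (fun q => f (G q)) p.
Proof.
move=> sG [U [oU UGp] Uf].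
have cG : continuous_at p G by apply: continuous_at_rV => j; exact: smooth_near_continuous.
have H1 j : \forall q \near p, forall k, Ck k [set q] (fun q => G q 0 j) by exact/smooth_nearP.
have H2 := @filter_forall _ _ (fun j q => forall k, Ck k [set q] (fun q => G q 0 j)) (nbhs p) _
  H1.
have H3 : \forall q \near p, U (G q) by apply: cG; exact: open_nbhs_nbhs.
have : \forall q \near p, U (G q) /\ forall j k, Ck k [set q] (fun q => G q 0 j) by near=> q;
  split; near: q; [exact: H3|exact: H2].
rewrite /prop_near1 nbhsE => -[V [oV Vp] VH]; exists V => // k.
apply: Ck_comp oU oV (Uf k) _ _ => [j|q /VH[]//].
by apply: Ck_pointwise => q Vq; exists [set q] => //; have [_] := VH q Vq; apply.
Unshelve. all: by end_near. Qed.

(** A one-variable function with derivatives of all orders is given here as a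
    sequence in which each term is the derivative of the preceding one; the
    induction on k moves along the sequence. *)
Lemma Ck_tower (n k : nat) (h : nat -> R -> R) (U : set 'rV[R]_n) l :
  (forall j (t : R), is_derive t 1 (h j) (h j.+1 t)) -> open U -> Ck k U l ->
  Ck k U (fun p => h 0%N (l p)).
Proof.
move=> dh oU; have : forall j, Ck k U l -> Ck k U (fun p => h j (l p)); last by apply.
have dfh j t : differentiable (h j) t by apply/derivable1_diffP; exact: ex_derive.
elim: k => [|k IH] j Cl.
  split=> // p Up; have := Ck_continuous Cl Up => cl.
  exact: (continuous_comp cl (differentiable_continuous (dfh j _))).
have C1 : Ck 1 U l.
  by move: Cl; clear; elim: k => [|k IH] // /CkS; exact: IH.
have dl p (Up : U p) := (C1_differentiable oU C1 Up).1.
have dhl p (Up : U p) : differentiable (h j \o l) p by apply: differentiable_comp;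
  [exact: dl|exact: dfh].
split=> [p Up|i].
  exact: (differentiable_continuous (dhl p Up)).
split=> [p Up|]; first exact: (diff_derivable (dhl p Up)).
have [_ /(_ i)[_ Dl]] := Cl.
apply: (Ck_eq (f := fun p => h j.+1 (l p) * 'D_(delta_mx 0 i) l p)) => //.
  move=> p Up; rewrite [RHS](_ : _ = 'D_(delta_mx 0 i) (h j \o l) p) //.
  rewrite (deriveE _ (dhl p Up)) (diff_comp (dl p Up) (dfh j _)) /=.
  by rewrite diff1E //= derive1E derive_val -(deriveE _ (dl p Up)) [RHS]mulrC.
by apply: CkM => //; apply: IH; exact: CkS.
Qed.

Lemma smooth_near_tower (n : nat) (h : nat -> R -> R) l (p : 'rV[R]_n) :
  (forall j (t : R), is_derive t 1 (h j) (h j.+1 t)) -> smooth_near l p ->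
  smooth_near (fun q => h 0%N (l q)) p.
Proof. by move=> dh [V [oV Vp] Vl]; exists V => // k; exact: Ck_tower. Qed.

(** These functions are a family containing exp(-1/t) and closed under
    differentiation. *)
Definition flat (P : {poly R}) (t : R) : R :=
  if 0 < t then P.[t^-1] * expR (- t^-1) else 0.

(** The factor s ^+ m makes the induction on the polynomial go through; for
    monomials the bound is the comparison of s^k / k! with the exponential
    series. *)
Lemma poly_exp_bounded (P : {poly R}) (m : nat) :
  exists C : R, forall s, 0 < s -> `|P.[s]| * s ^+ m * expR (- s) <= C.
Proof.
have mono k (s : R) : 0 < s -> s ^+ k * expR (- s) <= k`!%:R.
  move=> s0; rewrite expRN ler_pdivrMr ?expR_gt0 //.
  case: k => [|k]; first by rewrite expr0 fact0 mul1r -[leLHS](@expR0 R) ler_expR ltW.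
  have := @expR_ge1Dxn R s k (ltW s0) => H.
  rewrite -ler_pdivrMl ?ltr0n ?fact_gt0 // mulrC; apply: le_trans H.
  by rewrite lerDr.
elim/poly_ind: P m => [|P c IH] m.
  by exists 0 => s _; rewrite horner0 normr0 !mul0r.
have [C HC] := IH m.+1; exists (C + `|c| * m`!%:R) => s s0.
rewrite hornerMXaddC; apply: (@le_trans _ _ ((`|P.[s]| * s + `|c|) * s ^+ m * expR (- s))).
  rewrite ler_wpM2r ?expR_ge0 // ler_wpM2r ?(exprn_ge0 _ (ltW s0)) //.
  by apply: le_trans (ler_normD _ _) _; rewrite lerD2r normrM (gtr0_norm s0).
rewrite !mulrDl; apply: lerD; first by rewrite -(mulrA `|P.[s]|) -exprS; exact: HC.
by rewrite -mulrA ler_wpM2l // mono.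
Qed.

(** A bound by t ^ 2 is exactly what gives derivative 0 at the origin. *)
Lemma flat_quadratic (P : {poly R}) : exists C : R, forall t, `|flat P t| <= C * t ^+ 2.
Proof.
have [C HC] := poly_exp_bounded P 2; exists (Num.max 0 C) => t; rewrite /flat.
have C0 : 0 <= Num.max 0 C by rewrite le_max lexx.
case: ifPn => [t0|_]; last by rewrite normr0 mulr_ge0 // sqr_ge0.
have := HC t^-1; rewrite invr_gt0 t0 => /(_ isT) H.
rewrite normrM (gtr0_norm (expR_gt0 _)) -ler_pdivrMr ?exprn_gt0 //.
apply: (@le_trans _ _ C); last by rewrite le_max lexx orbT.
by apply: le_trans H; rewrite exprVn mulrAC.
Qed.

Lemma is_derive_flat (P : {poly R}) (t : R) :
  is_derive t 1 (flat P) (flat ('X^2 * (P - P^`())) t).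
Proof.
have [t0|t0|->] := ltrgtP t 0.
- rewrite [X in is_derive _ _ _ X](_ : _ = 0); last by rewrite /flat ltNge ltW.
  apply: near_eq_is_derive (is_derive_cst 0 t 1); near=> s.
  rewrite /flat /= ltNge (_ : s <= 0) //.
  by near: s; exact: lt_le_nbhsl.
- have -> : flat ('X^2 * (P - P^`())) t = t^-1 ^+ 2 * (P.[t^-1] - P^`().[t^-1]) * expR (- t^-1).
    by rewrite /flat t0 !hornerE.
  have tn0 : t != 0 by rewrite gt_eqF.
  have dV : is_derive t 1 (fun s : R => s^-1) (- t^-1 ^+ 2).
    apply: DeriveDef; first exact: derivableV.
    by rewrite deriveV // derive_id exprVn [LHS]mulr1.
  have dP : is_derive t 1 (fun s : R => P.[s^-1]) (- t^-1 ^+ 2 * P^`().[t^-1]).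
    have -> : (fun s : R => P.[s^-1]) = horner P \o (fun s : R => s^-1) by [].
    apply: DeriveDef.
      by apply/derivable1_diffP; apply: differentiable_comp; apply/derivable1_diffP;
        exact: ex_derive.
    by rewrite -derive1E derive1_comp ?derive1E ?derive_val // mulrC.
  have dE : is_derive t 1 (fun s : R => expR (- s^-1)) (t^-1 ^+ 2 * expR (- t^-1)).
    have -> : (fun s : R => expR (- s^-1)) = expR \o (fun s : R => - s^-1) by [].
    have dN : is_derive t 1 (fun s : R => - s^-1) (- - t^-1 ^+ 2) := is_deriveN dV.
    apply: DeriveDef.
      by apply/derivable1_diffP; apply: differentiable_comp; apply/derivable1_diffP;
        exact: ex_derive.
    by rewrite -derive1E derive1_comp ?derive1E ?derive_val // opprK mulrC.
  have : is_derive t 1 (fun s : R => P.[s^-1] * expR (- s^-1)) (t^-1 ^+ 2 * (P.[t^-1] -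
    P^`().[t^-1]) * expR (- t^-1)).
    have H := is_deriveM dP dE; apply: is_derive_eq H _.
    by rewrite /GRing.scale /=; ring.
  apply: near_eq_is_derive; near=> s; rewrite /flat ifT //.
  by near: s; exact: lt_nbhsr.
- have [C HC] := flat_quadratic P.
  rewrite [X in is_derive _ _ _ X](_ : _ = 0); last by rewrite /flat ltxx.
  have C0 : 0 <= C by have := HC 1; rewrite expr1n mulr1; exact: le_trans.
  have H : h^-1 *: ((flat P \o shift 0) (h *: 1) - flat P 0) @[h --> 0^'] --> (0 : R).
    apply/cvgrPdist_le => e e0; near=> h.
    rewrite sub0r normrN /= addr0 [_%:A]mulr1 {2}/flat ltxx subr0 normrM normfV.
    have h0 : h != 0 by near: h; exact: nbhs_dnbhs_neq.
    rewrite ler_pdivrMl ?normr_gt0 //; apply: le_trans (HC h) _.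
    rewrite -real_normK ?num_real // expr2 mulrCA ler_wpM2l //.
    have hd : `|h| < e / (C + 1) by near: h; apply: dnbhs0_lt; rewrite divr_gt0 // ltr_wpDl.
    have C1 : 0 < C + 1 by rewrite ltr_wpDl.
    apply: (@le_trans _ _ ((C + 1) * `|h|)); first by rewrite ler_wpM2r // lerDl.
    by rewrite mulrC -ler_pdivlMr // ltW.
  by apply: DeriveDef; [apply/cvg_ex; exists 0|exact/cvg_lim].
Unshelve. all: by end_near. Qed.

Definition flat_tower (j : nat) : R -> R :=
  flat (iter j (fun P : {poly R} => 'X^2 * (P - P^`())) 1%:P).

Lemma flat_towerP j (t : R) : is_derive t 1 (flat_tower j) (flat_tower j.+1 t).
Proof. exact: is_derive_flat. Qed.

(** With h = exp(-1/t) extended by zero, let w be h at r^2 minus the sum of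
    the squares of the coordinates of q - p; it is positive near p and zero
    away from p. To get a plateau without dividing functions, h is applied
    once more: 1 - h (1 - c w) / h 1 is zero where w = 0 and is 1 where w > 1
    / c. *)
Lemma bump_rV (n : nat) (p : 'rV[R]_n) (r : R) : 0 < r ->
  exists b : 'rV[R]_n -> R,
  [/\ forall q, smooth_near b q, \forall q \near p, b q = 1 &
      forall q, r < `|q - p| -> b q = 0].
Proof.
move=> r0; pose h := flat_tower 0.
have hE (t : R) : h t = if 0 < t then expR (- t^-1) else 0.
  by rewrite /h /flat_tower /= /flat hornerC mul1r.
pose s (q : 'rV[R]_n) := r ^+ 2 + (-1) * \sum_(i < n) (q 0 i + - p 0 i) * (q 0 i + - p 0 i).
have ss q : smooth_near s q.
  apply: smooth_nearD; first exact: smooth_near_cst.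
  apply: smooth_nearM; first exact: smooth_near_cst.
  apply: smooth_near_sum => i _; apply: smooth_nearM; apply: smooth_nearD;
    by [exact: smooth_near_coord|exact: smooth_near_cst].
have sp : s p = r ^+ 2 by rewrite /s big1 ?mulr0 ?addr0 // => i _; rewrite subrr mulr0.
have hr0 : 0 < h (r ^+ 2) by rewrite hE exprn_gt0 // expR_gt0.
have h10 : h 1 != 0 by rewrite hE ltr01 gt_eqF // expR_gt0.
(* The factor 2 / h (r ^+ 2) makes this equal to -1 at p. *)
pose u (q : 'rV[R]_n) := 1 + - (2 / h (r ^+ 2)) * h (s q).
have su q : smooth_near u q.
  apply: smooth_nearD; first exact: smooth_near_cst.
  apply: smooth_nearM; first exact: smooth_near_cst.
  exact: (smooth_near_tower flat_towerP (ss q)).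
exists (fun q => 1 + - (h 1)^-1 * h (u q)); split.
- move=> q; apply: smooth_nearD; first exact: smooth_near_cst.
  apply: smooth_nearM; first exact: smooth_near_cst.
  exact: (smooth_near_tower flat_towerP (su q)).
- have up : u p < 0.
    by rewrite /u sp mulNr divfK ?gt_eqF // ltrBlDr add0r ltr1n.
  have := smooth_near_continuous (su p); rewrite /continuous_at => /cvgr_lt /(_ 0 up) cu.
  near=> q; have uq : u q < 0 by near: q; exact: cu.
  by rewrite [h (u q)]hE ltNge (ltW uq) /= mulr0 addr0.
- move=> q qp; have sq : s q <= 0.
    rewrite /s mulN1r subr_le0 leNgt; apply/negP => H.
    move: qp; rewrite ltNge => /negP; apply.
    apply: norm_le_coord => [|i]; first exact: ltW.
    rewrite !mxE -ler_sqr ?nnegrE ?normr_ge0 ?(ltW r0) // real_normK ?num_real //.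
    apply: le_trans (ltW H).
    rewrite (bigD1 i) //= -expr2 lerDl sumr_ge0 // => j _.
    by rewrite -expr2 sqr_ge0.
  have hs : h (s q) = 0 by rewrite hE ltNge sq.
  by rewrite /u hs mulr0 addr0 mulNr mulVf // subrr.
Unshelve. all: by end_near. Qed.
End Smooth.

(** * Hadamard's lemma *)

Section Hadamard.
Local Open Scope classical_set_scope.
Local Open Scope ring_scope.
Context {R : realType} {n : nat}.
Local Notation mu := (@lebesgue_measure R).
Implicit Types (f H : 'rV[R]_n -> R) (p q : 'rV[R]_n).

Lemma Ck_continuousT k f : Ck k setT f -> continuous f.
Proof. by move=> Cf p; exact: Ck_continuous Cf I. Qed.

Lemma bounded_on_ball f (r : R) : continuous f ->
  exists C : R, 0 <= C /\ forall q, `|q| <= r -> `|f q| <= C.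
Proof.
move=> cf; pose A := [set q : 'rV[R]_n | `|q| <= r].
have cA : compact A.
  apply: bounded_closed_compact.
    by exists r; split=> [|M rM q Aq]; rewrite ?num_real //; apply: le_trans Aq (ltW rM).
  rewrite (_ : A = (@Num.norm R _) @^-1` [set x : R | x <= r]) //.
  by apply: closed_comp; [move=> x _; exact: norm_continuous|exact: closed_le].
have /compact_bounded[M [Mr HM]] : compact (f @` A).
  by apply: continuous_compact => //; exact: continuous_subspaceT.
exists (Num.max 0 (M + 1)); split; first by rewrite le_max lexx.
move=> q Aq; rewrite le_max; apply/orP; right; apply: HM; first by rewrite ltrDl.
by exists q.
Qed.

Definition seg p q (t : R) : 'rV[R]_n := p + t *: (q - p).

Lemma norm_seg p q (t : R) : t \in `[0, 1]%R -> `|seg p q t| <= `|p| + `|q - p|.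
Proof.
rewrite in_itv /= => /andP[t0 t1]; apply: le_trans (ler_normD _ _) _.
by rewrite lerD2l normrZ ger0_norm // ler_piMl.
Qed.

Lemma seg_continuous p q : continuous (seg p q).
Proof.
move=> t; apply: (@continuousD _ _ _ (cst p) (fun t : R => t *: (q - p))).
  exact: cst_continuous.
exact: scalel_continuous.
Qed.

(** Each derivative under the integral sign brings out a factor t: the
    weights t ^+ m make the family closed under partial derivatives. *)
Definition avg p (m : nat) H q : R := (\int[mu]_(t in `[0, 1]) (t ^+ m * H (seg p q t)))%R.

Lemma integrand_continuous p m H q : continuous H ->
  continuous (fun t : R => t ^+ m * H (seg p q t)).
Proof.
move=> cH t; apply: (@continuousM _ _ (fun t : R => t ^+ m) (fun t => H (seg p q t))).
  exact: exprn_continuous.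
by apply: continuous_comp; [exact: seg_continuous|exact: cH].
Qed.

Lemma integrand_integrable p m H q : continuous H ->
  mu.-integrable `[0, 1] (EFin \o (fun t : R => t ^+ m * H (seg p q t))).
Proof.
move=> cH; apply: continuous_compact_integrable; first exact: segment_compact.
by apply: continuous_subspaceT; exact: integrand_continuous.
Qed.

Lemma cst_integrable (C : R) : mu.-integrable `[0, 1] (EFin \o (fun=> C)).
Proof.
apply: continuous_compact_integrable; first exact: segment_compact.
by apply: continuous_subspaceT => ?; exact: cst_continuous.
Qed.

(** Differentiation under the integral sign; near q the integrands are
    dominated because the segments from p stay in a fixed ball. *)
Lemma avg_derive p m H q i : Ck 1 setT H ->
  derivable (avg p m H) q (delta_mx 0 i) /\
  'D_(delta_mx 0 i) (avg p m H) q = avg p m.+1 (fun q => 'D_(delta_mx 0 i) H q) q.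
Proof.
move=> CH; have cH := Ck_continuousT CH.
set v := delta_mx 0 i; pose DH q := 'D_v H q.
have CDH : Ck 0 setT DH by have [_ /(_ i)[]] := CH.
have cDH := Ck_continuousT CDH.
(* The radius covers all segments from p to points at distance 1 from q. *)
have [C [C0 HC]] := bounded_on_ball (`|p| + (`|q - p| + 1)) cDH.
pose F (x t : R) := t ^+ m * H (seg p (q + x *: v) t).
have dF (x t : R) : is_derive x (1 : R) (F^~ t) (t ^+ m.+1 * DH (seg p (q + x *: v) t)).
  have d := (C1_differentiable openT CH (I : setT (seg p (q + x *: v) t))).1.
  have dl : is_derive x (1 : R) (fun y => H (seg p (q + x *: v) t + ((y - x) * t) *: v))
      (t * DH (seg p (q + x *: v) t)).
    by apply: is_derive_line; apply: diff_derivable.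
  have e : (F^~ t) = t ^+ m *: (fun y => H (seg p (q + x *: v) t + ((y - x) * t) *: v)).
    apply/funext => y; rewrite /F /seg /=; congr (_ * H _).
    by apply/rowP => j; rewrite !mxE; ring.
  have -> : t ^+ m.+1 * DH (seg p (q + x *: v) t) = t ^+ m *: (t * DH (seg p (q + x *: v) t)).
    by rewrite exprSr -mulrA.
  by rewrite e; apply: is_deriveZ.
have H0 : `]-1, 1[%classic (0 : R) by rewrite /= in_itv /= ltrN10 ltr01.
have Hint (x : R) : `]-1, 1[%classic x -> mu.-integrable `[0, 1] (EFin \o F x).
  by move=> _; exact: integrand_integrable.
have Hder (x t : R) : `]-1, 1[%classic x -> `[0, 1]%classic t -> derivable (F^~ t) x 1.
  by move=> _ _; exact: (@ex_derive _ _ _ _ _ _ _ (dF x t)).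
have Hub (x t : R) : `]-1, 1[%classic x -> `[0, 1]%classic t -> `|partial1of2 F x t| <= C.
  rewrite /= !in_itv /= => /andP[x1 x2] t01; rewrite partial1of2E derive_val normrM.
  have /andP[t0 t1] := t01.
  rewrite -[C]mul1r; apply: ler_pM => //.
    by rewrite ger0_norm ?exprn_ge0 // exprn_ile1.
  apply: HC; apply: le_trans (norm_seg _ _ _) _; first by rewrite in_itv.
  rewrite lerD2l addrAC; apply: le_trans (ler_normD _ _) _; rewrite lerD2l.
  apply: norm_le_coord => // j; rewrite !mxE eqxx /= normrM.
  rewrite -[leRHS]mulr1; apply: ler_pM => //; first by rewrite ler_norml !ltW.
  by case: (j == i); rewrite ?normr1 ?normr0.
have mI : measurable (`[0, 1]%classic : set R) by exact: measurable_itv.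
have e0 : (fun x : R => avg p m H (x *: v + q)) = (fun x => \int[mu]_(y in `[0, 1]) F x y)%R.
  by apply/funext => x; rewrite /avg /F addrC.
have d0 := derivable_under_integral (mu := mu) (f := F) mI H0 Hint Hder (fun=> C0)
  (cst_integrable C) Hub.
have D0 := differentiation_under_integral (mu := mu) (f := F) mI H0 Hint Hder (fun=> C0)
  (cst_integrable C) Hub.
split; first by apply/derivable1P; rewrite e0.
have -> : 'D_v (avg p m H) q = derive1 (fun x : R => avg p m H (x *: v + q)) 0.
  rewrite derive1E /derive; set g1 := fun s : R => s^-1 *: _; set g2 := fun s : R => s^-1 *: _.
  by have -> : g1 = g2 by apply/funext => s; rewrite /g1 /g2 /= scale0r add0r addr0 [_%:A]mulr1.
rewrite e0 D0 /avg; apply: eq_Rintegral => t _.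
by rewrite partial1of2E derive_val scale0r addr0.
Qed.

Lemma derive_rV f p v : Ck 1 setT f ->
  'D_v f p = \sum_(i < n) 'D_(delta_mx 0 i) f p * v 0 i.
Proof. by move=> Cf; have [_] := C1_differentiable openT Cf (I : setT p). Qed.

(** The segment between two points of a ball stays in the ball, where the
    partial derivatives are bounded by compactness. *)
Lemma lipschitz_on_ball f (r : R) : Ck 1 setT f ->
  exists C : R, 0 <= C /\ forall a b, `|a| <= r -> `|b| <= r -> `|f a - f b| <= C * `|a - b|.
Proof.
move=> Cf; have [_ CDf] := Cf.
have CD i : Ck 0 setT (fun q => 'D_(delta_mx 0 i) f q) := (CDf i).2.
have H i := bounded_on_ball r (Ck_continuousT (CD i)).
have [C HC] := choice H.
exists (\sum_i C i); split; first by apply: sumr_ge0 => i _; have [] := HC i.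
move=> a b ar br; pose v := a - b.
have [|t t01] := @mvt_direction R n f b v 1.
  by move=> t _; apply: diff_derivable; have [] := C1_differentiable openT Cf (I : setT (b + (t
    * 1) *: v)).
have e : b + v = a by rewrite /v addrC subrK.
rewrite scale1r mul1r mulr1 e => ->.
rewrite derive_rV // mulr_suml; apply: le_trans (ler_norm_sum _ _ _) _.
apply: ler_sum => i _; rewrite normrM; apply: ler_pM => //; last exact: coord_le_norm.
have [_] := HC i; apply.
move: t01; rewrite in_itv /= => /andP[t0 t1].
rewrite (_ : b + _ = t *: a + (1 - t) *: b); last by apply/rowP => j; rewrite !mxE; ring.
apply: le_trans (ler_normD _ _) _; rewrite !normrZ ger0_norm // ger0_norm ?subr_ge0 //.
rewrite [leRHS](_ : r = t * r + (1 - t) * r); last by ring.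
by apply: lerD; rewrite ler_wpM2l // subr_ge0.
Qed.

Lemma avg_continuous p m H : Ck 1 setT H -> continuous (avg p m H).
Proof.
move=> CH q; have cH := Ck_continuousT CH.
have [C [C0 HC]] := lipschitz_on_ball (`|p| + (`|q - p| + 1)) CH.
have mI : measurable (`[0, 1]%classic : set R) by exact: measurable_itv.
have lip q' : `|q' - q| <= 1 -> `|avg p m H q - avg p m H q'| <= C * `|q - q'|.
  move=> q'q; rewrite /avg -RintegralB //; try exact: integrand_integrable.
  have iB : mu.-integrable `[0, 1] (EFin \o (fun t : R => t ^+ m * H (seg p q t) - t ^+ m * H
    (seg p q' t))).
    apply: continuous_compact_integrable; first exact: segment_compact.
    apply: continuous_subspaceT => t.
    by apply: (@continuousB _ _ _ (fun t : R => t ^+ m * H (seg p q t)) (fun t : R => t ^+ m *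
      H (seg p q' t)));
       exact: integrand_continuous.
  apply: le_trans (le_normr_Rintegral _ _) _ => //.
  have <- : (\int[mu]_(t in `[0, 1]) (C * `|q - q'|) = C * `|q - q'|)%R.
    by rewrite Rintegral_cst //= lebesgue_measure_itv /= lte_fin ltr01 oppr0 adde0 mulr1.
  apply: le_Rintegral => //; [|exact: cst_integrable|].
    have := integrable_norm iB; exact.
  move=> t t01; have /andP[t0 t1] : 0 <= t <= 1 by move: t01; rewrite /= in_itv.
  rewrite -mulrBr normrM -[leRHS]mul1r; apply: ler_pM => //.
    by rewrite ger0_norm ?exprn_ge0 // exprn_ile1.
  apply: le_trans (HC _ _ _ _) _.
  - by apply: le_trans (norm_seg _ _ t01) _; rewrite lerD2l lerDl.
  - apply: le_trans (norm_seg _ _ t01) _; rewrite lerD2l.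
    rewrite (_ : q' - p = (q - p) + (q' - q)); last by apply/rowP => j; rewrite !mxE; ring.
    by apply: le_trans (ler_normD _ _) _; rewrite lerD2l.
  rewrite ler_wpM2l // (_ : _ - _ = t *: (q - q')); last by apply/rowP => j; rewrite !mxE; ring.
  by rewrite normrZ ger0_norm // ler_piMl.
apply/(@cvgrPdist_le _ _ _ (nbhs q)) => e e0.
have d0 : 0 < Num.min 1 (e / (C + 1)) by rewrite lt_min ltr01 divr_gt0 // ltr_wpDl.
near=> q'.
have : `|q - q'| <= Num.min 1 (e / (C + 1)).
  near: q'; apply/nbhs_ballP; exists (Num.min 1 (e / (C + 1))) => // x.
  by rewrite -ball_normE /ball_ /= => /ltW.
rewrite le_min => /andP[h1 h2]; apply: le_trans (lip _ _) _; first by rewrite distrC.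
apply: le_trans (_ : _ <= (C + 1) * `|q - q'|) _; first by rewrite ler_wpM2r // lerDl.
by rewrite mulrC -ler_pdivlMr // ltr_wpDl.
Unshelve. all: by end_near. Qed.

Lemma Ck_avg p m H : Cinfty setT H -> Cinfty setT (avg p m H).
Proof.
move=> CH k; elim: k m H CH => [|k IH] m H CH; (split; first by move=> q _;
  exact: avg_continuous) => // i.
have d q := avg_derive p m q i (CH 1%N); split=> [q _|]; first by have [] := d q.
rewrite [X in Ck _ _ X](_ : _ = avg p m.+1 (fun q => 'D_(delta_mx 0 i) H q)).
  by apply: IH => l; have [_ /(_ i)[]] := CH l.+1.
by apply/funext => q; have [] := d q.
Qed.

Lemma continuous_sumR (I : Type) (r : seq I) (g : I -> R -> R) : (forall i, continuous (g i)) ->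
  continuous (fun t => \sum_(i <- r) g i t).
Proof.
move=> cg; elim: r => [|i r IH] t.
  rewrite (_ : (fun t => _) = cst 0); first exact: cst_continuous.
  by apply/funext => s; rewrite big_nil.
rewrite (_ : (fun t => _) = fun t => g i t + \sum_(i <- r) g i t).
  by apply: (@continuousD _ _ _ (g i)); [exact: cg|exact: IH].
by apply/funext => s; rewrite big_cons.
Qed.

Lemma Rintegral_sum (I : Type) (r : seq I) (g : I -> R -> R) : (forall i, continuous (g i)) ->
  (\int[mu]_(t in `[0, 1]) (\sum_(i <- r) g i t) = \sum_(i <- r) \int[mu]_(t in `[0, 1]) g i t)%R.
Proof.
move=> cg; have mI : measurable (`[0, 1]%classic : set R) by exact: measurable_itv.
have ci h : continuous h -> mu.-integrable `[0, 1] (EFin \o (h : R -> R)).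
  move=> ch; apply: continuous_compact_integrable; first exact: segment_compact.
  exact: continuous_subspaceT.
have cs r' := @continuous_sumR _ r' _ cg.
elim: r => [|i r IH].
  rewrite big_nil; under eq_Rintegral do rewrite big_nil.
  by rewrite Rintegral_cst // mul0r.
under eq_Rintegral do rewrite big_cons.
by rewrite RintegralD // ?big_cons ?IH //; apply: ci.
Qed.

(** The fundamental theorem of calculus along the segment from p to q, with
    g_i the mean of the i-th partial derivative over this segment. *)
Lemma hadamard f p : Cinfty setT f ->
  exists g : 'I_n -> 'rV[R]_n -> R,
  [/\ forall i, Cinfty setT (g i), forall i, g i p = 'D_(delta_mx 0 i) f p &
      forall q, f q = f p + \sum_(i < n) (q 0 i - p 0 i) * g i q].
Proof.
move=> Cf; exists (fun i => avg p 0 (fun q => 'D_(delta_mx 0 i) f q)).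
have CD i : Cinfty setT (fun q => 'D_(delta_mx 0 i) f q).
  by move=> k; have [_ /(_ i)[]] := Cf k.+1.
split=> [i|i|q]; first exact: Ck_avg.
  rewrite /avg; under eq_Rintegral do rewrite /seg subrr scaler0 addr0 expr0 mul1r.
  by rewrite Rintegral_cst //= lebesgue_measure_itv /= lte_fin ltr01 oppr0 adde0 mulr1.
have cDf i := Ck_continuousT (CD i 0%N).
pose v := q - p; pose F (t : R) := f (seg p q t).
pose G (t : R) := \sum_(i < n) (q 0 i - p 0 i) * (t ^+ 0 * 'D_(delta_mx 0 i) f (seg p q t)).
have cg i : continuous (fun t : R => (q 0 i - p 0 i) * (t ^+ 0 * 'D_(delta_mx 0 i) f (seg p q
  t))).
  move=> t; apply: (@continuousM _ _ (fun=> _) (fun t : R => t ^+ 0 * 'D_(delta_mx 0 i) f (seg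
    p q t))).
    exact: cst_continuous.
  exact: (@integrand_continuous p 0 _ q (cDf i) t).
have dF (t : R) : is_derive t (1 : R) F (G t).
  have d : derivable f (seg p q t) v.
    by apply: diff_derivable; have [] := C1_differentiable openT (Cf 1%N) (I : setT (seg p q t)).
  have := is_derive_line 1 t d.
  rewrite (_ : (fun y => _) = F); last first.
    by apply/funext => y; rewrite /F /seg; congr f; apply/rowP => j; rewrite !mxE; ring.
  rewrite (_ : 1 * _ = G t) //; rewrite mul1r (derive_rV _ _ (Cf 1%N)).
  by apply: eq_bigr => i _; rewrite !mxE expr0 mul1r mulrC.
have cF : continuous F.
  by move=> t; apply/differentiable_continuous/derivable1_diffP;
    exact: (@ex_derive _ _ _ _ _ _ _ (dF t)).
have cG : continuous G by exact: continuous_sumR.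
have eF : F 1 - F 0 = f q - f p by rewrite /F /seg scale1r scale0r addr0; congr (f _ - _);
  rewrite addrC subrK.
have lr : derivable_oo_LRcontinuous F 0 1.
  split=> [t _||]; first exact: (@ex_derive _ _ _ _ _ _ _ (dF t)).
    by apply: cvg_at_right_filter; exact: cF.
  by apply: cvg_at_left_filter; exact: cF.
have F'G : {in `]0, 1[, derive1 F =1 G}.
  by move=> t _; rewrite derive1E; exact: (@derive_val _ _ _ _ _ _ _ (dF t)).
have FTC := continuous_FTC2 ltr01 (continuous_subspaceT cG) lr F'G.
rewrite -[f q](subrK (f p)) -eF addrC; congr (_ + _).
have -> : F 1 - F 0 = (\int[mu]_(t in `[0, 1]) G t)%R by rewrite /Rintegral FTC.
rewrite /G Rintegral_sum //; apply: eq_bigr => i _.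
by apply: RintegralZl; [exact: measurable_itv|exact: (@integrand_integrable p 0 _ q (cDf i))].
Qed.
End Hadamard.

(** * Smooth functions on a manifold and their differentials *)

Section ChainRule.
Local Open Scope classical_set_scope.
Local Open Scope ring_scope.
Context {R : realType}.

Lemma smooth_near_chain (m n : nat) (G : 'rV[R]_m -> 'rV[R]_n) f p v :
  (forall j, smooth_near (fun q => G q 0 j) p) -> smooth_near f (G p) ->
  'D_v (fun q => f (G q)) p =
  \sum_(j < n) 'D_(delta_mx 0 j) f (G p) * 'D_v (fun q => G q 0 j) p.
Proof.
move=> sG [U [oU UGp] Uf].
have H1 j : \forall q \near p, forall k, Ck k [set q] (fun q => G q 0 j) by exact/smooth_nearP.
have H2 := @filter_forall _ _ (fun j q => forall k, Ck k [set q] (fun q => G q 0 j)) (nbhs p)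
  (nbhs_filter p) H1.
move: H2.
rewrite /prop_near1 nbhsE => -[V [oV Vp] VH].
have CG j : Ck 1 V (fun q => G q 0 j).
  by apply: Ck_pointwise => q Vq; exists [set q] => //; exact: VH.
by have [_ ->] := derive_rV_comp v oU oV (Uf 1%N) CG Vp UGp.
Qed.

Lemma linfun_linear (aT rT : vectType R) (f : aT -> rT) : linear f -> linfun f =1 f.
Proof.
move=> fl; pose fM := GRing.isLinear.Build _ _ _ _ _ fl.
by pose fL : {linear aT -> rT} := HB.pack f fM; exact: (lfunE fL).
Qed.
End ChainRule.

Section Manifold.
Local Open Scope classical_set_scope.
Local Open Scope ring_scope.
Context {R : realType} {n : nat} {M : manifold R n}.
Implicit Types (f g : M -> R) (x y z : M) (W U : set M).

Lemma psi_dom x p : (phi x @` dom x) p -> dom x (psi x p) /\ phi x (psi x p) = p.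
Proof. by move=> [y dy <-]; rewrite phiK. Qed.

Lemma image_phi x y : dom x y -> (phi x @` dom x) (phi x y).
Proof. by exists y. Qed.

Lemma near_psi x y (P : set M) : dom x y ->
  (\forall z \near y, P z) -> \forall p \near phi x y, P (psi x p).
Proof.
move=> dy HP; have := psi_continuous (image_phi dy).
by rewrite /continuous_at phiK //; apply.
Qed.

Lemma near_phi x y (P : set 'rV[R]_n) : dom x y ->
  (\forall p \near phi x y, P p) -> \forall z \near y, P (phi x z).
Proof. by move=> dy HP; have := phi_continuous dy; apply. Qed.

Lemma near_dom x y : dom x y -> \forall z \near y, dom x z.
Proof. by move=> dy; apply: open_nbhs_nbhs; split=> //; exact: dom_open. Qed.

Lemma near_image x y : dom x y -> \forall p \near phi x y, (phi x @` dom x) p.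
Proof. by move=> dy; apply: open_nbhs_nbhs; split; [exact: phi_open|exact: image_phi]. Qed.

Lemma near_psiK x y : dom x y -> \forall p \near phi x y, dom x (psi x p) /\ phi x (psi x p) = p.
Proof. by move=> dy; apply: filterS (near_image dy) => p; exact: psi_dom. Qed.

Lemma open_image_chart x W : open W -> open (phi x @` (dom x `&` W)).
Proof.
move=> oW; rewrite openE => _ [y [dy Wy] <-]; rewrite /interior.
have H1 := near_image dy; have H2 : \forall p \near phi x y, W (psi x p).
  by apply: near_psi => //; exact: open_nbhs_nbhs.
near=> p; have Hp : (phi x @` dom x) p by near: p.
have Wp : W (psi x p) by near: p.
by have [d e] := psi_dom Hp; exists (psi x p).
Unshelve. all: by end_near. Qed.

(** Smoothness is tested in the chart centred at the point itself; any other
    chart gives the same notion. *)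
Definition smooth_at f y := smooth_near (fun p => f (psi y p)) (phi y y).

Lemma transition_near x0 x1 y j : dom x0 y -> dom x1 y ->
  smooth_near (fun p => phi x1 (psi x0 p) 0 j) (phi x0 y).
Proof.
move=> d0 d1; apply: smooth_near_of (transition_smooth x0 x1 j).
  by apply: open_image_chart; exact: dom_open.
by exists y.
Qed.

Lemma smooth_near_transition x0 x1 f y : dom x0 y -> dom x1 y ->
  smooth_near (fun p => f (psi x1 p)) (phi x1 y) ->
  smooth_near (fun p => f (psi x0 p)) (phi x0 y).
Proof.
move=> d0 d1 sf; pose G p := phi x1 (psi x0 p).
have : smooth_near (fun p => f (psi x1 (G p))) (phi x0 y).
  apply: (@smooth_near_comp _ _ _ G (fun p => f (psi x1 p))).
    by move=> j; exact: transition_near.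
  by rewrite /G phiK.
apply: smooth_near_eq; have := near_psi d0 (near_dom d1).
by apply: filterS => p dp; rewrite /G phiK.
Qed.

(** Transition maps are smooth and smooth germs are stable under composition. *)
Lemma smooth_at_chart x f y : dom x y ->
  smooth_at f y <-> smooth_near (fun p => f (psi x p)) (phi x y).
Proof.
by move=> dy; split; apply: smooth_near_transition => //; exact: dom_center.
Qed.

Lemma smooth_on_at W f : open W -> smooth_on W f <-> forall y, W y -> smooth_at f y.
Proof.
move=> oW; split=> [sf y Wy|sf x].
  apply: smooth_near_of (sf y); first exact: open_image_chart.
  by exists y => //; split=> //; exact: dom_center.
apply/Cinfty_near; first exact: open_image_chart.
by move=> _ [y [dy Wy] <-]; apply/smooth_at_chart => //; exact: sf.
Qed.

Lemma smoothP f : smooth f <-> forall y, smooth_at f y.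
Proof.
by split=> [/(smooth_on_at _ openT) sf y|sf]; [exact: sf|apply/(smooth_on_at _ openT)].
Qed.

Lemma smooth_at_eq f g y : (\forall z \near y, f z = g z) -> smooth_at f y -> smooth_at g y.
Proof.
by move=> fg; apply: smooth_near_eq; exact: (near_psi (dom_center y) fg).
Qed.

Lemma smooth_at_near f y : smooth_at f y -> \forall z \near y, smooth_at f z.
Proof.
move=> /smooth_near_near sf; have H1 := near_phi (dom_center y) sf.
near=> z; apply/(@smooth_at_chart y).
  by near: z; exact: near_dom (dom_center y).
by near: z.
Unshelve. all: by end_near. Qed.

Lemma smooth_at_cst (c : R) y : smooth_at (fun=> c) y.
Proof. exact: smooth_near_cst. Qed.

Lemma smooth_atD f g y : smooth_at f y -> smooth_at g y -> smooth_at (fun z => f z + g z) y.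
Proof. exact: smooth_nearD. Qed.

Lemma smooth_atM f g y : smooth_at f y -> smooth_at g y -> smooth_at (fun z => f z * g z) y.
Proof. exact: smooth_nearM. Qed.

Lemma smooth_at_sum (I : Type) (r : seq I) (P : pred I) (f : I -> M -> R) y :
  (forall i, P i -> smooth_at (f i) y) -> smooth_at (fun z => \sum_(i <- r | P i) f i z) y.
Proof. exact: smooth_near_sum. Qed.

Lemma smooth_at_continuous f y : smooth_at f y -> continuous_at y f.
Proof.
move=> /smooth_near_continuous; rewrite /continuous_at phiK; last exact: dom_center.
move=> cf A /cf HA; have := near_phi (dom_center y) HA; rewrite /= => H.
have H2 := near_dom (dom_center y).
rewrite /nbhs /=; near=> z; have dz : dom y z by near: z.
have : A (f (psi y (phi y z))) by near: z.
by rewrite phiK.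
Unshelve. all: by end_near. Qed.

Lemma smooth_at_pullback x (g : 'rV[R]_n -> R) y : dom x y ->
  smooth_near g (phi x y) -> smooth_at (fun z => g (phi x z)) y.
Proof.
move=> dy sg; apply/(smooth_at_chart _ dy).
by apply: smooth_near_eq sg; have := near_psiK dy; apply: filterS => p [_ ->].
Qed.

Lemma smooth_at_coord x y j : dom x y -> smooth_at (fun z => phi x z 0 j) y.
Proof. by move=> dy; exact: (smooth_at_pullback (g := fun p => p 0 j) dy (smooth_near_coord _
  _)). Qed.

Definition partial x (i : 'I_n) f y : R := 'D_(delta_mx 0 i) (fun p => f (psi x p)) (phi x y).

Lemma smooth_at_partial x i f y : dom x y -> smooth_at f y -> smooth_at (partial x i f) y.
Proof.
move=> dy /(smooth_at_chart _ dy) sf.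
exact: (smooth_at_pullback (g := fun p => 'D_(delta_mx 0 i) (fun p => f (psi x p)) p) dy
  (smooth_near_derive i sf)).
Qed.

Lemma differentialE f y (v : tangent y) :
  differential f y v = \sum_(i < n) partial y i f y * v 0 i.
Proof.
rewrite /differential linfun_linear // => c a b.
rewrite (_ : forall r : R, c *: r = c * r) // mulr_sumr -big_split /=.
by apply: eq_bigr => i _; rewrite !mxE; ring.
Qed.

Lemma differential_eq f g y : (\forall z \near y, f z = g z) ->
  differential f y = differential g y.
Proof.
move=> fg; apply/lfunP => v; rewrite !differentialE; apply: eq_bigr => i _; congr (_ * _).
by apply: near_eq_derive; exact: (near_psi (dom_center y) fg).
Qed.

Lemma differentialD f g y : smooth_at f y -> smooth_at g y ->
  differential (fun z => f z + g z) y = differential f y + differential g y.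
Proof.
move=> sf sg; apply/lfunP => v; rewrite lfunE /= !differentialE -big_split /=.
apply: eq_bigr => i _; rewrite -mulrDl; congr (_ * _).
by rewrite [LHS]deriveD //; exact: smooth_near_derivable.
Qed.

Lemma differentialM f g y : smooth_at f y -> smooth_at g y ->
  differential (fun z => f z * g z) y = f y *: differential g y + g y *: differential f y.
Proof.
move=> sf sg; apply/lfunP => v; rewrite !lfunE /= !lfunE /= !differentialE.
rewrite !(_ : forall c r : R, c *: r = c * r) // !mulr_sumr -big_split /=.
apply: eq_bigr => i _; rewrite {1}/partial [X in X * _ = _]deriveM /=;
  try exact: smooth_near_derivable.
rewrite phiK; last exact: dom_center.
by rewrite mulrDl !mulrA.
Qed.

Lemma differential_cst (c : R) y : differential (fun _ : M => c) y = 0.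
Proof.
apply/lfunP => v; rewrite lfunE /= differentialE big1 // => i _.
by rewrite /partial derive_cst mul0r.
Qed.

Lemma differentialZ (c : R) f y : smooth_at f y ->
  differential (fun z => c * f z) y = c *: differential f y.
Proof.
move=> sf; rewrite (differentialM (smooth_at_cst c y) sf) differential_cst scaler0.
exact: addr0.
Qed.

Lemma differential_sum (I : Type) (r : seq I) (f : I -> M -> R) y :
  (forall i, smooth_at (f i) y) ->
  differential (fun z => \sum_(i <- r) f i z) y = \sum_(i <- r) differential (f i) y.
Proof.
move=> sf; elim: r => [|i r IH].
  rewrite big_nil -(differential_cst 0 y); congr (differential _ y).
  by apply/funext => z; rewrite big_nil.
rewrite big_cons -IH -differentialD //; last by apply: smooth_at_sum.
by congr (differential _ y); apply/funext => z; rewrite big_cons.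
Qed.

Lemma dxE y j (v : tangent y) : dx y j y v = v 0 j.
Proof.
rewrite /dx differentialE (bigD1 j) //= big1 => [|i ij].
  rewrite addr0 -[RHS]mul1r; congr (_ * _); rewrite /partial.
  rewrite (@near_eq_derive _ _ _ _ (fun p : 'rV[R]_n => p 0 j)).
    by rewrite (@derive_val _ _ _ _ _ _ _ (derive_coord j _ _)) !mxE !eqxx.
  by have := near_psiK (dom_center y); apply: filterS => p [_ ->].
rewrite /partial (@near_eq_derive _ _ _ _ (fun p : 'rV[R]_n => p 0 j)).
  by rewrite (@derive_val _ _ _ _ _ _ _ (derive_coord j _ _)) !mxE eqxx eq_sym (negbTE ij) mul0r.
by have := near_psiK (dom_center y); apply: filterS => p [_ ->].
Qed.

(** The differential is written in the chart centred at y; passing to another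
    chart is the chain rule for the transition map. *)
Lemma differential_chart x f y : dom x y -> smooth_at f y ->
  differential f y = \sum_(j < n) partial x j f y *: dx x j y.
Proof.
move=> dy sf; apply/lfunP => v; rewrite sum_lfunE differentialE.
under [RHS]eq_bigr do rewrite lfunE /= /dx differentialE (_ : forall c r : R, c *: r = c * r)
  // mulr_sumr.
rewrite exchange_big /=; apply: eq_bigr => i _; under eq_bigr do rewrite mulrA.
rewrite -mulr_suml; congr (_ * _); rewrite /partial.
pose G p := phi x (psi y p).
have sG j : smooth_near (fun q => G q 0 j) (phi y y) by exact: transition_near (dom_center y) dy.
have eG : G (phi y y) = phi x y by rewrite /G phiK //; exact: dom_center.
have sf' : smooth_near (fun p => f (psi x p)) (G (phi y y)) by rewrite eG;
  apply/(smooth_at_chart _ dy).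
rewrite -eG -(smooth_near_chain (delta_mx 0 i) sG sf'); apply: near_eq_derive.
have := near_psi (dom_center y) (near_dom dy).
by apply: filterS => p dp; rewrite /G phiK.
Qed.
End Manifold.

(** * Bump functions and point derivations on a manifold *)

Section Bump.
Local Open Scope classical_set_scope.
Local Open Scope ring_scope.
Context {R : realType} {n : nat} {M : manifold R n}.
Implicit Types (f g : M -> R) (x y z : M) (W U : set M).

(** Asking chi to vanish near the points outside U, and not only at them,
    makes chi * f smooth everywhere as soon as f is smooth on U, whatever f
    is outside U. *)
Definition is_bump (U : set M) (y : M) (chi : M -> R) :=
  [/\ forall z, smooth_at chi z, \forall z \near y, chi z = 1 &
      forall z, ~ U z -> \forall w \near z, chi w = 0].

(** A bump function of a chart is extended by zero. This is smooth because
    its support is compact, hence closed in the Hausdorff space M. *)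
Lemma bump_exists U y : open U -> U y -> exists chi, is_bump U y chi.
Proof.
move=> oU Uy; have dy := dom_center y.
have : nbhs (phi y y) (phi y @` (dom y `&` U)).
  by apply: open_nbhs_nbhs; split; [exact: open_image_chart|exists y].
move=> /nbhs_ballP[r /= r0 Hr].
have r20 : 0 < r / 2 by rewrite divr_gt0.
have [b [sb b1 b0]] := bump_rV (phi y y) r20.
pose B := [set q : 'rV[R]_n | `|q - phi y y| <= r / 2].
have BO : B `<=` phi y @` (dom y `&` U).
  move=> q Bq; apply: Hr; rewrite -ball_normE /ball_ /= distrC.
  by apply: le_lt_trans Bq _; rewrite ltr_pdivrMr // ltr_pMr // ltr1n.
pose K := psi y @` B.
have KU : K `<=` dom y `&` U.
  by move=> _ [q /BO[z [dz Uz] <-] <-]; rewrite phiK.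
have cK : compact K.
  apply: continuous_compact.
    apply: continuous_in_subspaceT => q; rewrite inE => /BO[z [dz _] <-].
    by apply: psi_continuous; exists z.
  apply: bounded_closed_compact.
    exists (`|phi y y| + r / 2); split=> [|s hs q Bq]; first exact: num_real.
    rewrite -(subrK (phi y y) q); apply: le_trans (ler_normD _ _) _.
    by rewrite addrC; apply: le_trans (ltW hs); rewrite lerD2l.
  rewrite (_ : B = (fun q => `|q - phi y y|) @^-1` [set x : R | x <= r / 2]) //.
  apply: closed_comp; last exact: closed_le.
  move=> q _; apply: continuous_comp; last exact: norm_continuous.
  by apply: (@continuousB _ _ _ id (cst (phi y y))); [exact: id|exact: cst_continuous].
have clK := compact_closed (@manifold_hausdorff _ _ M) cK.
pose chi z : R := if asbool (dom y z) then b (phi y z) else 0.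
have chiK z : ~ K z -> chi z = 0.
  move=> nK; rewrite /chi; case: asboolP => // dz; apply: b0; rewrite ltNge; apply/negP => Bz.
  by apply: nK; exists (phi y z) => //; rewrite phiK.
have nearK z : ~ K z -> \forall w \near z, chi w = 0.
  move=> nK; have : nbhs z (~` K) by apply: open_nbhs_nbhs; split=> //; exact: closed_openC.
  by apply: filterS => w; exact: chiK.
exists chi; split.
- move=> z; have [dz|ndz] := pselect (dom y z).
    apply: (smooth_at_eq _ (smooth_at_pullback dz (sb _))).
    by apply: filterS (near_dom dz) => w dw; rewrite /chi; case: asboolP.
  apply: (smooth_at_eq _ (smooth_at_cst 0 z)).
  have : ~ K z by move=> /KU[].
  by move=> /nearK; apply: filterS => w ->.
- have H1 := near_phi dy b1; have H2 := near_dom dy.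
  near=> w; rewrite /chi; case: asboolP => [_|[]]; first by near: w; exact: H1.
  by near: w.
- by move=> z nU; apply: nearK => /KU[].
Unshelve. all: by end_near. Qed.

Lemma bump_at U y chi : is_bump U y chi -> chi y = 1.
Proof. by move=> [_ H _]; exact: (nbhs_singleton H). Qed.

Lemma bump_smooth U y chi z : is_bump U y chi -> smooth_at chi z.
Proof. by move=> [H _ _]. Qed.

Lemma bump_out U y chi z : is_bump U y chi -> ~ U z -> chi z = 0.
Proof. by move=> [_ _ H] /H/nbhs_singleton. Qed.

Lemma bump_mul U y chi f : is_bump U y chi -> (forall z, U z -> smooth_at f z) ->
  smooth (fun z => chi z * f z).
Proof.
move=> [sc _ c0] sf; apply/smoothP => z; have [Uz|nU] := pselect (U z).
  by apply: smooth_atM; [exact: sc|exact: sf].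
apply: (smooth_at_eq _ (smooth_at_cst 0 z)).
by apply: filterS (c0 z nU) => w ->; rewrite mul0r.
Qed.

Lemma bump_mul_near U y chi f : is_bump U y chi -> \forall z \near y, chi z * f z = f z.
Proof. by move=> [_ c1 _]; apply: filterS c1 => z ->; rewrite mul1r. Qed.

Lemma near_open (y : M) (P : M -> Prop) : (\forall z \near y, P z) ->
  exists2 U : set M, open_nbhs y U & forall z, U z -> P z.
Proof. by rewrite /prop_near1 nbhsE. Qed.

Lemma germ_extension f y : smooth_at f y ->
  exists2 F, smooth F & \forall z \near y, F z = f z.
Proof.
move=> /smooth_at_near/near_open[U [oU Uy] Uf].
have [chi bc] := bump_exists oU Uy.
by exists (fun z => chi z * f z); [exact: bump_mul bc Uf|exact: bump_mul_near f bc].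
Qed.

Lemma smooth_sum (I : Type) (r : seq I) (f : I -> M -> R) :
  (forall i, smooth (f i)) -> smooth (fun z => \sum_(i <- r) f i z).
Proof.
by move=> sf; apply/smoothP => z; apply: smooth_at_sum => i _; move/smoothP: (sf i).
Qed.

Lemma smoothM f g : smooth f -> smooth g -> smooth (fun z => f z * g z).
Proof. by move=> /smoothP sf /smoothP sg; apply/smoothP => z; exact: smooth_atM. Qed.

Lemma smoothD f g : smooth f -> smooth g -> smooth (fun z => f z + g z).
Proof. by move=> /smoothP sf /smoothP sg; apply/smoothP => z; exact: smooth_atD. Qed.

Lemma smooth_cst (c : R) : smooth (fun _ : M => c).
Proof. by apply/smoothP => z; exact: smooth_at_cst. Qed.

Lemma covector_differential y (a : dualspace (tangent y)) :
  exists2 f, smooth f & differential f y = a.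
Proof.
pose f0 z : R := \sum_(i < n) a (delta_mx 0 i : 'rV[R]_n) * phi y z 0 i.
have s0 : smooth_at f0 y.
  apply: smooth_at_sum => i _; apply: smooth_atM; first exact: smooth_at_cst.
  exact: smooth_at_coord (dom_center y).
have [f sf ef] := germ_extension s0; exists f => //.
have sc i : smooth_at (fun z => phi y z 0 i) y by exact: smooth_at_coord (dom_center y).
have si i : smooth_at (fun z => a (delta_mx 0 i : 'rV[R]_n) * phi y z 0 i) y.
  by apply: smooth_atM => //; exact: smooth_at_cst.
rewrite (differential_eq ef) /f0 differential_sum //; apply/lfunP => v; rewrite sum_lfunE.
under eq_bigr => i _.
  rewrite differentialZ // lfunE /= (_ : forall c r : R, c *: r = c * r) //.
  rewrite -[differential _ y]/(dx y i y) dxE; over.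
rewrite {2}(row_sum_delta v) linear_sum; apply: eq_bigr => i _.
by rewrite linearZ [RHS]mulrC.
Qed.

Record point_derivation (y : M) (E : (M -> R) -> R) : Prop := {
  pd_linear : forall c f g, smooth f -> smooth g -> E (fun z => c * f z + g z) = c * E f + E g;
  pd_mul : forall f g, smooth f -> smooth g -> E (fun z => f z * g z) = f y * E g + g y * E f }.

Section PointDerivation.
Variables (y : M) (E : (M -> R) -> R) (HE : point_derivation y E).

Lemma pd_cst c : E (fun=> c) = 0.
Proof.
have s1 := smooth_cst 1; have s0 := smooth_cst 0.
have E1 : E (fun=> 1) = 0.
  have := pd_mul HE s1 s1; rewrite (_ : (fun z => 1 * 1) = fun=> 1); last by apply/funext => z;
    rewrite mul1r.
  by rewrite !mul1r => /eqP; rewrite -subr_eq0 opprD addrA subrr sub0r oppr_eq0 => /eqP.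
have E0 : E (fun=> 0) = 0.
  have := pd_linear HE 1 s0 s0.
  rewrite (_ : (fun z => 1 * 0 + 0) = fun=> 0); last by apply/funext => z; rewrite mul1r addr0.
  by rewrite mul1r => /eqP; rewrite -subr_eq0 opprD addrA subrr sub0r oppr_eq0 => /eqP.
have := pd_linear HE c s1 s0.
rewrite (_ : (fun z => c * 1 + 0) = fun=> c); last by apply/funext => z; rewrite mulr1 addr0.
by rewrite E1 E0 mulr0 addr0.
Qed.

Lemma pdD f g : smooth f -> smooth g -> E (fun z => f z + g z) = E f + E g.
Proof.
move=> sf sg; have := pd_linear HE 1 sf sg; rewrite mul1r => <-.
by congr E; apply/funext => z; rewrite mul1r.
Qed.

Lemma pd_sum (I : Type) (r : seq I) (f : I -> M -> R) : (forall i, smooth (f i)) ->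
  E (fun z => \sum_(i <- r) f i z) = \sum_(i <- r) E (f i).
Proof.
move=> sf; elim: r => [|i r IH].
  rewrite big_nil -[RHS](pd_cst 0); congr E; apply/funext => z; by rewrite big_nil.
rewrite big_cons -IH -pdD //; last exact: smooth_sum.
by congr E; apply/funext => z; rewrite big_cons.
Qed.

(** If h vanishes on U and chi is a bump function for U, then chi * h = 0,
    and applying E to this product leaves E h. *)
Lemma pd_local f g : smooth f -> smooth g -> (\forall z \near y, f z = g z) -> E f = E g.
Proof.
move=> sf sg fg; pose h z := -1 * g z + f z.
have sh : smooth h by apply: smoothD => //; apply: smoothM => //; exact: smooth_cst.
have h0 : \forall z \near y, h z = 0 by apply: filterS fg => z fgz; rewrite /h fgz mulN1r addNr.
have [U [oU Uy] Uh] := near_open h0.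
have [chi bc] := bump_exists oU Uy.
have sc : smooth chi by apply/smoothP => z; exact: bump_smooth bc.
have := pd_mul HE sc sh; rewrite (_ : (fun z => _) = fun=> 0); last first.
  apply/funext => z; have [/Uh ->|/(bump_out bc) ->] := pselect (U z); first by rewrite mulr0.
  by rewrite mul0r.
rewrite pd_cst (bump_at bc) (nbhs_singleton h0) mul1r mul0r addr0.
rewrite /h (pd_linear HE) // mulN1r => /eqP; rewrite eq_sym addrC subr_eq0 => /eqP.
by [].
Qed.

(** After multiplication by a bump function the local expression of f is
    smooth on R^n, so Hadamard's lemma writes f near y as a constant plus a
    sum of products of two functions that vanish at y; the derivation rule
    kills each product. *)
Lemma pd_differential0 f : smooth f -> differential f y = 0 -> E f = 0.
Proof.
move=> sf df; have dy := dom_center y; pose p := phi y y.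
have sf0 : smooth_near (fun q => f (psi y q)) p by move/smoothP: sf; apply.
have Df0 i : 'D_(delta_mx 0 i) (fun q => f (psi y q)) p = 0.
  have := @differentialE _ _ _ f y (delta_mx 0 i : 'rV[R]_n); rewrite df lfunE /=.
  rewrite (bigD1 i) //= big1 ?addr0 => [|j ji]; first by rewrite !mxE !eqxx mulr1.
  by rewrite !mxE (negbTE ji) andbF mulr0.
have : \forall q \near p, smooth_near (fun q => f (psi y q)) q by exact: smooth_near_near.
move=> /nbhs_ballP[r /= r0 Hr]; have r20 : 0 < r / 2 by rewrite divr_gt0.
have [b [sb b1 b0]] := bump_rV p r20.
pose F q := b q * f (psi y q).
have sF : Cinfty setT F.
  apply: Cinfty_smooth_near => q _; have [qr|qr] := ltP (`|q - p|) r.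
    by apply: smooth_nearM => //; apply: Hr; rewrite -ball_normE /ball_ /= distrC.
  apply: (smooth_near_eq _ (smooth_near_cst 0 q)).
  have : r / 2 < `|q - p| by apply: lt_le_trans qr; rewrite ltr_pdivrMr // ltr_pMr // ltr1n.
  have cn : continuous_at q (fun w => `|w - p|).
    apply: continuous_comp; last exact: norm_continuous.
    by apply: (@continuousB _ _ _ id (cst p)); [exact: id|exact: cst_continuous].
  move=> qr2; move: cn; rewrite /continuous_at => /cvgr_gt /(_ _ qr2) H.
  near=> w; rewrite /F b0 ?mul0r //; near: w; exact: H.
have eF : \forall q \near p, F q = f (psi y q).
  by have := b1; apply: filterS => q; rewrite /F => ->; rewrite mul1r.
have [g [sg g0 gE]] := hadamard p sF.
have g00 i : g i p = 0 by rewrite g0 (near_eq_derive _ eF).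
have sgn i q : smooth_near (g i) q by apply: smooth_near_of openT _ (sg i).
have [chi bc] := bump_exists (dom_open y) dy.
pose P i z := chi z * (phi y z 0 i + - p 0 i).
pose G i z := chi z * g i (phi y z).
have sP i : smooth (P i).
  apply: bump_mul bc _ => z dz; apply: smooth_atD; last exact: smooth_at_cst.
  exact: smooth_at_coord.
have sG i : smooth (G i).
  by apply: bump_mul bc _ => z dz; exact: smooth_at_pullback.
have sPG i : smooth (fun z => P i z * G i z) by exact: smoothM.
have : E f = E (fun z => f y + \sum_(i < n) P i z * G i z).
  apply: pd_local => //; first by apply: smoothD; [exact: smooth_cst|exact: smooth_sum].
  have H1 := near_phi dy eF; have H2 := near_dom dy; have [_ H3 _] := bc.
  near=> z; have dz : dom y z by near: z.
  have c1 : chi z = 1 by near: z.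
  have : F (phi y z) = f (psi y (phi y z)) by near: z.
  rewrite phiK // => <-; rewrite gE; congr (_ + _).
    by rewrite (nbhs_singleton eF) phiK.
  by apply: eq_bigr => i _; rewrite /P /G c1 !mul1r.
rewrite pdD ?pd_cst ?add0r; [|exact: smooth_cst|exact: smooth_sum].
move=> ->; rewrite pd_sum // big1 // => i _; rewrite (pd_mul HE) //.
by rewrite /P /G -/p subrr !mulr0 mul0r g00 mulr0 mul0r addr0.
Unshelve. all: by end_near. Qed.
End PointDerivation.
End Bump.

(** * The exterior algebra of a vector space *)

Section Exterior.
Local Open Scope ring_scope.
Context {R : realType} {V : vectType R}.
Implicit Types (X Y : multivector V) (a b d : dualspace V) (s t w : seq (dualspace V)) (p q :
  int).

(** Contraction by the covector a; the wedge product satisfies the graded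
    Leibniz rule for it, which allows inductions on the list of arguments. *)
Definition ins a X : multivector V := fun s => X (a :: s).

Definition scalar_form (c : R) : multivector V := fun s => if s is [::] then c else 0.

Definition vector_form (u : V) : multivector V := fun s => if s is [:: a] then a u else 0.

Lemma in_ext_linear p X s t c a b : in_ext p X ->
  X (s ++ (c *: a + b) :: t) = c * X (s ++ a :: t) + X (s ++ b :: t).
Proof. by case=> H _ _; exact: H. Qed.

Lemma in_ext_alt p X s t w a : in_ext p X -> X (s ++ a :: t ++ a :: w) = 0.
Proof. by case=> _ H _; exact: H. Qed.

Lemma in_ext_degree p X s : in_ext p X -> (size s)%:Z <> p -> X s = 0.
Proof. by case=> _ _ H; exact: H. Qed.

Lemma in_ext0 p : in_ext p (fun _ : seq (dualspace V) => 0 : R).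
Proof. by split=> //= *; rewrite mulr0 addr0. Qed.

Lemma in_extZD p c X Y : in_ext p X -> in_ext p Y -> in_ext p (fun s => c * X s + Y s).
Proof.
move=> HX HY; split=> [s t c' a b|s t w a|s hs].
- by rewrite (in_ext_linear _ _ _ _ _ HX) (in_ext_linear _ _ _ _ _ HY); ring.
- by rewrite (in_ext_alt _ _ _ _ HX) (in_ext_alt _ _ _ _ HY) mulr0 addr0.
- by rewrite (in_ext_degree HX) // (in_ext_degree HY) // mulr0 addr0.
Qed.

Lemma in_extZ p c X : in_ext p X -> in_ext p (fun s => c * X s).
Proof.
move=> HX; have := in_extZD c HX (in_ext0 p).
by congr in_ext; apply/funext => s; rewrite addr0.
Qed.

Lemma in_ext_neg p X s : in_ext p X -> p < 0 -> X s = 0.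
Proof. by move=> HX p0; apply: (in_ext_degree HX) => e; move: p0; rewrite -e. Qed.

Lemma in_ext_ins p a X : in_ext p X -> in_ext (p - 1) (ins a X).
Proof.
move=> HX; split=> [s t c b d|s t w b|s hs]; rewrite /ins.
- exact: (in_ext_linear (a :: s) _ _ _ _ HX).
- exact: (in_ext_alt (a :: s) _ _ _ HX).
- by apply: (in_ext_degree HX) => /= e; apply: hs; rewrite -e -addn1 PoszD addrK.
Qed.

Lemma in_ext_linear_sum (I : Type) (r : seq I) p X s t (c : I -> R) (v : I -> dualspace V) :
  in_ext p X ->
  X (s ++ (\sum_(i <- r) c i *: v i) :: t) = \sum_(i <- r) c i * X (s ++ v i :: t).
Proof.
move=> HX; elim: r => [|i r IH].
  have := in_ext_linear s t 1 0 0 HX.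
  rewrite !big_nil scale1r addr0 mul1r => /eqP.
  by rewrite -subr_eq0 opprD addrA subrr sub0r oppr_eq0 => /eqP.
by rewrite !big_cons (in_ext_linear _ _ _ _ _ HX) IH.
Qed.

Lemma alternating_swap (U : lmodType R) (g : U -> U -> R) (a b : U) :
  (forall c x y z, g (c *: x + y) z = c * g x z + g y z) ->
  (forall c x y z, g z (c *: x + y) = c * g z x + g z y) ->
  (forall x, g x x = 0) -> g a b = - g b a.
Proof.
move=> gl gr g0; have := g0 (1 *: a + b); rewrite gl !gr !g0 !mul1r add0r addr0 => /eqP.
by rewrite addr_eq0 => /eqP.
Qed.

Lemma in_ext_swap p X s t a b : in_ext p X -> X (s ++ a :: b :: t) = - X (s ++ b :: a :: t).
Proof.
move=> HX; apply: (@alternating_swap _ (fun a b => X (s ++ a :: b :: t))).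
- by move=> c x y z; exact: in_ext_linear HX.
- move=> c x y z; rewrite -!(cat_rcons z); exact: in_ext_linear HX.
- by move=> x; exact: (in_ext_alt s [::] t x HX).
Qed.

Lemma wedgeE N X Y s : size s = N ->
  wedge X Y s = \sum_(m : N.-tuple bool)
    (-1) ^+ inversions m * X (mask m s) * Y (mask (map negb m) s).
Proof. by move=> <-. Qed.

Lemma wedge_nil X Y : wedge X Y [::] = X [::] * Y [::].
Proof.
rewrite (@wedgeE 0) // (big_pred1 [tuple]) => [|m]; last by apply/esym/eqP/tuple0.
by rewrite /inversions big_ord0 expr0 mul1r.
Qed.

(** Placing a false in front of a mask adds one inversion for each true of
    the mask. *)
Lemma inversions_cons (b : bool) (m : bitseq) :
  inversions (b :: m) = ((if b then 0 else count id m) + inversions m)%N.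
Proof.
rewrite /inversions /= big_ord_recl /=; congr (_ + _)%N.
  rewrite big_mkcond big_ord_recl /= add0n.
  case: b; first by rewrite big1.
  rewrite -sum1_count (big_nth false) big_mkord [RHS]big_mkcond /=.
  by apply: eq_bigr => i _; case: nth.
apply: eq_bigr => i _; rewrite big_mkcond big_ord_recl /= add0n [RHS]big_mkcond.
by apply: eq_bigr => j _; rewrite /bump /= !add1n ltnS.
Qed.

Lemma sum_tuple_cons N (F : N.+1.-tuple bool -> R) :
  \sum_m F m = \sum_(m : N.-tuple bool) F [tuple of true :: m] +
               \sum_(m : N.-tuple bool) F [tuple of false :: m].
Proof.
rewrite (reindex (fun bm : bool * N.-tuple bool => [tuple of bm.1 :: bm.2])) /=.
  rewrite -(pair_bigA _ (fun (c : bool) (m : N.-tuple bool) => F [tuple of c :: m])) /=.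
  by rewrite big_bool.
exists (fun m => (thead m, [tuple of behead m])) => [[c m] _|m _] /=.
  by congr pair; apply: val_inj.
by rewrite [RHS](tuple_eta m); apply: val_inj.
Qed.

(** The shuffles are sorted according to the factor that receives the first
    argument: contraction is an antiderivation of the wedge product. Where
    the number of true bits differs from p the term is zero, so the sign is
    uniform. *)
Lemma wedge_cons p X Y a s : in_ext p X ->
  wedge X Y (a :: s) = wedge (ins a X) Y s + (-1) ^ p * wedge X (ins a Y) s.
Proof.
move=> HX; rewrite (@wedgeE (size s).+1) // sum_tuple_cons; congr (_ + _).
  by apply: eq_bigr => m _; rewrite inversions_cons add0n.
rewrite mulr_sumr; apply: eq_bigr => m _; rewrite inversions_cons /=.
have [e|ne] := pselect ((size (mask m s))%:Z = p).
  rewrite -e -exprnP size_mask ?size_tuple //.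
  by rewrite exprD /ins !mulrA.
by rewrite (in_ext_degree HX ne) !(mulr0, mul0r).
Qed.

Lemma wedgel_linear c X X' Y s :
  wedge (fun s => c * X s + X' s) Y s = c * wedge X Y s + wedge X' Y s.
Proof.
rewrite mulr_sumr -big_split /=; apply: eq_bigr => m _; ring.
Qed.

Lemma wedger_linear c X Y Y' s :
  wedge X (fun s => c * Y s + Y' s) s = c * wedge X Y s + wedge X Y' s.
Proof.
rewrite mulr_sumr -big_split /=; apply: eq_bigr => m _; ring.
Qed.

Lemma wedge0r X s : wedge X (fun=> 0) s = 0.
Proof. by rewrite /wedge big1 // => m _; rewrite mulr0. Qed.

Lemma wedge0l Y s : wedge (fun=> 0) Y s = 0.
Proof. by rewrite /wedge big1 // => m _; rewrite mulr0 mul0r. Qed.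

Lemma wedge_linear p q X Y s t c a b : in_ext p X -> in_ext q Y ->
  wedge X Y (s ++ (c *: a + b) :: t) = c * wedge X Y (s ++ a :: t) + wedge X Y (s ++ b :: t).
Proof.
elim: s p q X Y => [|d s IH] p q X Y HX HY /=; rewrite !(wedge_cons _ _ _ HX).
  have eX : ins (c *: a + b) X = fun s => c * ins a X s + ins b X s.
    by apply/funext => s; exact: (in_ext_linear [::] s c a b HX).
  have eY : ins (c *: a + b) Y = fun s => c * ins a Y s + ins b Y s.
    by apply/funext => s; exact: (in_ext_linear [::] s c a b HY).
  by rewrite eX eY wedgel_linear wedger_linear; ring.
rewrite (IH _ _ _ _ (in_ext_ins d HX) HY) (IH _ _ _ _ HX (in_ext_ins d HY)); ring.
Qed.

Lemma signB1 p : (-1) ^ (p - 1) = - (-1) ^ p :> R.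
Proof.
by rewrite expfzDr ?oppr_eq0 ?oner_eq0 // mulrC (_ : (-1) ^ (- 1) = -1 :> R) ?mulN1r // /exprz
  /= invrN invr1.
Qed.

Lemma wedge_alt_front p q X Y w a : in_ext p X -> in_ext q Y -> wedge X Y (a :: a :: w) = 0.
Proof.
move=> HX HY; rewrite (wedge_cons _ _ _ HX) (wedge_cons _ _ _ (in_ext_ins a HX)) (wedge_cons _
  _ _ HX).
rewrite (_ : ins a (ins a X) = fun=> 0); last by apply/funext => s;
  exact: (in_ext_alt [::] [::] s a HX).
rewrite (_ : ins a (ins a Y) = fun=> 0); last by apply/funext => s;
  exact: (in_ext_alt [::] [::] s a HY).
by rewrite wedge0l wedge0r signB1; ring.
Qed.

(** Induction on the number of arguments before the second occurrence of a.
    An argument in front of both is moved into the factors by [wedge_cons];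
    one between them is first exchanged with the first occurrence. *)
Lemma wedge_alt p q X Y s t w a : in_ext p X -> in_ext q Y ->
  wedge X Y (s ++ a :: t ++ a :: w) = 0.
Proof.
have [N] := ubnP (size s + size t)%N; elim: N => // N IH in s t p q X Y *.
rewrite ltnS => le HX HY; case: s le => [|d s] le /=; last first.
  rewrite (wedge_cons _ _ _ HX) (IH _ _ _ _ _ _ _ (in_ext_ins d HX) HY) //.
  by rewrite (IH _ _ _ _ _ _ _ HX (in_ext_ins d HY)) // mulr0 addr0.
case: t le => [|d t] le /=; first exact: wedge_alt_front HX HY.
have -> : wedge X Y (a :: d :: t ++ a :: w) = - wedge X Y (d :: a :: t ++ a :: w).
  apply: (@alternating_swap _ (fun a d => wedge X Y (a :: d :: t ++ _ :: w))).
  - by move=> c x y z; exact: (wedge_linear [::] _ _ _ _ HX HY).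
  - by move=> c x y z; exact: (wedge_linear [:: z] _ _ _ _ HX HY).
  - by move=> x; exact: wedge_alt_front HX HY.
rewrite (wedge_cons _ _ _ HX).
rewrite (IH [::] t _ _ _ _ _ (in_ext_ins d HX) HY) //.
by rewrite (IH [::] t _ _ _ _ _ HX (in_ext_ins d HY)) // mulr0 addr0 oppr0.
Qed.

Lemma wedge_degree p q X Y s : in_ext p X -> in_ext q Y -> (size s)%:Z <> p + q ->
  wedge X Y s = 0.
Proof.
elim: s p q X Y => [|a s IH] p q X Y HX HY ne.
  rewrite wedge_nil; have [p0|np] := pselect (0%N%:Z = p).
    rewrite (in_ext_degree HY) ?mulr0 // => e; apply: ne; by rewrite -p0 -e.
  by rewrite (in_ext_degree HX) ?mul0r.
have e : (size (a :: s))%:Z = (size s)%:Z + 1 by rewrite /= -addn1 PoszD.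
rewrite (wedge_cons _ _ _ HX) (IH _ _ _ _ (in_ext_ins a HX) HY).
  rewrite (IH _ _ _ _ HX (in_ext_ins a HY)) ?mulr0 ?addr0 // => H; apply: ne.
  by rewrite e H; ring.
by move=> H; apply: ne; rewrite e H; ring.
Qed.

Lemma in_ext_wedge p q X Y : in_ext p X -> in_ext q Y -> in_ext (p + q) (wedge X Y).
Proof.
move=> HX HY; split=> [s t c a b|s t w a|s hs].
- exact: wedge_linear HX HY.
- exact: wedge_alt HX HY.
- exact: wedge_degree HX HY hs.
Qed.

Lemma in_ext_scalar c : in_ext 0 (scalar_form c).
Proof.
split=> [[|x s] t c' a b|[|x s] t w a|[|x s] hs] //=; by rewrite mulr0 addr0.
Qed.

Lemma in_ext_vector u : in_ext 1 (vector_form u).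
Proof.
split=> [s t c a b|s t w a|s hs].
- case: s => [|x [|y s]] /=; last 2 first.
  + by rewrite mulr0 addr0.
  + by rewrite mulr0 addr0.
  by case: t => [|x t]; rewrite ?lfunE /= ?lfunE //= ?mulr0 ?addr0.
- by case: s => [|x [|y s]] //=; case: t.
- by case: s hs => [|x [|y s]].
Qed.

Lemma ins_vector a u : ins a (vector_form u) = scalar_form (a u).
Proof. by apply/funext => -[]. Qed.

Lemma wedge_scalarl c Y s : wedge (scalar_form c) Y s = c * Y s.
Proof.
elim: s Y => [|a s IH] Y; first by rewrite wedge_nil.
by rewrite (wedge_cons _ _ _ (in_ext_scalar c)) wedge0l add0r mul1r IH.
Qed.

Lemma wedge_scalarr p c X s : in_ext p X -> wedge X (scalar_form c) s = c * X s.
Proof.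
elim: s p X => [|a s IH] p X HX; first by rewrite wedge_nil mulrC.
by rewrite (wedge_cons _ _ _ HX) wedge0r mulr0 addr0 (IH _ _ (in_ext_ins a HX)).
Qed.

Lemma wedge_vector_cons u Y a s :
  wedge (vector_form u) Y (a :: s) = a u * Y s - wedge (vector_form u) (ins a Y) s.
Proof. by rewrite (wedge_cons _ _ _ (in_ext_vector u)) ins_vector wedge_scalarl mulN1r. Qed.

(** In the expansion of the product, the vector u is always paired with an
    argument. *)
Lemma wedge_vector_kill u Y s : (forall a, a \in s -> a u = 0) -> wedge (vector_form u) Y s = 0.
Proof.
elim: s Y => [|a s IH] Y H; first by rewrite wedge_nil mul0r.
rewrite wedge_vector_cons H ?mem_head // mul0r sub0r IH ?oppr0 // => b bs.
by apply: H; rewrite inE bs orbT.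
Qed.

Definition wedges (us : seq V) : multivector V :=
  foldr (fun u X => wedge (vector_form u) X) (scalar_form 1) us.

Lemma ins_wedges_kill a us : (forall u, u \in us -> a u = 0) -> ins a (wedges us) = fun=> 0.
Proof.
elim: us => [|u us IH] H; apply/funext => s //=.
rewrite /ins /= wedge_vector_cons H ?mem_head // mul0r sub0r IH ?wedge0r ?oppr0 // => v vus.
by apply: H; rewrite inE vus orbT.
Qed.

(** In the expansion along the first argument, contraction by eps k kills the
    product of the remaining vectors, so only the diagonal term is left. *)
Lemma wedges_dual (r : nat) (v : 'I_r -> V) (eps : 'I_r -> dualspace V) c (I : seq 'I_r) :
  (forall i j, eps i (v j) = if i == j then c else 0) -> uniq I ->
  wedges (map v I) (map eps I) = c ^+ size I.
Proof.
move=> dual; elim: I => [|k I IH] //= /andP[kI uI].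
rewrite wedge_vector_cons dual eqxx IH // -exprS ins_wedges_kill ?wedge0r ?subr0 //.
by move=> _ /mapP[i iI ->]; rewrite dual; case: eqP kI => // ->; rewrite iI.
Qed.

Lemma not_uniq_split (T : eqType) (s : seq T) : ~~ uniq s ->
  exists (s1 s2 s3 : seq T) (x : T), s = s1 ++ x :: s2 ++ x :: s3.
Proof.
elim: s => // x s IH /=; rewrite negb_and negbK => /orP[xs|/IH[s1 [s2 [s3 [y ->]]]]].
  by case/splitPr: xs => s1 s2; exists [::], s1, s2, x.
by exists (x :: s1), s2, s3, y.
Qed.

Section Frame.
Context {r : nat} (e : 'I_r -> V) (eps : 'I_r -> dualspace V).
Hypothesis frame : forall a : dualspace V, a = \sum_(i < r) a (e i) *: eps i.

Lemma in_ext_frame p X : in_ext p X -> (forall I, X (map eps I) = 0) -> forall s, X s = 0.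
Proof.
move=> HX H0 s; rewrite -[s]/(map eps [::] ++ s); move: [::] => I.
elim: s I => [|a s IH] I; first by rewrite cats0.
rewrite (frame a) (in_ext_linear_sum _ _ _ _ _ HX) big1 // => i _.
by rewrite -cat_rcons -map_rcons IH mulr0.
Qed.

Lemma in_ext_frame_uniq p X : in_ext p X -> (forall I, uniq I -> X (map eps I) = 0) ->
  forall s, X s = 0.
Proof.
move=> HX H0; apply: (in_ext_frame HX) => I; have [/H0 //|/not_uniq_split] := boolP (uniq I).
by move=> [s1 [s2 [s3 [x ->]]]]; rewrite map_cat /= map_cat /=; exact: in_ext_alt HX.
Qed.

(** By multilinearity it suffices to evaluate on lists of basis covectors,
    and a list of more than r of them has a repetition. *)
Lemma in_ext_gt p X s : in_ext p X -> r%:Z < p -> X s = 0.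
Proof.
move=> HX rp; apply: (in_ext_frame_uniq HX) => I uI; apply: (in_ext_degree HX) => eI.
move: rp; rewrite -eI size_map ltz_nat ltnNge.
by rewrite -(card_uniqP uI) (leq_trans (max_card _)) ?card_ord.
Qed.

Lemma in_ext_move p X a s t w : in_ext p X -> X (w ++ a :: s ++ t) = 0 ->
  X (w ++ s ++ a :: t) = 0.
Proof.
move=> HX; elim: s w => [|b s IH] w //=.
rewrite (in_ext_swap _ _ _ _ HX) => /eqP; rewrite oppr_eq0 => /eqP.
by rewrite -!(cat_rcons b); exact: IH.
Qed.

Lemma in_ext_block p X t1 t2 t3 w : in_ext p X ->
  X (w ++ t1 ++ t2 ++ t3) = 0 -> X (w ++ t2 ++ t1 ++ t3) = 0.
Proof.
move=> HX; elim: t1 w => [|a t1 IH] w //= H.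
by apply: (in_ext_move HX); rewrite -cat_rcons; apply: IH; rewrite cat_rcons.
Qed.

Lemma in_ext_perm p X I J : in_ext p X -> perm_eq I J ->
  X (map eps I) = 0 -> X (map eps J) = 0.
Proof.
move=> HX; apply: (catCA_perm_ind (P := fun I => X (map eps I) = 0)) => {I J} s1 s2 s3.
rewrite !map_cat; exact: (in_ext_block (w := [::]) HX).
Qed.

(** A repetition-free list of r basis covectors is a permutation of the whole
    basis, and the value on it changes only by a sign. *)
Lemma in_ext_top X : in_ext r%:Z X -> X (map eps (enum 'I_r)) = 0 -> forall s, X s = 0.
Proof.
move=> HX H0; apply: (in_ext_frame_uniq HX) => I uI.
have [sI|sI] := eqVneq (size I) r; last first.
  by apply: (in_ext_degree HX) => -[]; rewrite size_map; exact/eqP.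
apply: (in_ext_perm HX _ H0); rewrite perm_sym uniq_perm ?enum_uniq // => i.
rewrite mem_enum inE; have : #|I| = #|'I_r| by rewrite (card_uniqP uI) sI card_ord.
by move=> /subset_cardP H; rewrite (H (introT fintype.subsetP _) i).
Qed.

Lemma in_ext_top_eq X Y : in_ext r%:Z X -> in_ext r%:Z Y ->
  X (map eps (enum 'I_r)) = Y (map eps (enum 'I_r)) -> X = Y.
Proof.
move=> HX HY e0; apply/funext => s; apply/eqP; rewrite -subr_eq0; apply/eqP.
have := in_ext_top (in_extZD (-1) HY HX); rewrite mulN1r e0 addNr => /(_ erefl s).
by rewrite mulN1r addrC.
Qed.
End Frame.
End Exterior.

(** * Frames of a vector bundle and multivector fields *)

Section Trace.
Local Open Scope ring_scope.
Context {R : realType} {V : vectType R} {r : nat}.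
Variables (e : 'I_r -> V) (eps : 'I_r -> dualspace V).
Hypothesis decomp : forall v : V, v = \sum_(i < r) eps i v *: e i.

(** The trace does not depend on the basis: both sums are computed by
    expanding e k in the reference basis and g of the reference basis in the
    frame. *)
Lemma trace_frame (g : 'End(V)) : lfun_trace g = \sum_(k < r) eps k (g (e k)).
Proof.
set b := vbasis {:V}; have bV : basis_of {:V} b by exact: vbasisP.
rewrite /lfun_trace /mxtrace.
transitivity (\sum_i coord b i (g b`_i)).
  by apply: eq_bigr => i _; rewrite !mxE /= passmx.vecof_delta.
have bd v : v = \sum_i coord b i v *: b`_i by exact: (coord_basis bV (memvf v)).
under [RHS]eq_bigr => k _.
  rewrite (bd (e k)) linear_sum linear_sum /=.
  under eq_bigr do rewrite !linearZ /=.
  over.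
rewrite exchange_big /=; apply: eq_bigr => i _.
by rewrite {1}(decomp (g b`_i)) linear_sum; apply: eq_bigr => k _; rewrite linearZ [RHS]mulrC.
Qed.
End Trace.

Section Bundle.
Local Open Scope classical_set_scope.
Local Open Scope ring_scope.
Context {R : realType} {n : nat} {M : manifold R n} {r : nat} {A : vbundle M r}.
Implicit Types (x y z : M) (f h : M -> R) (u v : section A) (X Y : mvfield A) (p q : int).

Definition frame x (i : 'I_r) y : fib A y := (triv A x y)^-1%VF (delta_mx 0 i).

Lemma trivK x y : bdom A x y -> cancel (triv A x y) (triv A x y)^-1%VF.
Proof.
by move=> dy; apply: lker0_lfunK; apply/lker0P; exact: bij_inj (triv_bij dy).
Qed.

Lemma trivVK x y : bdom A x y -> cancel (triv A x y)^-1%VF (triv A x y).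
Proof.
by move=> dy w; have [g _ gK] := triv_bij dy; rewrite -(gK w) trivK.
Qed.

Lemma coframeE x i y (a : fib A y) : coframe A x i y a = triv A x y a 0 i.
Proof.
rewrite /coframe linfun_linear // => c b d; by rewrite linearP !mxE.
Qed.

Lemma coframe_frame x y i j : bdom A x y -> coframe A x i y (frame x j y) = if i == j then 1
  else 0.
Proof. by move=> dy; rewrite coframeE trivVK // mxE eqxx /=; case: (i == j). Qed.

Lemma frame_decomp x y (a : fib A y) : bdom A x y -> a = \sum_(i < r) coframe A x i y a *:
  frame x i y.
Proof.
move=> dy; rewrite -[LHS](trivK dy) [X in _ X = _]row_sum_delta linear_sum.
by apply: eq_bigr => i _; rewrite linearZ coframeE.
Qed.

Lemma coframe_decomp x y : bdom A x y -> forall a : dualspace (fib A y),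
  a = \sum_(i < r) a (frame x i y) *: coframe A x i y.
Proof.
move=> dy a; apply/lfunP => w; rewrite sum_lfunE {1}(frame_decomp w dy) linear_sum.
by apply: eq_bigr => i _; rewrite linearZ scale_lfunE [LHS]mulrC.
Qed.

Lemma mvext X Y : (forall x s, X x s = Y x s) -> X = Y.
Proof.
by move=> XY; apply/functional_extensionality_dep => x; apply/funext => s; exact: XY.
Qed.

Lemma smooth_sectionP u : smooth_section u <->
  forall x i y, bdom A x y -> smooth_at (fun y => coframe A x i y (u y)) y.
Proof.
split=> [su x i y dy|su x i].
  have /smooth_on_at H := su x i; have := H (bdom_open A x) y dy.
  by apply: smooth_at_eq; near=> z; rewrite coframeE.
apply/smooth_on_at; first exact: bdom_open.
move=> y dy; apply: smooth_at_eq (su x i y dy); by near=> z; rewrite coframeE.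
Unshelve. all: by end_near. Qed.

Lemma GammaP p X : Gamma p X <-> (forall x, in_ext p (X x)) /\
  forall x I y, bdom A x y -> smooth_at (fun y => X y [seq coframe A x i y | i <- I]) y.
Proof.
split=> -[H1 H2]; split=> // x I; [|apply/smooth_on_at; first exact: bdom_open].
  by have /smooth_on_at H := H2 x I; exact: (H (bdom_open A x)).
exact: H2.
Qed.

Lemma Gamma_in_ext p X x : Gamma p X -> in_ext p (X x).
Proof. by case. Qed.

Lemma Gamma_fun f : smooth f -> Gamma 0 (mv_fun A f).
Proof.
move=> sf; apply/GammaP; split=> [x|x I y _]; first exact: in_ext_scalar.
case: I => [|i I] /=; first by move/smoothP: sf; apply.
exact: smooth_at_cst.
Qed.

Lemma Gamma_section u : smooth_section u -> Gamma 1 (mv_section u).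
Proof.
move=> /smooth_sectionP su; apply/GammaP; split=> [x|x I y dy]; first exact: in_ext_vector.
by case: I => [|i [|j I]] /=; [exact: smooth_at_cst|exact: su|exact: smooth_at_cst].
Qed.

Lemma Gamma_wedge p q X Y : Gamma p X -> Gamma q Y -> Gamma (p + q) (mv_wedge X Y).
Proof.
move=> /GammaP[X1 X2] /GammaP[Y1 Y2]; apply/GammaP; split=> [x|x I y dy].
  exact: in_ext_wedge.
have : smooth_at (fun y => \sum_(m : (size I).-tuple bool) ((-1) ^+ inversions m
    * X y [seq coframe A x i y | i <- mask m I])
    * Y y [seq coframe A x i y | i <- mask (map negb m) I]) y.
  apply: smooth_at_sum => m _; apply: smooth_atM; last exact: Y2.
  by apply: smooth_atM; [exact: smooth_at_cst|exact: X2].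
apply: smooth_at_eq; near=> z; rewrite /mv_wedge (wedgeE (N := size I)) ?size_map //.
by apply: eq_bigr => m _; rewrite !map_mask.
Unshelve. all: by end_near. Qed.

Lemma Gamma_linear p c X Y : Gamma p X -> Gamma p Y -> Gamma p (mv_add (mv_scale c X) Y).
Proof.
move=> /GammaP[X1 X2] /GammaP[Y1 Y2]; apply/GammaP; split=> [x|x I y dy].
  exact: in_extZD.
apply: smooth_atD; last exact: Y2.
by apply: smooth_atM; [exact: smooth_at_cst|exact: X2].
Qed.

Lemma Gamma0 p : Gamma p (mv0 A).
Proof.
by apply/GammaP; split=> [x|x I y dy]; [exact: in_ext0|exact: smooth_at_cst].
Qed.

Lemma Gamma_scale p c X : Gamma p X -> Gamma p (mv_scale c X).
Proof.
move=> GX; have := Gamma_linear c GX (Gamma0 p).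
by congr Gamma; apply: mvext => x s; rewrite /mv_add /mv0 addr0.
Qed.

Lemma Gamma_neg p X : Gamma p X -> p < 0 -> X = mv0 A.
Proof.
by move=> [GX _] p0; apply: mvext => x s; exact: in_ext_neg (GX x) p0.
Qed.

Lemma Gamma_gt p X : Gamma p X -> r%:Z < p -> X = mv0 A.
Proof.
move=> [GX _] rp; apply: mvext => x s.
exact: (in_ext_gt (coframe_decomp (bdom_center A x)) s (GX x) rp).
Qed.

Lemma mv_wedge_funl f X : mv_wedge (mv_fun A f) X = fun x s => f x * X x s.
Proof. by apply: mvext => x s; exact: wedge_scalarl. Qed.

Lemma mv_wedge_funr p f X : Gamma p X -> mv_wedge X (mv_fun A f) = fun x s => f x * X x s.
Proof. by move=> [GX _]; apply: mvext => x s; exact: wedge_scalarr (GX x). Qed.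

Lemma Gamma0E X : Gamma 0 X -> smooth (fun x => X x [::]) /\ X = mv_fun A (fun x => X x [::]).
Proof.
move=> GX; have [GX1 GX2] := GX; split.
  apply/smoothP => y; have [_ H] := (GammaP 0 X).1 GX.
  exact: (H y [::] y (bdom_center A y)).
apply: mvext => x [|a s] //=.
exact: (in_ext_degree (GX1 x)).
Qed.

(** Biduality in finite dimension: a linear form on the dual of the fibre is
    evaluation at a vector. *)
Lemma Gamma1E X : Gamma 1 X -> exists2 u, smooth_section u & X = mv_section u.
Proof.
move=> GX; have [GX1 GX2] := GX.
pose u y : fib A y := \sum_(i < r) X y [:: coframe A y i y] *: frame y i y.
have Xu y (a : dualspace (fib A y)) : X y [:: a] = a (u y).
  rewrite {1}(coframe_decomp (bdom_center A y) a).
  have := in_ext_linear_sum (index_enum 'I_r) [::] [::] (fun i => a (frame y i y)) (fun i =>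
    coframe A y i y) (GX1 y).
  rewrite /= => ->; rewrite linear_sum; apply: eq_bigr => i _.
  by rewrite linearZ [LHS]mulrC.
exists u.
  apply/smooth_sectionP => x i y dy; have [_ H] := (GammaP 1 X).1 GX.
  apply: smooth_at_eq (H x [:: i] y dy); near=> z; exact: Xu.
apply: mvext => x [|a [|b s]] /=; [|exact: Xu|];
  by apply: (in_ext_degree (GX1 x)).
Unshelve. all: by end_near. Qed.

Lemma smooth_section_linear c u v : smooth_section u -> smooth_section v ->
  smooth_section (fun x => c *: u x + v x : fib A x).
Proof.
move=> /smooth_sectionP su /smooth_sectionP sv; apply/smooth_sectionP => x i y dy.
have := smooth_atD (smooth_atM (smooth_at_cst c y) (su x i y dy)) (sv x i y dy).
by apply: smooth_at_eq; near=> z; rewrite linearP.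
Unshelve. all: by end_near. Qed.

Lemma smooth_section_scale f u : smooth f -> smooth_section u ->
  smooth_section (fun x => f x *: u x : fib A x).
Proof.
move=> /smoothP sf /smooth_sectionP su; apply/smooth_sectionP => x i y dy.
have := smooth_atM (sf y) (su x i y dy).
by apply: smooth_at_eq; near=> z; rewrite linearZ.
Unshelve. all: by end_near. Qed.

Lemma smooth_section0 : smooth_section (fun x => 0 : fib A x).
Proof.
apply/smooth_sectionP => x i y dy.
by apply: smooth_at_eq (smooth_at_cst 0 y); near=> z; rewrite linear0.
Unshelve. all: by end_near. Qed.

Lemma smooth_section_sum (I : Type) (s : seq I) (u : I -> section A) :
  (forall i, smooth_section (u i)) -> smooth_section (fun x => \sum_(i <- s) u i x : fib A x).
Proof.
move=> su; elim: s => [|i s IH].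
  rewrite (_ : (fun x => _) = fun x => 0 : fib A x); first exact: smooth_section0.
  by apply/functional_extensionality_dep => x; rewrite big_nil.
rewrite (_ : (fun x => _) = fun x => 1 *: u i x + \sum_(i <- s) u i x : fib A x).
  exact: smooth_section_linear.
by apply/functional_extensionality_dep => x; rewrite big_cons scale1r.
Qed.

Section CutFrame.
Variables (x : M) (chi : M -> R).
Hypothesis bc : is_bump (bdom A x) x chi.

(** The local frame is multiplied by a bump function to get global sections,
    to which the axioms of the bracket apply. *)
Definition cut_frame (i : 'I_r) : section A := fun y => chi y *: frame x i y.

Lemma smooth_cut_frame i : smooth_section (cut_frame i).
Proof.
apply/smooth_sectionP => x1 j y d1; have [dy|ndy] := pselect (bdom A x y).
  have /smooth_on_at H := @triv_smooth _ _ _ _ A x x1 i j.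
  have oI := openI (@bdom_open _ _ _ _ A x) (@bdom_open _ _ _ _ A x1).
  have := smooth_atM (bump_smooth y bc) (H oI y (conj dy d1)).
  by apply: smooth_at_eq; near=> z; rewrite coframeE /cut_frame linearZ mxE.
apply: smooth_at_eq (smooth_at_cst 0 y).
have [_ _ /(_ y ndy)] := bc; apply: filterS => z c0.
by rewrite /cut_frame c0 scale0r linear0.
Unshelve. all: by end_near. Qed.

Lemma coframe_cut_frame y i j : bdom A x y ->
  coframe A x i y (cut_frame j y) = if i == j then chi y else 0.
Proof.
move=> dy; rewrite coframeE /cut_frame linearZ mxE -coframeE coframe_frame //.
by case: ifP => _; rewrite ?mulr1 ?mulr0.
Qed.

Lemma cut_frame_center i : cut_frame i x = frame x i x.
Proof. by rewrite /cut_frame (bump_at bc) scale1r. Qed.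

(** Constant coefficients in the frame make this linear in the vector a. *)
Definition extend (a : fib A x) : section A :=
  fun y => \sum_(i < r) coframe A x i x a *: cut_frame i y.

Lemma smooth_extend a : smooth_section (extend a).
Proof.
apply: smooth_section_sum => i; apply: smooth_section_scale; first exact: smooth_cst.
exact: smooth_cut_frame.
Qed.

Lemma extend_center a : extend a x = a.
Proof.
rewrite {2}(frame_decomp a (bdom_center A x)); apply: eq_bigr => i _.
by rewrite cut_frame_center.
Qed.

Lemma extend_linear c a b : extend (c *: a + b) = fun y => c *: extend a y + extend b y.
Proof.
apply/functional_extensionality_dep => y; rewrite /extend scaler_sumr -big_split /=.
by apply: eq_bigr => i _; rewrite !coframeE linearP !mxE scalerDl -scalerA.
Qed.

Definition cut_wedges (I : seq 'I_r) : mvfield A :=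
  foldr (fun i X => mv_wedge (mv_section (cut_frame i)) X) (mv_fun A (fun=> 1)) I.

Arguments cut_wedges I x s : clear implicits.

Lemma cut_wedgesE I y : cut_wedges I y = wedges [seq cut_frame i y | i <- I].
Proof.
elim: I => [|i I IH] //=.
by rewrite /mv_wedge IH.
Qed.

Lemma Gamma_cut_wedges I : Gamma (size I)%:Z (cut_wedges I).
Proof.
elim: I => [|i I IH] /=; first by apply: Gamma_fun; exact: smooth_cst.
rewrite -add1n PoszD; apply: Gamma_wedge => //; apply: Gamma_section.
exact: smooth_cut_frame.
Qed.

Lemma cut_wedges_coframe I y : bdom A x y -> uniq I ->
  cut_wedges I y [seq coframe A x i y | i <- I] = chi y ^+ size I.
Proof.
move=> dy uI; rewrite cut_wedgesE.
apply: (wedges_dual (eps := fun i => coframe A x i y) (v := fun i => cut_frame i y)) => //.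
by move=> i j; exact: coframe_cut_frame.
Qed.

Definition top_coef X y : R := X y [seq coframe A x i y | i <- enum 'I_r].

Lemma top_coef_smooth X y : Gamma r%:Z X -> bdom A x y -> smooth_at (top_coef X) y.
Proof. by move=> /GammaP[_ H] dy; exact: H. Qed.

(** The exponent counts one factor chi for each of the r sections in the
    wedge product and one for the coefficient. *)
Lemma top_form_decomp X : Gamma r%:Z X ->
  (fun y s => (chi y * top_coef X y) * cut_wedges (enum 'I_r) y s) =
  (fun y s => chi y ^+ r.+1 * X y s).
Proof.
move=> GX; apply/functional_extensionality_dep => y; have [dy|ndy] := pselect (bdom A x y);
  last first.
  by rewrite (bump_out bc ndy); apply/funext => s; rewrite expr0n !mul0r.
have GW := Gamma_in_ext y (Gamma_cut_wedges (enum 'I_r)); rewrite size_enum_ord in GW.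
have c0 : in_ext r%:Z (fun s => chi y ^+ r.+1 * X y s) by apply: in_extZ; exact: Gamma_in_ext.
have c1 : in_ext r%:Z (fun s => (chi y * top_coef X y) * cut_wedges (enum 'I_r) y s) by exact:
  in_extZ.
apply: (in_ext_top_eq (coframe_decomp dy) c1 c0).
by rewrite cut_wedges_coframe ?enum_uniq // size_enum_ord exprS /top_coef; ring.
Qed.

End CutFrame.
End Bundle.

(** * Brackets in a local frame *)

Arguments cut_wedges {R n M r A} x chi I y s : rename.

Section Algebroid.
Local Open Scope classical_set_scope.
Local Open Scope ring_scope.
Context {R : realType} {n : nat} {M : manifold R n} {r : nat} {A : vbundle M r}.
Variable L : lie_algebroid A.
Implicit Types (x y z : M) (f g h : M -> R) (u v w : section A) (X Y Z : mvfield A) (p q : int).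

Definition rho u f : M -> R := lie_derivative (fun x => anchor L x (u x)) f.

Lemma rhoE u f x : rho u f x = differential f x (anchor L x (u x)).
Proof. by []. Qed.

Lemma rho_smooth u f : smooth_section u -> smooth f -> smooth (rho u f).
Proof.
move=> su /smoothP sf; apply/smoothP => y; have dy := dom_center y.
have : smooth_at (fun z => \sum_(j < n) partial y j f z * dx y j z (anchor L z (u z))) y.
  apply: smooth_at_sum => j _; apply: smooth_atM; first exact: smooth_at_partial.
  have /smooth_on_at H := anchor_smooth L su y j.
  exact: (H (dom_open y)).
apply: smooth_at_eq; have := near_dom dy; apply: filterS => z dz.
rewrite rhoE (differential_chart dz (sf z)) sum_lfunE; apply: eq_bigr => j _.
by rewrite scale_lfunE.
Qed.

Lemma rho_near u f g x : (\forall z \near x, f z = g z) -> rho u f x = rho u g x.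
Proof. by move=> fg; rewrite !rhoE (differential_eq fg). Qed.

Lemma rho_cst u (c : R) x : rho u (fun=> c) x = 0.
Proof. by rewrite rhoE differential_cst lfunE. Qed.

Lemma rho_scale f u g x : rho (fun z => f z *: u z) g x = f x * rho u g x.
Proof. by rewrite !rhoE !linearZ. Qed.

Lemma rho_anchor0 u f x : anchor L x = 0 -> rho u f x = 0.
Proof. by move=> a0; rewrite rhoE a0 lfunE linear0. Qed.

Lemma bracketZDr c u v w : smooth_section u -> smooth_section v -> smooth_section w ->
  bracket L u (fun x => c *: v x + w x) = fun x => c *: bracket L u v x + bracket L u w x.
Proof.
move=> su sv sw; rewrite bracket_antisym //; last exact: smooth_section_linear.
rewrite bracket_linear // [in RHS](bracket_antisym L su sv) (bracket_antisym L su sw).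
by apply/functional_extensionality_dep => x; rewrite opprD scalerN.
Qed.

Lemma bracket0r u : smooth_section u -> bracket L u (fun x => 0) = fun x => 0.
Proof.
move=> su; have s0 := @smooth_section0 _ _ _ _ A.
have := bracketZDr (-1) su s0 s0.
rewrite (_ : (fun x => -1 *: 0 + 0) = fun x => 0 : fib A x); last first.
  by apply/functional_extensionality_dep => x; rewrite scaler0 addr0.
by move=> ->; apply/functional_extensionality_dep => x; rewrite scaleN1r addNr.
Qed.

Lemma bracket_sum_scale u (I : Type) (s : seq I) (g : I -> M -> R) (v : I -> section A) x :
  smooth_section u -> (forall i, smooth (g i)) -> (forall i, smooth_section (v i)) ->
  bracket L u (fun x => \sum_(i <- s) g i x *: v i x) x =
  \sum_(i <- s) (g i x *: bracket L u (v i) x + rho u (g i) x *: v i x).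
Proof.
move=> su sg sv; have sgv i : smooth_section (fun x => g i x *: v i x : fib A x).
  exact: smooth_section_scale.
elim: s => [|i s IH].
  rewrite big_nil (_ : (fun x => _) = fun x => 0 : fib A x) ?bracket0r //.
  by apply/functional_extensionality_dep => z; rewrite big_nil.
have e := congr1 (fun s : section A => s x) (bracket_leibniz L su (sv i) (sg i)).
rewrite big_cons -IH -[X in _ = X + _]e.
rewrite (_ : (fun x => _) = fun x => 1 *: (g i x *: v i x) + \sum_(i <- s) g i x *: v i x : fib
  A x).
  by rewrite bracketZDr //; [rewrite scale1r|exact: smooth_section_sum].
by apply/functional_extensionality_dep => z; rewrite big_cons scale1r.
Qed.

Lemma bracket_scale_l h u v x : smooth_section u -> smooth_section v -> smooth h ->
  bracket L (fun z => h z *: u z) v x = h x *: bracket L u v x - rho v h x *: u x.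
Proof.
move=> su sv sh; have shu : smooth_section (fun z => h z *: u z : fib A z) by exact:
  smooth_section_scale.
rewrite bracket_antisym // bracket_leibniz // (bracket_antisym L su sv).
by rewrite opprD scalerN.
Qed.

Section AtPoint.
Variables (x : M) (chi : M -> R).
Hypothesis bc : is_bump (bdom A x) x chi.
Local Notation E := (cut_frame (A := A) x chi).
Local Notation eps i := (coframe A x i x).

Lemma smooth_chi : smooth chi.
Proof. by apply/smoothP => z; exact: bump_smooth bc. Qed.

Lemma chi_near1 : \forall z \near x, chi z = 1.
Proof. by have [] := bc. Qed.

(** The section chi^2 v is a combination of the cut-off frame with smooth
    coefficients, and [u, chi^2 v] = [u, v] at x because chi = 1 near x. *)
Lemma bracket_expand u v : smooth_section u -> smooth_section v ->
  bracket L u v x = \sum_(i < r) (eps i (v x) *: bracket L u (E i) x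
    + rho u (fun z => chi z * coframe A x i z (v z)) x *: E i x).
Proof.
move=> su sv; have sg (i : 'I_r) : smooth (fun z => chi z * coframe A x i z (v z)).
  by apply: bump_mul bc _ => z dz; move/smooth_sectionP: sv; apply.
have := bracket_sum_scale (index_enum 'I_r) x su sg (smooth_cut_frame bc).
(* One factor chi is in the coefficients and the other in the frame. *)
rewrite (_ : (fun z => _) = fun z => (chi z * chi z) *: v z : fib A z); last first.
  apply/functional_extensionality_dep => z; have [dz|ndz] := pselect (bdom A x z).
    rewrite {2}(frame_decomp (v z) dz) scaler_sumr; apply: eq_bigr => i _.
    by rewrite /cut_frame !scalerA mulrAC.
  by rewrite (bump_out bc ndz) mul0r scale0r big1 // => i _; rewrite mul0r scale0r.
rewrite bracket_leibniz //; last by apply: smoothM; exact: smooth_chi.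
rewrite -/(rho u _ x) (@rho_near _ _ (fun=> 1)).
  rewrite rho_cst scale0r addr0 (bump_at bc) mulr1 scale1r => ->.
  by apply: eq_bigr => i _; rewrite mul1r.
by apply: filterS chi_near1 => z ->; rewrite mulr1.
Qed.

Lemma bracket_at_zero_r u v v' : anchor L x = 0 ->
  smooth_section u -> smooth_section v -> smooth_section v' -> v x = v' x ->
  bracket L u v x = bracket L u v' x.
Proof.
move=> a0 su sv sv' e; rewrite !bracket_expand //; apply: eq_bigr => i _.
by rewrite e !rho_anchor0.
Qed.

Lemma bracket_at_zero u u' v v' : anchor L x = 0 ->
  smooth_section u -> smooth_section u' -> smooth_section v -> smooth_section v' ->
  u x = u' x -> v x = v' x -> bracket L u v x = bracket L u' v' x.
Proof.
move=> a0 su su' sv sv' eu ev; rewrite (bracket_at_zero_r a0 su sv sv' ev).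
rewrite [LHS](congr1 (fun s : section A => s x) (bracket_antisym L su sv')).
rewrite [RHS](congr1 (fun s : section A => s x) (bracket_antisym L su' sv')).
by rewrite (bracket_at_zero_r a0 sv' su su' eu).
Qed.

Definition induced_bracket (a b : fib A x) : fib A x :=
  bracket L (extend chi a) (extend chi b) x.

Lemma induced_bracketP : anchor L x = 0 -> is_fibre_bracket L induced_bracket.
Proof.
move=> a0 u v su sv; apply: bracket_at_zero => //; try exact: smooth_extend.
  exact: extend_center.
exact: extend_center.
Qed.

(** At a zero of the anchor this is the trace of ad (w x); elsewhere it
    depends on the first derivatives of w. *)
Definition frame_trace w : R := \sum_(k < r) eps k (bracket L w (E k) x).

(** The Leibniz rule contributes - rho(e_k) h w to [h w, e_k], and the sum of
    the eps_k(w) rho(e_k) h is rho(w) h. *)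
Lemma frame_trace_scale h w : smooth_section w -> smooth h ->
  frame_trace (fun z => h z *: w z) = h x * frame_trace w - rho w h x.
Proof.
move=> sw sh; rewrite /frame_trace.
transitivity (\sum_(k < r) (h x * eps k (bracket L w (E k) x) - rho (E k) h x * eps k (w x))).
  apply: eq_bigr => k _; rewrite (bracket_scale_l x sw (smooth_cut_frame bc k) sh).
  by rewrite !coframeE linearB 2![in LHS]linearZ !mxE.
rewrite sumrB mulr_sumr; congr (_ - _).
have -> : rho w h x = rho (fun z => \sum_(k < r) eps k (w x) *: E k z) h x.
  rewrite !rhoE; congr (differential h x (anchor L x _)).
  by rewrite {1}(frame_decomp (w x) (bdom_center A x)); apply: eq_bigr => k _;
    rewrite cut_frame_center.
rewrite rhoE !linear_sum; apply: eq_bigr => k _.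
by rewrite mulrC rhoE [in RHS]linearZ [in RHS]linearZ.
Qed.

Lemma frame_trace_adjoint (m : fib A x -> fib A x -> fib A x) w : smooth_section w ->
  is_fibre_bracket L m -> frame_trace w = adjoint_character m (w x).
Proof.
move=> sw Hm; have ml : linear (m (w x)).
  have mE a : m (w x) a = bracket L w (extend chi a) x.
    by rewrite -{1}(extend_center bc a) Hm //; exact: smooth_extend.
  by move=> c a b; rewrite !mE extend_linear bracketZDr //; exact: smooth_extend.
rewrite /adjoint_character (trace_frame (e := fun k => frame x k x) (eps := fun k => eps k)).
  apply: eq_bigr => k _; rewrite linfun_linear // -(cut_frame_center bc) Hm //.
  exact: smooth_cut_frame.
by move=> a; exact: frame_decomp (bdom_center A x).
Qed.

Section Schouten.
Variable S : mvfield A -> mvfield A -> mvfield A.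
Arguments S : clear implicits.
Hypothesis hS : is_schouten_bracket L S.

Lemma schouten0l q Y : Gamma q Y -> S (mv0 A) Y = mv0 A.
Proof.
move=> GY; have := schouten_linearl hS (-1) (Gamma0 0) (Gamma0 0) GY.
rewrite (_ : mv_add (mv_scale (-1) (mv0 A)) (mv0 A) = mv0 A); last first.
  by apply: mvext => z s; rewrite /mv_add /mv_scale /mv0 mulr0 addr0.
by move=> ->; apply: mvext => z s; rewrite /mv_add /mv_scale mulN1r addNr.
Qed.

Lemma schouten0r p X : Gamma p X -> S X (mv0 A) = mv0 A.
Proof.
move=> GX; have := schouten_linearr hS (-1) GX (Gamma0 0) (Gamma0 0).
rewrite (_ : mv_add (mv_scale (-1) (mv0 A)) (mv0 A) = mv0 A); last first.
  by apply: mvext => z s; rewrite /mv_add /mv_scale /mv0 mulr0 addr0.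
by move=> ->; apply: mvext => z s; rewrite /mv_add /mv_scale mulN1r addNr.
Qed.

Lemma schouten_section_scale w h q Z : smooth_section w -> smooth h -> Gamma q Z ->
  S (mv_section w) (fun z s => h z * Z z s) =
  fun z s => rho w h z * Z z s + h z * S (mv_section w) Z z s.
Proof.
move=> sw sh GZ; rewrite -mv_wedge_funl.
rewrite (schouten_leibniz hS (Gamma_section sw) (Gamma_fun sh) GZ) (schouten_fun hS) //.
rewrite !mv_wedge_funl; apply: mvext => z s.
by rewrite /mv_add /mv_scale subrr mul0r expr0z mul1r.
Qed.

Lemma schouten_fun_fun f g : smooth f -> smooth g -> S (mv_fun A f) (mv_fun A g) = mv0 A.
Proof.
move=> sf sg; have := schouten_degree hS (Gamma_fun sf) (Gamma_fun sg).
by move=> /Gamma_neg; apply.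
Qed.

Lemma schouten_fun_scale f h q Z : smooth f -> smooth h -> Gamma q Z ->
  S (mv_fun A f) (fun z s => h z * Z z s) = fun z s => h z * S (mv_fun A f) Z z s.
Proof.
move=> sf sh GZ; rewrite -mv_wedge_funl.
rewrite (schouten_leibniz hS (Gamma_fun sf) (Gamma_fun sh) GZ) schouten_fun_fun //.
rewrite mv_wedge_funl; apply: mvext => z s.
by rewrite /mv_add /mv_scale /mv_wedge wedge0l add0r mulr0 expr0z mul1r.
Qed.

Local Notation W I := (cut_wedges x chi I).

(** By the Leibniz rule w acts on one factor at a time; evaluated on the
    coframe, only the diagonal coefficient of [w, e_k] survives. *)
Lemma schouten_section_wedges w (I : seq 'I_r) : smooth_section w -> uniq I ->
  S (mv_section w) (W I) x [seq eps i | i <- I] = \sum_(k <- I) eps k (bracket L w (E k) x).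
Proof.
move=> sw; elim: I => [|k I IH] /=.
  rewrite big_nil (schouten_fun hS) //; last exact: smooth_cst.
  by move=> _; exact: (rho_cst w 1 x).
move=> /andP[kI uI]; have sE := smooth_cut_frame bc k.
rewrite (schouten_leibniz hS (Gamma_section sw) (Gamma_section sE) (Gamma_cut_wedges bc I)).
rewrite (schouten_section hS) // big_cons /mv_add /mv_scale subrr mul0r expr0z mul1r.
have dx0 := bdom_center A x.
rewrite /mv_wedge [X in X + _](wedge_vector_cons (bracket L w (E k) x)).
rewrite [X in _ + X](wedge_vector_cons (E k x)) -IH //.
rewrite (cut_wedges_coframe chi dx0 uI) (bump_at bc) expr1n mulr1.
rewrite coframe_cut_frame // eqxx (bump_at bc) mul1r.
have -> : ins (eps k) (cut_wedges x chi I x) = fun=> 0.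
  rewrite cut_wedgesE; apply: ins_wedges_kill => _ /mapP[i iI ->].
  by rewrite coframe_cut_frame //; case: eqP kI => // ->; rewrite iI.
rewrite wedge0r subr0 wedge_vector_kill ?subr0 // => _ /mapP[i iI ->].
by rewrite coframe_cut_frame //; case: eqP iI kI => // -> ->.
Qed.

Lemma chi_pow_smooth k : smooth (fun z => chi z ^+ k).
Proof.
elim: k => [|k IH]; first exact: smooth_cst.
rewrite (_ : (fun z => _) = fun z => chi z * chi z ^+ k); first exact: smoothM smooth_chi IH.
by apply/funext => z; rewrite exprS.
Qed.

Lemma rho_chi_pow w k : rho w (fun z => chi z ^+ k) x = 0.
Proof.
rewrite (@rho_near _ _ (fun=> 1)) ?rho_cst //.
by apply: filterS chi_near1 => z ->; rewrite expr1n.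
Qed.

Lemma chi_top_coef_smooth Z : Gamma r%:Z Z -> smooth (fun z => chi z * top_coef x Z z).
Proof. by move=> GZ; apply: bump_mul bc _ => z dz; exact: top_coef_smooth. Qed.

(** The global identity of [top_form_decomp] is bracketed with w; at x the
    powers of chi have value 1 and derivative 0. *)
Lemma schouten_top w Z : smooth_section w -> Gamma r%:Z Z ->
  top_coef x (S (mv_section w) Z) x =
  rho w (fun z => chi z * top_coef x Z z) x + top_coef x Z x * frame_trace w.
Proof.
move=> sw GZ; have GW := Gamma_cut_wedges bc (enum 'I_r); rewrite size_enum_ord in GW.
have H := schouten_section_scale sw (chi_top_coef_smooth GZ) GW.
have := schouten_section_scale sw (chi_pow_smooth r.+1) GZ.
rewrite -(top_form_decomp bc GZ) H => /(congr1 (fun X : mvfield A => X x [seq eps i | i <- enum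
  'I_r])).
rewrite rho_chi_pow mul0r add0r (bump_at bc) expr1n !mul1r /top_coef => <-.
rewrite schouten_section_wedges ?enum_uniq // (cut_wedges_coframe chi (bdom_center A x))
  ?enum_uniq //.
by rewrite (bump_at bc) expr1n mulr1 big_enum.
Qed.

Lemma schouten_fun_wedges f I s : anchor L x = 0 -> smooth f -> S (mv_fun A f) (W I) x s = 0.
Proof.
move=> a0 sf; elim: I s => [|k I IH] s /=.
  by rewrite schouten_fun_fun //; exact: smooth_cst.
have sE := smooth_cut_frame bc k.
rewrite (schouten_leibniz hS (Gamma_fun sf) (Gamma_section sE) (Gamma_cut_wedges bc I)).
rewrite (schouten_antisym hS (Gamma_fun sf) (Gamma_section sE)) (schouten_fun hS) //.
rewrite /mv_add /mv_scale /mv_wedge.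
rewrite (_ : (fun s => _ * mv_fun A _ x s) = fun=> 0); last first.
  by apply/funext => -[|a t] /=; rewrite ?mulr0 // -/(rho (E k) f x) rho_anchor0 ?mulr0.
rewrite (_ : S _ _ x = fun=> 0); last by apply/funext.
by rewrite wedge0l wedge0r mulr0 addr0.
Qed.

(** The bracket with a function is tensorial in Z because two functions have
    zero bracket; on a frame it involves only the rho(e_k) f. *)
Lemma schouten_fun_top f Z s : smooth f -> Gamma r%:Z Z ->
  anchor L x = 0 \/ (forall t, Z x t = 0) -> S (mv_fun A f) Z x s = 0.
Proof.
move=> sf GZ H; have GW := Gamma_cut_wedges bc (enum 'I_r); rewrite size_enum_ord in GW.
have := schouten_fun_scale sf (chi_pow_smooth r.+1) GZ.
rewrite -(top_form_decomp bc GZ) (schouten_fun_scale sf (chi_top_coef_smooth GZ) GW).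
move=> /(congr1 (fun X : mvfield A => X x s)); rewrite (bump_at bc) expr1n !mul1r => <-.
case: H => [a0|Z0]; first by rewrite schouten_fun_wedges // mulr0.
by rewrite /top_coef Z0 mul0r.
Qed.
End Schouten.
End AtPoint.
End Algebroid.

(** * From a differential to a tensor *)

Section Tensor.
Local Open Scope classical_set_scope.
Local Open Scope ring_scope.
Context {R : realType} {n : nat} {M : manifold R n} {r : nat} {A : vbundle M r}.
Implicit Types (x y z : M) (f g h : M -> R) (X Y Z : mvfield A).

Lemma nonzero_near f y : smooth_at f y -> f y <> 0 -> \forall z \near y, f z <> 0.
Proof.
move=> /smooth_at_continuous cf /eqP f0.
have : nbhs (f y) [set t : R | t != 0] by apply: open_nbhs_nbhs; split=> //; exact: open_neq.
move=> /cf H; have {}H : \forall z \near y, f z != 0 by exact: H.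
by apply: filterS H => z /eqP.
Qed.

Section Fixed.
Variable pi : tensor_field A.
Arguments pi : clear implicits.
Hypothesis Hpi : is_top_tensor_section pi.

Lemma tensor_linear x c a b s : pi x (c *: a + b) s = c * pi x a s + pi x b s.
Proof. by case: Hpi. Qed.

Lemma tensor_in_ext x a : in_ext r%:Z (pi x a).
Proof. by case: Hpi. Qed.

Lemma tensor0 x s : pi x 0 s = 0.
Proof.
have := @tensor_linear x (-1) 0 0 s; rewrite scaler0 addr0 => ->.
by rewrite mulN1r addNr.
Qed.

Lemma tensor_sum x (I : Type) (l : seq I) (c : I -> R) (a : I -> dualspace (tangent x)) s :
  pi x (\sum_(i <- l) c i *: a i) s = \sum_(i <- l) c i * pi x (a i) s.
Proof.
elim: l => [|i l IH]; first by rewrite !big_nil tensor0.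
by rewrite !big_cons tensor_linear IH.
Qed.

Lemma tensor_smooth x0 x1 j (I : seq 'I_r) y : dom x0 y -> bdom A x1 y ->
  smooth_at (fun y => pi y (dx x0 j y) [seq coframe A x1 i y | i <- I]) y.
Proof.
move=> d0 d1; case: Hpi => _ _ H; have /smooth_on_at H' := H x0 x1 j I.
by apply: H' => //; apply: openI; [exact: dom_open|exact: bdom_open].
Qed.

Lemma Gamma_iota f : smooth f -> Gamma r%:Z (iota_d f pi).
Proof.
move=> /smoothP sf; apply/GammaP; split=> [x|x I y dy]; first exact: tensor_in_ext.
have d0 := dom_center y.
have : smooth_at (fun z => \sum_(j < n) partial y j f z *
    pi z (dx y j z) [seq coframe A x i z | i <- I]) y.
  apply: smooth_at_sum => j _; apply: smooth_atM; first exact: smooth_at_partial.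
  exact: tensor_smooth.
apply: smooth_at_eq; apply: filterS (near_dom d0) => z dz.
by rewrite /iota_d (differential_chart dz (sf z)) tensor_sum.
Qed.

(** Some component of pi in the coordinate and bundle frames is nonzero at x,
    and it is continuous. *)
Lemma nonvanishing_near x : ~ vanishes_at pi x -> \forall y \near x, ~ vanishes_at pi y.
Proof.
move=> nv; have [j nj] : exists j, pi x (dx x j x) [seq coframe A x i x | i <- enum 'I_r] <> 0.
  apply: contrapT => /forallNP H; apply: nv => a s.
  have -> : a = \sum_(j < n) a (delta_mx 0 j : 'rV[R]_n) *: dx x j x.
    apply/lfunP => v; rewrite sum_lfunE {1}(row_sum_delta v) linear_sum.
    by apply: eq_bigr => j _; rewrite scale_lfunE dxE linearZ [LHS]mulrC.
  rewrite tensor_sum big1 // => j _.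
  rewrite (in_ext_top (coframe_decomp (bdom_center A x)) (tensor_in_ext _)) ?mulr0 //.
  exact: contrapT (H j).
have := nonzero_near (tensor_smooth j (enum 'I_r) (dom_center x) (bdom_center A x)) nj.
by apply: filterS => y ny vy; apply: ny; exact: vy.
Qed.
End Fixed.
End Tensor.

Section Anchor.
Local Open Scope classical_set_scope.
Local Open Scope ring_scope.
Context {R : realType} {n : nat} {M : manifold R n} {r : nat} {A : vbundle M r}.
Variable L : lie_algebroid A.
Implicit Types (x y z : M) (f g h : M -> R) (X Y Z : mvfield A).

Lemma anchor_neq0 x : anchor L x <> 0 ->
  exists (u : section A) (j : 'I_n), smooth_section u /\ dx x j x (anchor L x (u x)) <> 0.
Proof.
move=> an0; have [chi bc] := bump_exists (bdom_open A x) (bdom_center A x).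
apply: contrapT => H; apply: an0; apply/lfunP => a; rewrite lfunE /=.
apply/rowP => j; rewrite [RHS]mxE; apply: contrapT => nz; apply: H.
exists (extend chi a), j; split; first exact: smooth_extend bc a.
by rewrite dxE extend_center.
Qed.

Lemma anchor_neq0_near x : anchor L x <> 0 -> \forall y \near x, anchor L y <> 0.
Proof.
move=> /anchor_neq0[u [j [su nz]]].
have /smooth_on_at H := anchor_smooth L su x j.
have := nonzero_near (H (dom_open x) x (dom_center x)) nz.
by apply: filterS => y ny ay; apply: ny; rewrite ay lfunE linear0.
Qed.

Lemma rho_neq0 x : anchor L x <> 0 ->
  exists u f, [/\ smooth_section u, smooth f & rho L u f x <> 0].
Proof.
move=> /anchor_neq0[u [j [su nz]]].
have [f sf df] := covector_differential (dx x j x).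
by exists u, f; split=> //; rewrite rhoE df.
Qed.
End Anchor.

Section Correspondence.
Local Open Scope classical_set_scope.
Local Open Scope ring_scope.
Context {R : realType} {n : nat} {M : manifold R n} {r : nat} {A : vbundle M r}.
Variable L : lie_algebroid A.
Variable S : mvfield A -> mvfield A -> mvfield A.
Arguments S : clear implicits.
Hypothesis hS : is_schouten_bracket L S.
Implicit Types (x y z : M) (f g h : M -> R) (u v w : section A) (X Y Z : mvfield A) (p q : int).

Lemma shift_degree p : p + (r.+1)%:Z - 1 = p + r%:Z.
Proof. by rewrite -addn1 PoszD addrA addrK. Qed.

Section Direct.
Variable delta : mvfield A -> mvfield A.
Arguments delta : clear implicits.
Hypothesis Hd : is_differential S r.+1 delta.

Lemma delta_pos p X : Gamma p X -> 0 < p -> delta X = mv0 A.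
Proof.
move=> GX p0; have := differential_degree Hd GX; rewrite shift_degree => /Gamma_gt; apply.
by rewrite ltrDr.
Qed.

Lemma delta0 : delta (mv0 A) = mv0 A.
Proof.
have := differential_linear Hd (-1) (Gamma0 0) (Gamma0 0).
rewrite (_ : mv_add (mv_scale (-1) (mv0 A)) (mv0 A) = mv0 A); last first.
  by apply: mvext => z s; rewrite /mv_add /mv_scale /mv0 mulr0 addr0.
by move=> ->; apply: mvext => z s; rewrite /mv_add /mv_scale mulN1r addNr.
Qed.

Lemma delta_section u : smooth_section u -> delta (mv_section u) = mv0 A.
Proof. by move=> su; exact: (delta_pos (Gamma_section su)). Qed.

Lemma Gamma_delta_fun f : smooth f -> Gamma r%:Z (delta (mv_fun A f)).
Proof. by move=> sf; have := differential_degree Hd (Gamma_fun sf);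
  rewrite shift_degree add0r. Qed.

Lemma delta_derivation x s : point_derivation x (fun f => delta (mv_fun A f) x s).
Proof.
split=> [c f g sf sg|f g sf sg].
  rewrite (_ : mv_fun A _ = mv_add (mv_scale c (mv_fun A f)) (mv_fun A g)).
    by rewrite (differential_linear Hd _ (Gamma_fun sf) (Gamma_fun sg)).
  by apply: mvext => z [|a t]; rewrite /mv_add /mv_scale //= mulr0 addr0.
rewrite (_ : mv_fun A _ = mv_wedge (mv_fun A f) (mv_fun A g)).
  rewrite (differential_wedge Hd (Gamma_fun sf) (Gamma_fun sg)) /mv_add /mv_scale.
  rewrite (mv_wedge_funr _ (Gamma_delta_fun sf)) mv_wedge_funl mulr0 expr0z mul1r.
  exact: addrC.
by rewrite mv_wedge_funl; apply: mvext => z [|a t] //=; rewrite mulr0.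
Qed.

Lemma delta_fun_eq f g x s : smooth f -> smooth g -> differential f x = differential g x ->
  delta (mv_fun A f) x s = delta (mv_fun A g) x s.
Proof.
move=> sf sg e; have D := delta_derivation s.
have sh : smooth (fun z => -1 * g z + f z) by apply: smoothD => //; apply: smoothM => //;
  exact: smooth_cst.
have := pd_differential0 D sh; rewrite (pd_linear D) // mulN1r addrC => H.
apply/eqP; rewrite -subr_eq0; apply/eqP; apply: H.
move/smoothP: sf e => sf e; move/smoothP: sg => sg.
by rewrite differentialD ?differentialZ ?e ?scaleN1r ?addNr //; apply: smooth_atM => //;
  exact: smooth_at_cst.
Qed.

(** The bracket of a section and a function, where delta kills the section. *)
Lemma delta_rho u f : smooth_section u -> smooth f ->
  delta (mv_fun A (rho L u f)) = S (mv_section u) (delta (mv_fun A f)).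
Proof.
move=> su sf; have GS := Gamma_section su; have GF : Gamma 0 (mv_fun A f) := Gamma_fun sf.
have := differential_bracket Hd GS GF; rewrite (schouten_fun hS) // => ->.
rewrite delta_section // (schouten0l hS GF); apply: mvext => z s.
by rewrite /mv_add /mv_scale subrr mulr0 expr0z mul1r add0r.
Qed.

Definition dcoef x f : R := top_coef x (delta (mv_fun A f)) x.

Lemma dcoef_rho x chi u f : is_bump (bdom A x) x chi -> smooth_section u -> smooth f ->
  dcoef x (rho L u f) =
  rho L u (fun z => chi z * top_coef x (delta (mv_fun A f)) z) x + dcoef x f * frame_trace L x
    chi u.
Proof.
move=> bc su sf; rewrite /dcoef delta_rho //.
exact: (schouten_top bc hS su (Gamma_delta_fun sf)).
Qed.

(** The identity [dcoef_rho] for h u, minus h times the one for u: all terms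
    cancel except the derivative of h in the derivation rule and the one in
    [frame_trace_scale]. *)
Lemma dcoef_anchor x u f h : smooth_section u -> smooth f -> smooth h ->
  dcoef x h * rho L u f x = - (dcoef x f * rho L u h x).
Proof.
move=> su sf sh; have [chi bc] := bump_exists (bdom_open A x) (bdom_center A x).
have shu : smooth_section (fun z => h z *: u z : fib A z) by exact: smooth_section_scale.
have := dcoef_rho bc shu sf.
rewrite (_ : rho L _ f = fun z => h z * rho L u f z); last by apply/funext => z;
  rewrite rho_scale.
rewrite rho_scale (frame_trace_scale L bc) // /dcoef {1}/top_coef.
rewrite (pd_mul (delta_derivation (x := x) _)) //; last exact: rho_smooth.
rewrite -!/(top_coef _ _ _) -!/(dcoef _ _) (dcoef_rho bc su sf) => H.
by move: H; lra.
Qed.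

(** Choose u and g with rho(u) g nonzero at x. Applied to g and g,
    [dcoef_anchor] gives dcoef x g = 0; applied to g and f, it then gives
    dcoef x f = 0. *)
Lemma delta_fun_anchor_neq0 x f s : anchor L x <> 0 -> smooth f -> delta (mv_fun A f) x s = 0.
Proof.
move=> /rho_neq0[u [g [su sg /eqP nz]]] sf.
have g0 : dcoef x g = 0.
  have /eqP := dcoef_anchor x su sg sg; rewrite -subr_eq0 opprK -mulr2n mulrn_eq0 /= mulf_eq0
    (negbTE nz) orbF.
  by move/eqP.
have := dcoef_anchor x su sg sf; rewrite g0 mul0r oppr0 => /eqP;
  rewrite mulf_eq0 (negbTE nz) orbF => /eqP f0.
exact: (in_ext_top (coframe_decomp (bdom_center A x)) (Gamma_in_ext x (Gamma_delta_fun sf)) f0).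
Qed.

(** Any function with differential a at x would do, since [delta_fun_eq]
    makes the resulting value independent of the choice. *)
Definition primitive x (a : dualspace (tangent x)) : M ->
  R := sval (cid2 (covector_differential a)).

Lemma primitive_smooth x (a : dualspace (tangent x)) : smooth (primitive a).
Proof. by rewrite /primitive; case: cid2. Qed.

Lemma primitive_differential x (a : dualspace (tangent x)) : differential (primitive a) x = a.
Proof. by rewrite /primitive; case: cid2. Qed.

Definition symbol : tensor_field A :=
  fun x a s => (-1) ^+ r * delta (mv_fun A (primitive a)) x s.
Arguments symbol : clear implicits.

Lemma sign_nat_sqr k : (-1) ^+ k * (-1) ^+ k = 1 :> R.
Proof. by rewrite -exprMn mulrNN mulr1 expr1n. Qed.

Lemma symbol_differential x f s : smooth f ->
  symbol x (differential f x) s = (-1) ^+ r * delta (mv_fun A f) x s.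
Proof.
move=> sf; congr (_ * _); apply: delta_fun_eq => //; first exact: primitive_smooth.
exact: primitive_differential.
Qed.

Lemma symbolP f : smooth f -> delta (mv_fun A f) = mv_scale ((-1) ^+ r) (iota_d f symbol).
Proof.
move=> sf; apply: mvext => x s; rewrite /mv_scale /iota_d symbol_differential //.
by rewrite mulrA sign_nat_sqr mul1r.
Qed.

(** Near a point, dx x0 j is the differential of one globally defined
    function F, so the components of the symbol are those of the smooth field
    delta F. *)
Lemma symbol_section : is_top_tensor_section symbol.
Proof.
split=> [x c a b s|x a|x0 x1 j I].
- have sa := primitive_smooth a; have sb := primitive_smooth b.
  have sab := primitive_smooth (c *: a + b).
  have sl : smooth (fun z => c * primitive a z + primitive b z).
    by apply: smoothD => //; apply: smoothM => //; exact: smooth_cst.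
  rewrite /symbol (delta_fun_eq s sab sl); last first.
    rewrite primitive_differential; move/smoothP: sa => sa; move/smoothP: sb => sb.
    rewrite differentialD ?differentialZ ?primitive_differential //.
    by apply: smooth_atM => //; exact: smooth_at_cst.
  by rewrite (pd_linear (delta_derivation s)) //; ring.
- by apply: in_extZ; apply: Gamma_in_ext; apply: Gamma_delta_fun; exact: primitive_smooth.
apply/smooth_on_at; first by apply: openI; [exact: dom_open|exact: bdom_open].
move=> y [d0 d1]; have [F sF eF] := germ_extension (smooth_at_coord j d0).
have [_ H] := (GammaP _ _).1 (Gamma_delta_fun sF).
have := smooth_atM (smooth_at_cst ((-1) ^+ r) y) (H x1 I y d1).
apply: smooth_at_eq; have [U [oU Uy] UF] := near_open eF.
have : nbhs y U by exact: open_nbhs_nbhs.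
apply: filterS => z Uz; rewrite -symbol_differential //; congr symbol.
rewrite /dx; apply: differential_eq.
have : nbhs z U by exact: open_nbhs_nbhs.
by apply: filterS => t; exact: UF.
Qed.

(** Nonvanishing is an open condition and excludes a nonzero anchor, so the
    anchor is zero near a point x where the symbol does not vanish; then
    rho(u) f = 0 near x and [dcoef_rho] is reduced to dcoef x f * tr (ad_u) =
    0. *)
Lemma symbol_admissible : admissible L symbol.
Proof.
split; first exact: symbol_section.
- move=> x an0 a s; rewrite /symbol delta_fun_anchor_neq0 ?mulr0 //.
  exact: primitive_smooth.
move=> x a0 [m [Hm [a ca]]]; apply: contrapT => nv; apply: ca.
have [chi bc] := bump_exists (bdom_open A x) (bdom_center A x).
have [b nb] : exists b, ~ forall s, symbol x b s = 0.
  by apply: contrapT => /forallNP H; apply: nv => b s; have /contrapT := H b; apply.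
set f := primitive b; have sf : smooth f := primitive_smooth b.
have z0 : dcoef x f != 0.
  apply/eqP => z0; apply: nb => s; rewrite /symbol.
  by rewrite (in_ext_top (coframe_decomp (bdom_center A x)) (Gamma_in_ext x (Gamma_delta_fun
    sf)) z0) mulr0.
(* A nonzero anchor at y would make the symbol vanish at y. *)
have near0 : \forall y \near x, anchor L y = 0.
  have := nonvanishing_near symbol_section nv; apply: filterS => y ny.
  apply: contrapT => an0; apply: ny => c s; rewrite /symbol delta_fun_anchor_neq0 ?mulr0 //.
  exact: primitive_smooth.
pose u := extend chi a; have su : smooth_section u := smooth_extend bc a.
have := dcoef_rho bc su sf; rewrite (rho_anchor0 _ _ a0) add0r.
rewrite (_ : dcoef x _ = 0); last first.
  have D := delta_derivation [seq coframe A x i x | i <- enum 'I_r].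
  rewrite /dcoef /top_coef (pd_local D (g := fun=> 0)) ?(pd_cst D) //.
  - exact: rho_smooth.
  - exact: smooth_cst.
  by apply: filterS near0 => y ay; exact: rho_anchor0.
move/esym/eqP; rewrite mulf_eq0 (negbTE z0) /= => /eqP.
by rewrite (frame_trace_adjoint bc su Hm) /u extend_center.
Qed.
End Direct.
End Correspondence.

(** * From a tensor to a differential *)

Section Converse.
Local Open Scope classical_set_scope.
Local Open Scope ring_scope.
Context {R : realType} {n : nat} {M : manifold R n} {r : nat} {A : vbundle M r}.
Variable L : lie_algebroid A.
Variable S : mvfield A -> mvfield A -> mvfield A.
Arguments S : clear implicits.
Hypothesis hS : is_schouten_bracket L S.
Variable pi : tensor_field A.
Arguments pi : clear implicits.
Hypothesis Hpi : admissible L pi.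
Implicit Types (x y z : M) (f g h : M -> R) (u v w : section A) (X Y Z : mvfield A) (p q : int).

Lemma admissible_tensor : is_top_tensor_section pi.
Proof. by case: Hpi. Qed.
Local Notation tpi := admissible_tensor.

(** The analogue of the Hamiltonian vector field of f. *)
Definition ham f : mvfield A := mv_scale ((-1) ^+ r) (iota_d f pi).
Arguments ham : clear implicits.

Lemma Gamma_ham f : smooth f -> Gamma r%:Z (ham f).
Proof. by move=> sf; apply: Gamma_scale; exact: Gamma_iota tpi _ sf. Qed.

Lemma ham_vanish f x s : vanishes_at pi x -> ham f x s = 0.
Proof. by move=> v; rewrite /ham /mv_scale /iota_d v mulr0. Qed.

Lemma nonvanish_anchor0 x : ~ vanishes_at pi x -> anchor L x = 0.
Proof. by move=> nv; apply: contrapT => an0; apply: nv; case: Hpi => _ H _; exact: H. Qed.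

(** Both sides are top forms, so only the coefficient matters. Where pi is
    nonzero the anchor is zero nearby and tr (ad_u) = 0. Where pi is zero at
    x, the derivative rho(u) z is zero at x as well: either rho is zero at x,
    or pi vanishes near x. *)
Lemma ham_rho u f : smooth_section u -> smooth f ->
  S (mv_section u) (ham f) = ham (rho L u f).
Proof.
move=> su sf; apply/functional_extensionality_dep => x.
have GS : Gamma r%:Z (S (mv_section u) (ham f)).
  have := schouten_degree hS (Gamma_section su) (Gamma_ham sf).
  by rewrite addrAC subrr add0r.
have GH := Gamma_ham (rho_smooth L su sf).
have [chi bc] := bump_exists (bdom_open A x) (bdom_center A x).
apply: (in_ext_top_eq (coframe_decomp (bdom_center A x)) (Gamma_in_ext x GS) (Gamma_in_ext x GH)).
rewrite -[LHS]/(top_coef x _ x) (schouten_top bc hS su (Gamma_ham sf)).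
have [v|nv] := pselect (vanishes_at pi x).
  rewrite /top_coef !ham_vanish // mul0r addr0.
  have [a0|an0] := pselect (anchor L x = 0); first exact: rho_anchor0.
  rewrite (@rho_near _ _ _ _ _ L u _ (fun=> 0)) ?rho_cst //.
  apply: filterS (anchor_neq0_near an0) => y any; rewrite ham_vanish ?mulr0 //.
  by case: Hpi => _ H _; exact: H.
have a0 := nonvanish_anchor0 nv; rewrite rho_anchor0 // add0r.
have -> : frame_trace L x chi u = 0.
  have Hm := induced_bracketP bc a0; rewrite (frame_trace_adjoint bc su Hm).
  apply: contrapT => ne; apply: nv; case: Hpi => _ _ H; apply: H => //.
  by exists (induced_bracket L chi); split=> //; exists (u x).
rewrite mulr0 /ham /mv_scale /iota_d (differential_eq (g := fun=> 0)).
  by rewrite differential_cst (tensor0 tpi) mulr0.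
apply: filterS (nonvanishing_near tpi nv) => y nvy; apply: rho_anchor0.
exact: nonvanish_anchor0.
Qed.

Lemma schouten_ham_fun f g : smooth f -> smooth g -> S (mv_fun A g) (ham f) = mv0 A.
Proof.
move=> sf sg; apply: mvext => x s.
have [chi bc] := bump_exists (bdom_open A x) (bdom_center A x).
apply: (schouten_fun_top bc hS) => //; first exact: Gamma_ham.
have [v|nv] := pselect (vanishes_at pi x); [right=> t; exact: ham_vanish|left].
exact: nonvanish_anchor0.
Qed.

Lemma Gamma_value_smooth p X : Gamma p X -> smooth (fun x => X x [::]).
Proof.
by move=> /GammaP[_ H]; apply/smoothP => y; exact: (H y [::] y (bdom_center A y)).
Qed.

(** A form of nonzero degree is zero on the empty list, so this map is zero
    outside degree 0. *)
Definition ham_differential X : mvfield A := ham (fun x => X x [::]).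
Arguments ham_differential : clear implicits.
Local Notation delta := ham_differential.

Lemma ham_differential_fun f : delta (mv_fun A f) = ham f.
Proof. by []. Qed.

Lemma ham0 : ham (fun=> 0) = mv0 A.
Proof.
by apply: mvext => x s; rewrite /ham /mv_scale /iota_d differential_cst (tensor0 tpi) mulr0.
Qed.

Lemma ham_differential_neq0 p X : Gamma p X -> p <> 0 -> delta X = mv0 A.
Proof.
move=> GX p0; rewrite /ham_differential (_ : (fun x => _) = fun=> 0) ?ham0 //.
apply/funext => x; apply: (in_ext_degree (Gamma_in_ext x GX)) => /= e; exact: p0.
Qed.

Lemma Gamma_ham_differential p X : Gamma p X -> Gamma (p + r%:Z) (delta X).
Proof.
move=> GX; have [e|ne] := pselect (p = 0); last first.
  by rewrite (ham_differential_neq0 GX ne); exact: Gamma0.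
by rewrite e add0r; apply: Gamma_ham; exact: Gamma_value_smooth GX.
Qed.

Lemma ham_differential_linear p c X Y : Gamma p X -> Gamma p Y ->
  delta (mv_add (mv_scale c X) Y) = mv_add (mv_scale c (delta X)) (delta Y).
Proof.
move=> GX GY; have /smoothP sX := Gamma_value_smooth GX.
have /smoothP sY := Gamma_value_smooth GY.
apply: mvext => x s; rewrite /ham_differential /ham /mv_add /mv_scale /iota_d.
rewrite differentialD ?differentialZ //; last by apply: smooth_atM => //; exact: smooth_at_cst.
by rewrite (tensor_linear tpi); ring.
Qed.

Lemma mv_wedge0l Y : mv_wedge (mv0 A) Y = mv0 A.
Proof. by apply: mvext => x s; exact: wedge0l. Qed.

Lemma mv_wedge0r X : mv_wedge X (mv0 A) = mv0 A.
Proof. by apply: mvext => x s; exact: wedge0r. Qed.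

Lemma wedge_ham_differential_l p q X Y : Gamma p X -> Gamma q Y -> q <> 0 ->
  mv_wedge (delta X) Y = mv0 A.
Proof.
move=> GX GY q0; have [p0|p0] := pselect (p = 0); last first.
  by rewrite (ham_differential_neq0 GX p0) mv_wedge0l.
have [qn|qp|] := ltrgtP q 0; [by rewrite (Gamma_neg GY qn) mv_wedge0r| |by []].
have := Gamma_wedge (Gamma_ham_differential GX) GY => /Gamma_gt; apply.
by rewrite p0 add0r ltrDl.
Qed.

Lemma wedge_ham_differential_r p q X Y : Gamma p X -> Gamma q Y -> p <> 0 ->
  mv_wedge X (delta Y) = mv0 A.
Proof.
move=> GX GY p0; have [q0|q0] := pselect (q = 0); last first.
  by rewrite (ham_differential_neq0 GY q0) mv_wedge0r.
have [pn|pp|] := ltrgtP p 0; [by rewrite (Gamma_neg GX pn) mv_wedge0l| |by []].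
have := Gamma_wedge GX (Gamma_ham_differential GY) => /Gamma_gt; apply.
by rewrite q0 add0r ltrDr.
Qed.

Lemma ham_differential_wedge p q X Y : Gamma p X -> Gamma q Y ->
  delta (mv_wedge X Y) = mv_add (mv_wedge (delta X) Y)
    (mv_scale ((-1) ^ ((r.+1%:Z - 1) * p)) (mv_wedge X (delta Y))).
Proof.
move=> GX GY; have e0 c : mv_add (mv0 A) (mv_scale c (mv0 A)) = mv0 A.
  by apply: mvext => x s; rewrite /mv_add /mv_scale /mv0 mulr0 addr0.
have eW : (fun x => @mv_wedge _ _ _ _ _ X Y x [::]) = fun x => X x [::] * Y x [::].
  by apply/funext => x; exact: wedge_nil.
have [p0|p0] := pselect (p = 0); last first.
  rewrite (ham_differential_neq0 GX p0) mv_wedge0l (wedge_ham_differential_r GX GY p0) e0.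
  rewrite /ham_differential eW -ham0; congr ham; apply/funext => x.
  by rewrite (in_ext_degree (Gamma_in_ext x GX)) ?mul0r // => e; exact: p0.
have [q0|q0] := pselect (q = 0); last first.
  rewrite (ham_differential_neq0 GY q0) mv_wedge0r (wedge_ham_differential_l GX GY q0) e0.
  rewrite /ham_differential eW -ham0; congr ham; apply/funext => x.
  by rewrite (in_ext_degree (Gamma_in_ext x GY)) ?mulr0 // => e; exact: q0.
subst p q; have [sX eX] := Gamma0E GX; have [sY eY] := Gamma0E GY.
rewrite [X in mv_wedge X (delta Y)]eX [X in mv_wedge (delta _) X]eY mv_wedge_funl.
rewrite (mv_wedge_funr _ (Gamma_ham_differential GX)) mulr0 expr0z.
move/smoothP: sX => sX; move/smoothP: sY => sY.
apply: mvext => x s; rewrite /ham_differential eW /ham /mv_add /mv_scale /iota_d.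
rewrite differentialM // (tensor_linear tpi) -[_ *: differential _ _]addr0 (tensor_linear tpi).
by rewrite (tensor0 tpi); ring.
Qed.

(** In degree q > 1 the bracket has degree larger than r; for q = 0 it
    vanishes pointwise by [schouten_ham_fun]. *)
Lemma schouten_ham_l p q X Y : Gamma p X -> Gamma q Y -> ~ (p = 0 /\ q = 1) ->
  S (delta X) Y = mv0 A.
Proof.
move=> GX GY npq; have [p0|p0] := pselect (p = 0); last first.
  by rewrite (ham_differential_neq0 GX p0) (schouten0l hS GY).
have [qn|qp|q0] := ltrgtP q 0.
- by rewrite (Gamma_neg GY qn) (schouten0r hS (Gamma_ham_differential GX)).
- have := schouten_degree hS (Gamma_ham_differential GX) GY => /Gamma_gt; apply.
  have : q <> 1 by move=> q1; apply: npq.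
  by rewrite p0; lia.
subst p q; have [sX eX] := Gamma0E GX; have [sY eY] := Gamma0E GY.
rewrite (schouten_antisym hS (Gamma_ham_differential GX) GY) [X in S X _]eY.
rewrite /ham_differential schouten_ham_fun //.
by apply: mvext => x s; rewrite /mv_scale mulr0.
Qed.

Lemma schouten_ham_r p q X Y : Gamma p X -> Gamma q Y -> ~ (p = 1 /\ q = 0) ->
  S X (delta Y) = mv0 A.
Proof.
move=> GX GY npq; rewrite (schouten_antisym hS GX (Gamma_ham_differential GY)).
rewrite (schouten_ham_l GY GX); first by apply: mvext => x s; rewrite /mv_scale mulr0.
by move=> [q0 p1]; apply: npq.
Qed.

Lemma ham_differential_bracket p q X Y : Gamma p X -> Gamma q Y ->
  delta (S X Y) = mv_add (S (delta X) Y)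
    (mv_scale ((-1) ^ ((r.+1%:Z - 1) * (p - 1))) (S X (delta Y))).
Proof.
move=> GX GY.
have e0 c : mv_add (mv0 A) (mv_scale c (mv0 A)) = mv0 A.
  by apply: mvext => x s; rewrite /mv_add /mv_scale /mv0 mulr0 addr0.
have [[p0 q1]|n01] := pselect (p = 0 /\ q = 1).
  subst p q; rewrite (schouten_ham_r GX GY) //; last by case.
  have [sX eX] := Gamma0E GX; have [v sv eY] := Gamma1E GY.
  rewrite (schouten_antisym hS GX GY) (schouten_antisym hS (Gamma_ham_differential GX) GY).
  rewrite eX eY (schouten_fun hS) // ham_differential_fun ham_rho //.
  rewrite !subrr !mulr0 expr0z.
  have sr := rho_smooth L sv sX.
  have := ham_differential_linear (-1) (Gamma_fun sr) (Gamma0 0).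
  rewrite ham_differential_fun (_ : mv_add _ _ = mv_scale (-1) (mv_fun A (rho L v (fun x => X x
    [::])))).
    rewrite -/(rho L v _) => ->.
    apply: mvext => x s; rewrite /mv_add /mv_scale.
    by rewrite (ham_differential_neq0 (Gamma0 1)) // /mv0 mulr0.
  by apply: mvext => x s; rewrite /mv_add addr0.
rewrite (schouten_ham_l GX GY n01).
have [[p1 q0]|n10] := pselect (p = 1 /\ q = 0).
  subst p q; have [u su eX] := Gamma1E GX; have [sY eY] := Gamma0E GY.
  rewrite eX eY (schouten_fun hS) // !ham_differential_fun ham_rho //.
  by apply: mvext => x s; rewrite /mv_add /mv_scale subrr mulr0 expr0z mul1r add0r.
rewrite (schouten_ham_r GX GY n10) e0.
have GS := schouten_degree hS GX GY.
have [e|ne] := pselect (p + q - 1 = 0); last exact: ham_differential_neq0 GS ne.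
suff -> : S X Y = mv0 A by apply: (ham_differential_neq0 (Gamma0 1)).
have [pn|pp] := ltP p 0; first by rewrite (Gamma_neg GX pn) (schouten0l hS GY).
have [qn|qp] := ltP q 0; first by rewrite (Gamma_neg GY qn) (schouten0r hS GX).
by exfalso; have [] : (p = 0 /\ q = 1) \/ (p = 1 /\ q = 0) by lia.
Qed.

Lemma ham_differentialP : is_differential S r.+1 delta.
Proof.
split.
- by move=> p X GX; rewrite shift_degree; exact: Gamma_ham_differential.
- exact: ham_differential_linear.
- exact: ham_differential_wedge.
- exact: ham_differential_bracket.
Qed.

Lemma ham_differential_unique (delta' : mvfield A -> mvfield A) :
  is_differential S r.+1 delta' ->
  (forall f, smooth f -> delta' (mv_fun A f) = ham f) ->
  forall p X, Gamma p X -> delta' X = delta X.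
Proof.
move=> Hd e p X GX; have [pn|pp|p0] := ltrgtP p 0.
- rewrite (ham_differential_neq0 GX) ?(Gamma_neg GX pn) ?(delta0 Hd) //.
  by move=> p0; rewrite p0 ltxx in pn.
- rewrite (delta_pos Hd GX pp) (ham_differential_neq0 GX) // => p0.
  by rewrite p0 ltxx in pp.
by subst p; have [sX ->] := Gamma0E GX; rewrite e.
Qed.
End Converse.

Section Uniqueness.
Local Open Scope ring_scope.
Context {R : realType} {n : nat} {M : manifold R n} {r : nat} {A : vbundle M r}.

Lemma tensor_determined (pi pi' : tensor_field A) :
  (forall f : M -> R, smooth f ->
     mv_scale ((-1) ^+ r) (iota_d f pi) = mv_scale ((-1) ^+ r) (iota_d f pi')) ->
  pi = pi'.
Proof.
move=> e; apply/functional_extensionality_dep => x; apply/funext => a; apply/funext => s.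
have [f sf <-] := covector_differential a.
have := congr1 (fun X : mvfield A => X x s) (e f sf); rewrite /mv_scale /iota_d => H.
have sq : (-1) ^+ r * (-1) ^+ r = 1 :> R by rewrite -exprMn mulrNN mulr1 expr1n.
by rewrite -[LHS]mul1r -sq -mulrA H mulrA sq mul1r.
Qed.
End Uniqueness.

Theorem theorem6p6 (R : realType) (n top : nat) (M : manifold R n)
    (A : vbundle M top) (L : lie_algebroid A)
    (S : mvfield A -> mvfield A -> mvfield A) (hS : is_schouten_bracket L S) :
  (forall delta : mvfield A -> mvfield A, is_differential S top.+1 delta ->
     (forall u : section A, smooth_section u ->
        delta (mv_section u) = mv0 A) /\
     exists! pi : tensor_field A,
       admissible L pi /\
       forall f : M -> R, smooth f ->
         delta (mv_fun A f) = mv_scale ((-1) ^+ top) (iota_d f pi))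
  /\
  (forall pi : tensor_field A, admissible L pi ->
     exists delta : mvfield A -> mvfield A,
       [/\ is_differential S top.+1 delta,
           forall u : section A, smooth_section u ->
             delta (mv_section u) = mv0 A,
           forall f : M -> R, smooth f ->
             delta (mv_fun A f) = mv_scale ((-1) ^+ top) (iota_d f pi)
         & forall delta' : mvfield A -> mvfield A,
             is_differential S top.+1 delta' ->
             (forall f : M -> R, smooth f ->
                delta' (mv_fun A f) =
                mv_scale ((-1) ^+ top) (iota_d f pi)) ->
             forall (p : int) (X : mvfield A), Gamma p X ->
               delta' X = delta X]).
Proof.
split=> [delta Hd|pi Hpi].
  split; first exact: delta_section Hd.
  exists (symbol delta); split.
    by split; [exact: symbol_admissible hS _ Hd|exact: symbolP Hd].
  move=> pi' [_ H]; apply: tensor_determined => f sf.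
  by rewrite -H // (symbolP Hd).
exists (ham_differential pi); split.
- exact: ham_differentialP hS _ Hpi.
- by move=> u su; exact: (delta_section (ham_differentialP hS Hpi)).
- by move=> f sf.
- by move=> delta' Hd' e p X GX; exact: (ham_differential_unique Hpi Hd' e GX).
Qed.
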